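(* Let $\varphi\in\operatorname{Diff}_{\mathcal S}(\mathbb R)$, $q=\beta(\varphi)$, $u=\log\varphi'$, $\psi=e^{-u/2}$, fix $x_0\in\mathbb R$, and let \[ \widetilde\psi(x)=\psi(x)\int_{x_0}^x\psi(t)^{-2}\,dt,\qquad \Lambda_1(v)=\int_{\mathbb R}\psi^2 v\,dx,\qquad \Lambda_2(v)=\int_{\mathbb R}\psi\widetilde\psi\,v\,dx . \] Then: (a) The range of $D\beta_u\colon\mathcal S(\mathbb R;\mathbb R)\to\mathcal S(\mathbb R;\mathbb R)$ is $\ker\Lambda_1\cap\ker\Lambda_2$ (kernels taken in $\mathcal S(\mathbb R;\mathbb R)$), and this range is closed and split of codimension two. (b) The functional $\Lambda_1$ is the first variation of $W\bigl(f_-(\cdot,0),f_+(\cdot,0)\bigr)$: for every $v\in\mathcal S(\mathbb R;\mathbb R)$, writing $f_\pm^{\varepsilon}(\cdot,0)$ for the zero-energy Jost solutions of the potential $q+\varepsilon v$, \[ \frac{d}{d\varepsilon}\Big|_{\varepsilon=0}W\bigl(f_-^{\varepsilon}(\cdot,0),f_+^{\varepsilon}(\cdot,0)\bigr)=\Lambda_1(v). \] (c) On $\ker\Lambda_1$ the functional $\Lambda_2$ is the first variation of $R_q(0)$, in the following sense: for every $v\in\mathcal S(\mathbb R;\mathbb R)$ with $\Lambda_1(v)=0$ there is a smooth curve $\varepsilon\mapsto q_\varepsilon\in\mathcal S(\mathbb R;\mathbb R)$, defined for small $\varepsilon$, of potentials that are exceptional at zero energy and for which $H_{q_\varepsilon}$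 has no negative eigenvalues, with $q_0=q$ and $\frac{d}{d\varepsilon}|_{\varepsilon=0}q_\varepsilon=v$, along which $R_{q_\varepsilon}(0)=\varepsilon\Lambda_2(v)+O(\varepsilon^2)$. (d) For every integer $k\ge 0$, the range of $D\beta_u\colon W^{k+2,1}(\mathbb R)\to W^{k,1}(\mathbb R)$ is not closed, and the closure of that range in $W^{k,1}(\mathbb R)$ is $\ker\Lambda_1=\{v\in W^{k,1}(\mathbb R):\Lambda_1(v)=0\}$.
   Context: $\mathcal S(\mathbb R;\mathbb R)$ is the space of real-valued Schwartz functions on $\mathbb R$; $W^{k,1}(\mathbb R)$ is the Sobolev space of (real-valued) functions whose derivatives of order $\le k$ lie in $L^1(\mathbb R)$. $\operatorname{Diff}_{\mathcal S}(\mathbb R)$ is the set of orientation-preserving diffeomorphisms $\varphi$ of $\mathbb R$ with $\varphi'-1\in\mathcal S(\mathbb R;\mathbb R)$ and $\varphi(x)-x\to 0$ as $x\to-\infty$. The map $\varphi\mapsto u=\log\varphi'$ is a bijection of $\operatorname{Diff}_{\mathcal S}(\mathbb R)$ onto $\mathcal S(\mathbb R;\mathbb R)$. The real Bers map is $\beta(\varphi)=\tfrac12\left(\frac{\varphi'''}{\varphi'}-\frac32\left(\frac{\varphi''}{\varphi'}\right)^2\right)$; in terms of $u=\log\varphi'$ it is $u\mapsto\tfrac12u''-\tfrac14(u')^2$, and its differential at $u$ is \[ D\beta_u(\delta u)=\tfrac12\bigl(\delta u''-u'\,\delta u'\bigr). \] A closed subspace is split if it has a closed complementary subspace. Wronskian: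 $W(f,g)=fg'-f'g$ (so $W(\psi,\widetilde\psi)=1$). For $q\in\mathcal S(\mathbb R;\mathbb R)$, $H_q=-\partial_x^2-q$ on $L^2(\mathbb R)$ (note the sign of $q$). For real $k$ the Jost solutions $f_\pm(\cdot,k)$ are the solutions of $-y''-qy=k^2y$ fixed by $f_+(x,k)=e^{ikx}(1+o(1))$ as $x\to+\infty$ and $f_-(x,k)=e^{-ikx}(1+o(1))$ as $x\to-\infty$ (at $k=0$, $f_\pm(x,0)\to1$ as $x\to\pm\infty$). The potential $q$ is exceptional at zero energy if $W(f_-(\cdot,0),f_+(\cdot,0))=0$. For real $k\ne 0$ the coefficients $a_q(k),b_q(k)$ are defined by $f_-(x,k)=a_q(k)f_+(x,-k)+b_q(k)f_+(x,k)$, and $R_q(k)=b_q(k)/a_q(k)$ is the reflection coefficient; $R_q(0)$ is its limit as $k\to 0$ along the real axis. *)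

(* Defs.v *)
From HB Require Import structures.
From mathcomp Require Import all_boot all_order ssralg ssrnum ssrint interval.
From mathcomp Require Import complex.
From mathcomp Require Import all_classical all_reals all_analysis.

Set Implicit Arguments.
Unset Strict Implicit.
Unset Printing Implicit Defensive.

Import Order.TTheory GRing.Theory Num.Theory.
Import numFieldNormedType.Exports.

Local Open Scope classical_set_scope.
Local Open Scope ring_scope.

(* [Rcomplex R] is the alias of R[i] that carries an R-vector space structure
   and the R-valued modulus; with the metric of the modulus it becomes a normed
   R-module, so that the library's limits and derivatives apply to functions
   R -> Rcomplex R. *)
Section Rcomplex_normedMod.
Variable R : realType.

HB.instance Definition _ :=
  PseudoMetric.copy (Rcomplex R) (pseudoMetric_normed (Rcomplex R)).
HB.instance Definition _ := isPointed.Build (Rcomplex R) 0.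
HB.instance Definition _ :=
  NormedZmod_PseudoMetric_eq.Build R (Rcomplex R) erefl.

Lemma Rcomplex_normrZ (l : R) (z : Rcomplex R) : `|l *: z| = `|l| * `|z|.
Proof.
case: z => a b.
rewrite /Num.norm /= !exprMn -mulrDr sqrtrM ?sqr_ge0 // sqrtr_sqr.
by [].
Qed.

HB.instance Definition _ :=
  PseudoMetricNormedZmod_Lmodule_isNormedModule.Build R (Rcomplex R)
    Rcomplex_normrZ.

End Rcomplex_normedMod.

Section smooth.
Variable R : realType.
Implicit Types f g : R -> R.

Definition smooth f := forall n x, derivable (f^`(n)) x 1.

Definition test_function f :=
  smooth f /\ exists M : R, forall x, M < `|x| -> f x = 0.

Lemma derive1n_linear (a : R) f g n : smooth f -> smooth g ->
  (a *: f + g)^`(n) = a *: f^`(n) + g^`(n).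
Proof.
move=> sf sg; elim: n => [//|n IH].
rewrite !derive1nS IH; apply/funext => x; rewrite !fctE !derive1E.
have df := sf n x; have dg := sg n x.
by rewrite deriveD ?deriveZ //; exact: derivableZ.
Qed.

Lemma smooth_linear (a : R) f g : smooth f -> smooth g -> smooth (a *: f + g).
Proof.
move=> sf sg n x; rewrite derive1n_linear //.
by apply: derivableD; [apply: derivableZ; exact: sf|exact: sg].
Qed.

Lemma derive1n_cst0 n : (0 : R -> R)^`(n) = 0.
Proof.
elim: n => [//|n IH]; rewrite derive1nS IH; apply/funext => x.
by rewrite derive1E -[LHS]/('D_1 (cst 0) x) derive_cst.
Qed.

End smooth.

Section schwartz.
Variable R : realType.
Implicit Types f g : R -> R.

Definition rapidly_decreasing f := forall m n : nat,
  exists C : R, forall x, `|x| ^+ m * `|f^`(n) x| <= C.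

Definition schwartz : {pred (R -> R)} :=
  mem [set f | smooth f /\ rapidly_decreasing f].

Lemma schwartz_submod_closed : submod_closed schwartz.
Proof.
split=> [|a f g].
  rewrite inE /=; split=> [n x|m n].
    by rewrite derive1n_cst0; exact: derivable_cst.
  by exists 0 => x; rewrite derive1n_cst0 normr0 mulr0.
rewrite !inE /= => -[sf df] [sg dg]; split; first exact: smooth_linear.
move=> m n; have [C1 hC1] := df m n; have [C2 hC2] := dg m n.
exists (`|a| * C1 + C2) => x; rewrite derive1n_linear //.
apply: (@le_trans _ _ (`|x| ^+ m * (`|a| * `|f^`(n) x| + `|g^`(n) x|))).
  by rewrite ler_wpM2l ?exprn_ge0 // (le_trans (ler_normD _ _)) // normrM.
by rewrite mulrDr mulrCA lerD // ler_wpM2l.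
Qed.

HB.instance Definition _ :=
  GRing.isSubmodClosed.Build R (R -> R) schwartz schwartz_submod_closed.

Record schwartzType :=
  Schwartz { schwartz_fun :> R -> R; _ : schwartz_fun \in schwartz }.

HB.instance Definition _ := [isSub for schwartz_fun].
HB.instance Definition _ := [Choice of schwartzType by <:].
HB.instance Definition _ := [SubChoice_isSubLmodule of schwartzType by <:].
HB.instance Definition _ := isPointed.Build schwartzType 0.

Definition schwartz_seminorm (m n : nat) f : R :=
  sup [set `|x| ^+ m * `|f^`(n) x| | x in [set: R]].

(* The locally convex topology of the seminorms: the open balls of all
   seminorms around all points form a subbase. *)
HB.instance Definition _ := @isSubBaseTopological.Build schwartzType
  (schwartzType * (nat * nat) * R)%type
  [set i | 0 < i.2]
  (fun i => [set g : schwartzType |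
    schwartz_seminorm i.1.2.1 i.1.2.2 (g - i.1.1 : schwartzType) < i.2]).

End schwartz.

Section subspaces.
Variables (R : realType) (V : preTopologicalLmodType R).
Implicit Types A B : set V.

Definition linear_subspace A :=
  A 0 /\ forall (a : R) v w, A v -> A w -> A (a *: v + w).

(* the classes of e_0, ..., e_(n-1) form a basis of V / A *)
Definition codimension (n : nat) A :=
  exists e : 'I_n -> V, forall v,
    exists! c : {ffun 'I_n -> R}, A (v - \sum_(i < n) c i *: e i).

Definition split_subspace A :=
  [/\ linear_subspace A, closed A &
    exists B, [/\ linear_subspace B, closed B, A `&` B = [set 0] &
                  [set v + w | v in A & w in B] = setT]].

Definition curve_derivative (c : R -> V) (t : R) (l : V) :=
  (fun h => h^-1 *: (c (t + h) - c t)) @ 0^' --> l.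

Definition smooth_curve_on (I : set R) (c : R -> V) :=
  exists2 D : nat -> R -> V, D 0%N = c &
    forall n t, I t -> curve_derivative (D n) t (D n.+1 t).

End subspaces.

Section sobolev.
Variable R : realType.
Local Notation mu := (@lebesgue_measure R).
Implicit Types f g : R -> R.

Definition is_weak_derivative (j : nat) f g :=
  locally_integrable setT g /\
  forall phi : R -> R, test_function phi ->
    \int[mu]_x (f x * phi^`(j) x) = (-1) ^+ j * \int[mu]_x (g x * phi x).

(* a representative; it is determined up to a null set *)
Definition weak_derivative (j : nat) f : R -> R :=
  xget (cst 0) [set g | is_weak_derivative j f g].

Definition sobolev (k : nat) (p : \bar R) : set (R -> R) :=
  [set f | f \in Lfun mu p /\
    forall j, (j <= k)%N ->
      exists2 g, g \in Lfun mu p & is_weak_derivative j f g].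

Definition sobolev1_norm (k : nat) f : R :=
  \sum_(j < k.+1) \int[mu]_x `|weak_derivative j f x|.

(* W^{k,1}(R); its elements are functions rather than classes modulo null sets,
   so the W^{k,1} norm is a seminorm here. Open and closed sets of its topology
   are invariant under modification on null sets and correspond to those of the
   quotient. *)
Record sobolev1Type (k : nat) :=
  Sobolev1 { sobolev1_fun :> R -> R; _ : sobolev1_fun \in sobolev k 1%E }.

Section instances.
Variable k : nat.

HB.instance Definition _ := [isSub for @sobolev1_fun k].
HB.instance Definition _ := [Choice of sobolev1Type k by <:].
HB.instance Definition _ := @isSubBaseTopological.Build (sobolev1Type k)
  ((R -> R) * R)%type
  [set i | sobolev k 1 i.1 /\ 0 < i.2]
  (fun i => [set g : sobolev1Type k |
    sobolev1_norm k (fun x => g x - i.1 x) < i.2]).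

End instances.
End sobolev.

Section bers.
Variable R : realType.
Local Notation mu := (@lebesgue_measure R).
Implicit Types phi u h v : R -> R.

Definition diffeo_schwartz phi :=
  [/\ smooth phi,
      exists g, [/\ smooth g, cancel phi g & cancel g phi],
      {homo phi : x y / x < y},
      (fun x => phi^`() x - 1) \in @schwartz R &
      phi x - x @[x --> -oo%R] --> (0 : R)].

Definition log_derivative phi : R -> R := fun x => ln (phi^`() x).

Definition bers phi : R -> R := fun x =>
  2^-1 * (phi^`(3) x / phi^`() x
          - 3 / 2 * (phi^`(2) x / phi^`() x) ^+ 2).

Definition Dbers u h : R -> R := fun x =>
  2^-1 * (h^`(2) x - u^`() x * h^`() x).

Definition Dbers_weak u h : R -> R := fun x =>
  2^-1 * (weak_derivative 2 h x - u^`() x * weak_derivative 1 h x).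

Definition range_Dbers_sobolev u (k : nat) : set (sobolev1Type R k) :=
  [set v | exists2 h, sobolev k.+2 1 h &
    (v : R -> R) = Dbers_weak u h %[ae mu]].

Definition oriented_integral (a b : R) (f : R -> R) : R :=
  if a <= b then \int[mu]_(t in `[a, b]) f t
  else - \int[mu]_(t in `[b, a]) f t.

Definition psi u : R -> R := fun x => expR (- (u x / 2)).

Definition psi_tilde u (x0 : R) : R -> R := fun x =>
  psi u x * oriented_integral x0 x (fun t => (psi u t) ^- 2).

Definition Lambda1 u v : R := \int[mu]_x (psi u x ^+ 2 * v x).

Definition Lambda2 u (x0 : R) v : R :=
  \int[mu]_x (psi u x * psi_tilde u x0 x * v x).

End bers.

(* Sign convention: H_q = - d^2/dx^2 - q. *)
Section scattering.
Variable R : realType.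
Local Notation mu := (@lebesgue_measure R).
Local Notation C := (Rcomplex R).
Implicit Types (q : R -> R) (f g : R -> C) (k : R).

Definition expi (t : R) : C := Complex (cos t) (sin t).

Definition schrodinger_solution q k f :=
  forall x, [/\ derivable f x 1, derivable f^`() x 1 &
    - f^`(2) x - q x *: f x = (k ^+ 2) *: f x].

Definition is_jost_plus q k f :=
  schrodinger_solution q k f /\
  f x / expi (k * x) @[x --> +oo%R] --> (1 : C).

Definition is_jost_minus q k f :=
  schrodinger_solution q k f /\
  f x / expi (- (k * x)) @[x --> -oo%R] --> (1 : C).

(* xget picks the solution, which exists and is unique for Schwartz q *)
Definition jost_plus q k : R -> C := xget (cst 0) [set f | is_jost_plus q k f].
Definition jost_minus q k : R -> C :=
  xget (cst 0) [set f | is_jost_minus q k f].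

Definition wronskian f g : R -> C := fun x => f x * g^`() x - f^`() x * g x.

(* W(f_-(.,0), f_+(.,0)), a constant function of x *)
Definition jost_wronskian0 q : R -> C :=
  wronskian (jost_minus q 0) (jost_plus q 0).

Definition exceptional q := forall x, jost_wronskian0 q x = 0.

(* the pair (a_q(k), b_q(k)), unique for k != 0 *)
Definition scattering_coefficients q k : C * C :=
  xget (0, 0) [set ab : C * C | forall x,
    jost_minus q k x = ab.1 * jost_plus q (- k) x + ab.2 * jost_plus q k x].

Definition reflection q k : C :=
  (scattering_coefficients q k).2 / (scattering_coefficients q k).1.

Definition reflection0 q : C := lim (reflection q k @[k --> (0 : R)^']).

(* f represents an element of the domain H^2(R) of H_q, and H_q f = lam f with
   f != 0 in L^2(R) *)
Definition is_eigenfunction q (lam : R) f :=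
  [/\ sobolev 2 2%:E (fun x => complex.Re (f x)), sobolev 2 2%:E (fun x => complex.Im (f x)),
      ~ f = cst 0 %[ae mu] &
      (fun x => - (Complex (weak_derivative 2 (fun y => complex.Re (f y)) x)
                           (weak_derivative 2 (fun y => complex.Im (f y)) x) : C)
                - q x *: f x)
      = (fun x => lam *: f x) %[ae mu]].

Definition is_eigenvalue q (lam : R) := exists f, is_eigenfunction q lam f.

End scattering.

(* Main.v *)
Require Import Defs.
From mathcomp Require Import all_boot all_order ssralg ssrnum interval.
From mathcomp Require Import complex finmap.
From mathcomp Require Import all_classical all_reals all_analysis.
From mathcomp Require Import measurable_realfun.
From mathcomp Require Import ring lra.

Set Implicit Arguments.
Unset Strict Implicit.
Unset Printing Implicit Defensive.

Import Order.TTheory GRing.Theory Num.Theory.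
Import numFieldNormedType.Exports.

Local Open Scope classical_set_scope.
Local Open Scope ring_scope.

(** The logarithmic derivative u of phi is a Schwartz function, and in terms of it
    the linearized Bers map is h |-> lin u h' with
    lin u g = (g' - u' g) / 2 = exp(u) (exp(-u) g)' / 2,
    while psi^2 = exp(-u). Everything about the range comes from this divergence
    form. Integrating it against psi^2 gives 0 (Lambda1_lin), and conversely a v
    with Lambda1 v = 0 is lin u g for the explicit g = 2 exp(u) times the integral
    of exp(-u) v from -oo (lin_surj). Integrating against psi psi_tilde by parts
    gives minus half the mean of g (Lambda2_lin), so Lambda2 v = 0 is the condition
    for g to be the derivative of a Schwartz function. Both functionals are bounded
    by finitely many seminorms, and a pair of functions dual to them
    (dual_basis) provides the closed complement of dimension two.

    For the zero-energy scattering a solution of the Schrodinger equation at real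
    momentum k is written as A cos(k x) + B sin(k x) / k, which for k = 0 means
    A + B x. By variation of constants (A, B) solves a linear system whose matrix is
    dominated by 1 / (1 + x^2), uniformly in k. Picard iteration from -oo
    (sys_exists) and a Gronwall inequality with the weight exp(C atan x) (gronwall,
    sys_perturb) give existence, limits at both ends, and stability under
    perturbation of the potential and of k; the Jost solutions are read off from
    these limits. The function psi = exp(-u/2) solves the zero-energy equation and
    tends to 1 at both ends, so it is the Jost solution from either side. The
    Wronskian for q + e v is e times the integral of v psi f, where f is the perturbed
    Jost solution, and f = psi + O(e) (1 + |x|), whence its derivative Lambda1 v
    (jost_wronskian0_variation).

    If Lambda1 v = 0, write v = lin u g1, let h be the primitive of g1 from -oo and H
    its limit at +oo, and move u to u + e h (exceptional_curve). The potential along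
    this curve is a quadratic polynomial in e with tangent v. It keeps the positive
    bounded ground state exp(-(u + e h)/2), so it stays exceptional, and dividing by
    the ground state shows that it has no negative eigenvalue: the flux of the quotient
    is monotone, so a nonzero solution cannot be square integrable at both ends
    (no_square_integrable_solution). As k tends to 0 the ratio c = exp(-e H / 2) of
    the limits of the ground state determines the reflection coefficient,
    (c^2 - 1) / (c^2 + 1) = - e H / 2 + O(e^2), and - H / 2 = Lambda2 v.

    On Sobolev spaces Lambda1 is still continuous and vanishes on the range, so the
    closure of the range is contained in its kernel. For v in the kernel the same
    formula gives a solution g that tends to 0 at both ends, but g need not be
    integrable, let alone of zero mean. Cut g off at distance n, and cancel the
    integral of the result by a bump so wide that its derivatives are small in L^1:
    what remains is the derivative of a compactly supported function whose image
    tends to v (range_dense). The range is not closed since it misses lin u S' for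
    a smooth step S: a preimage could differ from S only by a constant, and S plus
    a constant is never integrable (range_not_closed). *)

(** * Derivatives as a relation between functions *)

Section calculus.
Variable R : realType.
Implicit Types (f g h df dg : R -> R) (x a b : R).

Definition Der f g := forall x, is_derive x (1 : R) f (g x).

Lemma Der_eq f df dg : Der f df -> (forall x, df x = dg x) -> Der f dg.
Proof. by move=> fd e x; rewrite -e. Qed.

Lemma Der_derivable f df : Der f df -> forall x, derivable f x 1.
Proof. by move=> fd x; have [] := fd x. Qed.

Lemma Der_derive1 f df : Der f df -> f^`() = df.
Proof. by move=> fd; apply/funext => x; rewrite derive1E; have [] := fd x. Qed.

Lemma derivable_Der f : (forall x, derivable f x 1) -> Der f f^`().
Proof. by move=> fd x; rewrite derive1E; exact/derivableP. Qed.

Lemma Der_continuous f df : Der f df -> continuous f.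
Proof.
by move=> fd x; apply/differentiable_continuous/derivable1_diffP; have [] := fd x.
Qed.

Lemma Der_cst c : Der (fun=> c) (fun=> 0).
Proof. by move=> x; exact: is_derive_cst. Qed.

Lemma Der_id : Der (fun x => x) (fun=> 1).
Proof. by move=> x; exact: is_derive_id. Qed.

Lemma DerD f g df dg : Der f df -> Der g dg ->
  Der (fun x => f x + g x) (fun x => df x + dg x).
Proof. by move=> fd gd x; exact: is_deriveD. Qed.

Lemma DerN f df : Der f df -> Der (fun x => - f x) (fun x => - df x).
Proof. by move=> fd x; exact: is_deriveN. Qed.

Lemma is_derM f g x a b : is_derive x (1 : R) f a -> is_derive x (1 : R) g b ->
  is_derive x (1 : R) (fun y => f y * g y) (a * g x + f x * b).
Proof.
move=> fd gd; have H := is_deriveM fd gd.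
rewrite (_ : a * g x + f x * b = f x *: b + g x *: a); first exact: H.
by rewrite addrC; congr (_ + _); exact: mulrC.
Qed.

Lemma DerM f g df dg : Der f df -> Der g dg ->
  Der (fun x => f x * g x) (fun x => df x * g x + f x * dg x).
Proof. by move=> fd gd x; exact: is_derM. Qed.

Lemma Der_comp f g df dg : Der f df -> Der g dg ->
  Der (fun x => f (g x)) (fun x => df (g x) * dg x).
Proof. by move=> fd gd x; exact: is_derive1_comp. Qed.

Lemma DerX f df n : Der f df ->
  Der (fun x => f x ^+ n) (fun x => n%:R * f x ^+ n.-1 * df x).
Proof.
move=> fd x; have := @is_deriveX _ _ f n x 1 (df x) (fd x).
have -> : f ^+ n = (fun y => f y ^+ n).
  elim: n => [//|n IH]; rewrite exprS IH; apply/funext => y /=.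
  by rewrite exprS.
case: n => [|n]; first by rewrite !mulr0n !mul0r scale0r.
by rewrite /= -mulr_natl.
Qed.

Lemma Der_expR f df : Der f df ->
  Der (fun x => expR (f x)) (fun x => expR (f x) * df x).
Proof. by move=> fd; apply: (Der_comp (fun x => is_derive_expR x) fd). Qed.

Lemma Der_sin f df : Der f df ->
  Der (fun x => sin (f x)) (fun x => cos (f x) * df x).
Proof. by move=> fd; apply: (Der_comp (fun x => is_derive_sin x) fd). Qed.

Lemma Der_cos f df : Der f df ->
  Der (fun x => cos (f x)) (fun x => - sin (f x) * df x).
Proof. by move=> fd; apply: (Der_comp (fun x => is_derive_cos x) fd). Qed.

Lemma Der_atan f df : Der f df ->
  Der (fun x => atan (f x)) (fun x => (1 + f x ^+ 2)^-1 * df x).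
Proof. by move=> fd; apply: (Der_comp (fun x => is_derive1_atan x) fd). Qed.

Lemma DerV f df : (forall x, f x != 0) -> Der f df ->
  Der (fun x => (f x)^-1) (fun x => - (f x) ^- 2 * df x).
Proof.
move=> f0 fd x.
by have := @is_deriveV _ f x _ _ (f0 x) (fd x); rewrite /GRing.scale /=.
Qed.

Lemma Der_ln f df : (forall x, 0 < f x) -> Der f df ->
  Der (fun x => ln (f x)) (fun x => (f x)^-1 * df x).
Proof. by move=> f0 fd x; exact: (is_derive1_comp (is_derive1_ln (f0 x)) (fd x)). Qed.

(** Comparing increments through pointwise comparison of derivatives avoids
    estimating integrals. *)
Lemma Der_le f g df dg a b : Der f df -> Der g dg ->
  (forall x, a <= x <= b -> df x <= dg x) -> a <= b -> f b - f a <= g b - g a.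
Proof.
move=> fd gd le ab; set h := fun x => g x + - f x.
have hd : Der h (fun x => dg x + - df x) by apply: DerD => //; exact: DerN.
rewrite -subr_ge0.
have -> : g b - g a - (f b - f a) = h b - h a by rewrite /h; ring.
have [c cab ->] := @MVT_segment _ h _ a b ab (fun x _ => hd x)
  (continuous_subspaceT (Der_continuous hd)).
by rewrite mulr_ge0 ?subr_ge0 ?le // ?(itvP cab).
Qed.

Lemma Der_ler_norm f g df dg a b : Der f df -> Der g dg ->
  (forall x, a <= x <= b -> `|df x| <= dg x) -> a <= b ->
  `|f b - f a| <= g b - g a.
Proof.
move=> fd gd le ab; rewrite ler_norml; apply/andP; split; last first.
  by apply: (Der_le fd gd) => // x /le; apply: le_trans; exact: ler_norm.
rewrite lerNl; have -> : - (f b - f a) = - f b - - f a by ring.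
apply: (Der_le (DerN fd) gd) => // x /le; apply: le_trans.
by rewrite -normrN; exact: ler_norm.
Qed.

Lemma Der_homo f df : Der f df -> (forall x, 0 <= df x) ->
  {homo f : x y / x <= y}.
Proof.
move=> fd df0 x y xy; have := Der_le (Der_cst 0) fd (fun z _ => df0 z) xy.
by rewrite subrr subr_ge0.
Qed.

Lemma Der0_cst f : Der f (fun=> 0) -> forall x y, f x = f y.
Proof.
move=> fd x y; apply/eqP; rewrite eq_le.
wlog xy : x y / x <= y.
  by move=> H; case/orP: (le_total x y) => /H // /andP[-> ->].
apply/andP; split; first exact: (Der_homo fd).
have := Der_homo (Der_eq (DerN fd) (fun x => oppr0 R)).
by move=> /(_ (fun=> lexx _) _ _ xy); rewrite lerN2.
Qed.

Lemma Der_uniq f df dg : Der f df -> Der f dg -> forall x, df x = dg x.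
Proof. by move=> /Der_derive1 <- /Der_derive1 <-. Qed.

End calculus.

Ltac der_step :=
  first [ eassumption | eapply Der_cst | eapply Der_id | eapply DerD
        | eapply DerN | eapply DerX | eapply DerM | eapply Der_expR | eapply Der_sin
        | eapply Der_cos | eapply Der_atan ].
Ltac der := eapply Der_eq; [ solve [repeat der_step] | move=> /= ? ].

(** * Classes of smooth functions closed under differentiation *)

Section classes.
Variable R : realType.
Implicit Types (f g h : R -> R) (P Q S : (R -> R) -> Prop).

(** Every derivative belongs to P; the finite-order version is what inductions
    on the order run on. *)
Fixpoint clsn P n f : Prop :=
  P f /\ (if n is m.+1 then exists2 g, Der f g & clsn P m g else True).

Definition cls P f := forall n, clsn P n f.

Lemma clsn_in P n f : clsn P n f -> P f.
Proof. by case: n => [|n] []. Qed.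

Lemma cls_in P f : cls P f -> P f.
Proof. by move=> /(_ 0%N)/clsn_in. Qed.

Lemma clsn_der P n f g : clsn P n.+1 f -> Der f g -> clsn P n g.
Proof.
move=> [_ [h fh ch]] fg.
by have -> : g = h by apply/funext => x; exact: (Der_uniq fg fh).
Qed.

Lemma cls_der P f g : cls P f -> Der f g -> cls P g.
Proof. by move=> cf fg n; exact: (clsn_der (cf n.+1) fg). Qed.

Lemma cls_derive1 P f : cls P f -> Der f f^`().
Proof. by move=> /(_ 1%N)[_ [g fg _]]; rewrite (Der_derive1 fg). Qed.

Lemma cls_derivative P f : cls P f -> cls P f^`().
Proof. by move=> cf; apply: (cls_der cf); exact: cls_derive1 cf. Qed.

Lemma cls_continuous P f : cls P f -> continuous f.
Proof. by move=> /cls_derive1/Der_continuous. Qed.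

Lemma clsI P f g : P f -> Der f g -> cls P g -> cls P f.
Proof. by move=> Pf fg cg [//|n] /=; split=> //; exists g. Qed.

Lemma clsnS P n f : clsn P n.+1 f -> clsn P n f.
Proof.
elim: n f => [|n IH] f; first by case.
by move=> [Pf [g fg cg]]; split=> //; exists g => //; exact: IH.
Qed.

Lemma clsn_sub P Q n f : (forall f, P f -> Q f) -> clsn P n f -> clsn Q n f.
Proof.
move=> PQ; elim: n f => [|n IH] f /=; first by case=> /PQ.
by move=> [/PQ Qf [g fg /IH cg]]; split=> //; exists g.
Qed.

Lemma cls_sub P Q f : (forall f, P f -> Q f) -> cls P f -> cls Q f.
Proof. by move=> PQ cf n; exact: clsn_sub (cf n). Qed.

Lemma derive1Sn n f : f^`(n.+1) = f^`()^`(n).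
Proof. by elim: n => [//|n IH]; rewrite derive1nS IH -derive1nS. Qed.

Lemma clsE P f :
  cls P f <-> forall n, (forall x, derivable f^`(n) x 1) /\ P f^`(n).
Proof.
split=> [cf n|H n].
  elim: n f cf => [|n IH] f cf.
    by split; [exact: Der_derivable (cls_derive1 cf)|exact: cls_in].
  by rewrite derive1Sn; apply: IH; exact: cls_derivative.
elim: n f H => [|n IH] f H /=; first by have [] := H 0%N.
split; first by have [] := H 0%N.
exists f^`(); first by apply: derivable_Der => x; have [] := H 0%N.
by apply: IH => m; rewrite -derive1Sn.
Qed.

Lemma cls_iter P f n : cls P f -> cls P f^`(n).
Proof.
elim: n f => [//|n IH] f cf; rewrite derive1Sn; apply: IH.
exact: cls_derivative.
Qed.

Section closure.
Variables P Q S : (R -> R) -> Prop.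

Lemma clsnD n f g :
  (forall f g, S f -> S g -> S (fun x => f x + g x)) ->
  clsn S n f -> clsn S n g -> clsn S n (fun x => f x + g x).
Proof.
move=> SD; elim: n f g => [|n IH] f g.
  by move=> [? _] [? _]; split=> //; exact: SD.
move=> [Sf [df fd cf]] [Sg [dg gd cg]]; split; first exact: SD.
by exists (fun x => df x + dg x); [exact: DerD|exact: IH].
Qed.

Lemma clsnM n f g :
  (forall f g, P f -> Q g -> S (fun x => f x * g x)) ->
  (forall f g, S f -> S g -> S (fun x => f x + g x)) ->
  clsn P n f -> clsn Q n g -> clsn S n (fun x => f x * g x).
Proof.
move=> PQS SD; elim: n f g => [|n IH] f g cf cg.
  by split=> //; apply: PQS; [exact: clsn_in cf|exact: clsn_in cg].
split; first by apply: PQS; [exact: clsn_in cf|exact: clsn_in cg].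
have [_ [df fd cdf]] := cf; have [_ [dg gd cdg]] := cg.
exists (fun x => df x * g x + f x * dg x); first exact: DerM.
by apply: clsnD => //; apply: IH => //; exact: clsnS.
Qed.

Lemma clsM f g :
  (forall f g, P f -> Q g -> S (fun x => f x * g x)) ->
  (forall f g, S f -> S g -> S (fun x => f x + g x)) ->
  cls P f -> cls Q g -> cls S (fun x => f x * g x).
Proof. by move=> PQS SD cf cg n; exact: clsnM. Qed.

Lemma clsD f g :
  (forall f g, S f -> S g -> S (fun x => f x + g x)) ->
  cls S f -> cls S g -> cls S (fun x => f x + g x).
Proof. by move=> SD cf cg n; exact: clsnD. Qed.

End closure.

(** Conditions on a single function: cls imposes them on all derivatives, so that
    cls rd is the Schwartz space and cls cpt the space of test functions. *)
Definition bnd f := exists C, forall x, `|f x| <= C.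
Definition rd f := forall m : nat, exists C, forall x, `|x| ^+ m * `|f x| <= C.
Definition cpt f := exists M : R, forall x, M < `|x| -> f x = 0.
Definition anyf f := True.

Lemma bndM f g : bnd f -> bnd g -> bnd (fun x => f x * g x).
Proof.
by move=> [C hC] [D hD]; exists (C * D) => x; rewrite normrM ler_pM.
Qed.

Lemma bndD f g : bnd f -> bnd g -> bnd (fun x => f x + g x).
Proof.
by move=> [C hC] [D hD]; exists (C + D) => x; rewrite (le_trans (ler_normD _ _))// lerD.
Qed.

Lemma rdD f g : rd f -> rd g -> rd (fun x => f x + g x).
Proof.
move=> fr gr m; have [C hC] := fr m; have [D hD] := gr m; exists (C + D) => x.
by apply: le_trans (lerD (hC x) (hD x)); rewrite -mulrDr ler_wpM2l ?exprn_ge0 ?ler_normD.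
Qed.

Lemma bnd_rdM f g : bnd f -> rd g -> rd (fun x => f x * g x).
Proof.
move=> [C hC] gr m; have [D hD] := gr m; exists (C * D) => x.
by rewrite normrM mulrCA ler_pM// mulr_ge0 ?exprn_ge0.
Qed.

Lemma rd_bnd f : rd f -> bnd f.
Proof. by move=> /(_ 0%N)[C hC]; exists C => x; have := hC x; rewrite expr0 mul1r. Qed.

Lemma cptM f g : anyf f -> cpt g -> cpt (fun x => f x * g x).
Proof. by move=> _ [M hM]; exists M => x /hM ->; rewrite mulr0. Qed.

Lemma cptD f g : cpt f -> cpt g -> cpt (fun x => f x + g x).
Proof.
move=> [M hM] [N hN]; exists (Num.max M N) => x.
by rewrite gt_max => /andP[/hM -> /hN ->]; rewrite addr0.
Qed.

Lemma cls_bndM f g : cls bnd f -> cls bnd g -> cls bnd (fun x => f x * g x).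
Proof. by apply: clsM; [exact: bndM|exact: bndD]. Qed.

Lemma cls_rdM f g : cls bnd f -> cls rd g -> cls rd (fun x => f x * g x).
Proof. by apply: clsM; [exact: bnd_rdM|exact: rdD]. Qed.

Lemma cls_cptM f g : cls anyf f -> cls cpt g -> cls cpt (fun x => f x * g x).
Proof. by apply: clsM; [exact: cptM|exact: cptD]. Qed.

Lemma cls_anyM f g : cls anyf f -> cls anyf g -> cls anyf (fun x => f x * g x).
Proof. by apply: clsM. Qed.

Lemma cls_any P f : cls P f -> cls anyf f.
Proof. exact: cls_sub. Qed.

Lemma cls_rd_bnd f : cls rd f -> cls bnd f.
Proof. by apply: cls_sub; exact: rd_bnd. Qed.

Lemma cls_cst P c : P (fun=> c) -> P (fun=> 0) -> cls P (fun=> c).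
Proof.
move=> Pc P0 n; case: n => [//|n] /=; split=> //.
exists (fun=> 0); first exact: Der_cst.
by elim: n => [//|n IH]; split=> //; exists (fun=> 0) => //; exact: Der_cst.
Qed.

Lemma cls_bnd_cst c : cls bnd (fun=> c).
Proof.
by apply: cls_cst; [exists `|c| => _|exists 0 => _; rewrite normr0].
Qed.

Lemma cls_rdZ c f : cls rd f -> cls rd (fun x => c * f x).
Proof. by apply: cls_rdM; exact: cls_bnd_cst. Qed.

Lemma smoothE f : smooth f <-> cls anyf f.
Proof.
split=> [sf|/clsE sf n x]; last by have [] := sf n.
by apply/clsE => n; split=> // x; exact: sf.
Qed.

Lemma schwartzP f : reflect (cls rd f) (f \in @schwartz R).
Proof.
apply: (iffP idP); rewrite inE.
  by move=> [sf df]; apply/clsE => n; split=> [x|m]; [exact: sf|exact: df].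
by move=> /clsE H; split=> [n x|m n]; have [H1 H2] := H n; [exact: H1|exact: H2].
Qed.

Lemma test_functionP f : test_function f <-> cls cpt f.
Proof.
split=> [[sf [M hM]]|cf]; last first.
  by split; [apply/smoothE; exact: cls_any cf|exact: cls_in cf].
move=> n; move: (sf) => /smoothE/(_ n); elim: n f sf hM => [|n IH] f sf hM.
  by move=> _; split=> //; exists M.
move=> [_ [g fg cg]]; split; first by exists M.
exists g => //; have e := Der_derive1 fg; rewrite -e in cg *.
apply: IH => //.
  by move=> m x; rewrite -derive1Sn; exact: sf.
move=> x Mx; rewrite derive1E.
rewrite (@near_eq_derive _ _ _ f (cst 0) x 1) ?derive_cst ?oner_eq0//.
near=> y; apply: hM; near: y.
have : {for x, continuous (fun y : R => `|y|)} by exact: norm_continuous.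
by move=> /cvgr_gt; apply.
Unshelve. all: by end_near. Qed.

Lemma cls_bnd_expR f : cls bnd f -> cls bnd (fun x => expR (f x)).
Proof.
move=> cf n; have be : bnd (fun x => expR (f x)).
  have [C hC] := cls_in cf; exists (expR C) => x.
  by rewrite ger0_norm ?expR_ge0// ler_expR (le_trans (ler_norm _)).
elim: n => [//|n IH]; split=> //; have fd := cls_derive1 cf.
exists (fun x => expR (f x) * f^`() x); first exact: Der_expR.
apply: (@clsnM bnd bnd) => //; [exact: bndM|exact: bndD|].
exact: cls_derivative.
Qed.

Lemma cls_bndV f c : 0 < c -> (forall x, c <= f x) -> cls bnd f ->
  cls bnd (fun x => (f x)^-1).
Proof.
move=> c0 cf bf n; have f0 x : 0 < f x by exact: lt_le_trans (cf x).
have be : bnd (fun x => (f x)^-1).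
  by exists c^-1 => x; rewrite ger0_norm ?lef_pV2 ?posrE// invr_ge0 ltW.
elim: n => [//|n IH]; split=> //; have fd := cls_derive1 bf.
exists (fun x => -1 * (((f x)^-1 * (f x)^-1) * f^`() x)).
  apply: Der_eq (DerV _ fd) _ => x; first by rewrite gt_eqF.
  by rewrite expr2 invfM mulN1r mulNr.
apply: (@clsnM bnd bnd) => //; [exact: bndM|exact: bndD|exact: cls_bnd_cst|].
apply: (@clsnM bnd bnd) => //; [exact: bndM|exact: bndD| |exact: cls_derivative].
by apply: (@clsnM bnd bnd) => //; [exact: bndM|exact: bndD].
Qed.

End classes.

(** * Integrals of functions dominated by the derivative of the arctangent *)

Section dominated.
Variable R : realType.
Local Notation mu := (@lebesgue_measure R).
Implicit Types (f g h : R -> R).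

Definition wt (x : R) : R := (1 + x ^+ 2)^-1.

Lemma wt_gt0 x : 0 < wt x.
Proof. by rewrite invr_gt0 ltr_wpDr ?sqr_ge0. Qed.

Lemma Der_wt : Der (@atan R) wt.
Proof. by move=> x; exact: is_derive1_atan. Qed.

Lemma continuous_wt : continuous wt.
Proof.
apply: Der_continuous; apply: DerV.
  by move=> x; rewrite gt_eqF// ltr_wpDr ?sqr_ge0.
by apply: DerD; [exact: Der_cst|exact: (DerX 2 (@Der_id R))].
Qed.

Lemma wtN x : wt (- x) = wt x.
Proof. by rewrite /wt sqrrN. Qed.

Lemma cvgNy_atan : @atan R x @[x --> -oo] --> - (pi / 2).
Proof.
apply/cvgNy_compNP.
rewrite (_ : _ \o _ = (fun x => - atan x)); last first.
  by apply/funext => x; rewrite /= atanN.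
by apply: cvgN; exact: cvgy_atan.
Qed.

Lemma measurable_cont f (D : set R) : continuous f -> measurable_fun D f.
Proof.
move=> cf; apply: (measurable_funS measurableT) => //.
exact: continuous_measurable_fun.
Qed.

Lemma integral_wty a :
  (\int[mu]_(x in `[a, +oo[) (wt x)%:E = (pi / 2 - atan a)%:E)%E.
Proof.
rewrite (ge0_continuous_FTC2y _ _ (@cvgy_atan R))/= ?EFinB//.
- by move=> x _; rewrite ltW// wt_gt0.
- by apply: continuous_subspaceT; exact: continuous_wt.
- by apply: cvg_at_right_filter; exact: continuous_atan.
- by move=> x _; exact: derive1_atan.
Qed.

Lemma integral_wtNy a :
  (\int[mu]_(x in `]-oo, a]) (wt x)%:E = (pi / 2 + atan a)%:E)%E.
Proof.
rewrite -[a in `]-oo, a]]opprK ge0_integration_by_substitutionNy//.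
- under eq_integral do rewrite /= wtN.
  by rewrite integral_wty atanN opprK.
- by apply: continuous_subspaceT; exact: continuous_wt.
- by move=> x _; rewrite ltW// wt_gt0.
Qed.

Lemma integrable_wt : mu.-integrable setT (EFin \o wt).
Proof.
apply/integrableP; split.
  by apply/measurable_EFinP; apply: measurable_cont; exact: continuous_wt.
under eq_integral do rewrite /= ger0_norm ?ltW ?wt_gt0//.
have -> : [set: R] = `]-oo, 0] `|` `]0, +oo[.
  by rewrite -itv_bndbnd_setU// set_itvE.
rewrite ge0_integral_setU//=.
- rewrite integral_itv_obnd_cbnd ?integral_wty ?integral_wtNy ?ltry//.
  by apply/measurable_EFinP; apply: measurable_cont; exact: continuous_wt.
- by apply/measurable_EFinP; apply: measurable_cont; exact: continuous_wt.
- by move=> x _; rewrite lee_fin ltW// wt_gt0.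
- apply/disj_setPS => x [] /=; rewrite !in_itv/= andbT => x0 /lt_le_trans/(_ x0).
  by rewrite ltxx.
Qed.

Definition dom f := continuous f /\ exists C, forall x, `|f x| <= C * wt x.

Definition intg f := mu.-integrable setT (EFin \o f).

Lemma intg_meas f : intg f -> measurable_fun setT f.
Proof. by move=> /measurable_int/measurable_EFinP. Qed.

Lemma intg_le f g : measurable_fun setT f -> intg g ->
  (forall x, `|f x| <= `|g x|) -> intg f.
Proof.
move=> mf ig le; apply: (le_integrable measurableT _ _ ig).
  exact/measurable_EFinP.
by move=> x _; rewrite /= lee_fin.
Qed.

Lemma intgD f g : intg f -> intg g -> intg (fun x => f x + g x).
Proof.
move=> i1 i2; have := integrableD measurableT i1 i2.
by apply: eq_integrable.
Qed.

Lemma intgZ c f : intg f -> intg (fun x => c * f x).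
Proof.
move=> i1; have := integrableZl measurableT c i1.
by apply: eq_integrable.
Qed.

Lemma intgN f : intg f -> intg (fun x => - f x).
Proof.
by move=> /(intgZ (-1)); rewrite (_ : (fun x => -1 * f x) = (fun x => - f x))//;
  apply/funext => x; rewrite mulN1r.
Qed.

Lemma intgB f g : intg f -> intg g -> intg (fun x => f x - g x).
Proof. by move=> i1 /intgN; exact: intgD. Qed.

Lemma intg_norm f : intg f -> intg (fun x => `|f x|).
Proof. by move=> /integrable_abse; apply: eq_integrable. Qed.

Lemma intgM a f : measurable_fun setT a -> bnd a -> intg f ->
  intg (fun x => a x * f x).
Proof.
move=> ma [C hC] fi; have mf := intg_meas fi.
apply: (intg_le (g := fun x => C * f x)).
- exact: measurable_funM.
- exact: intgZ.
- move=> x; rewrite !normrM ler_wpM2r//.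
  by apply: le_trans (hC x) (ler_norm _).
Qed.

Lemma intg_wt C : intg (fun x => C * wt x).
Proof. by apply: intgZ; exact: integrable_wt. Qed.

Lemma dom_intg f : dom f -> intg f.
Proof.
move=> [cf [C hC]]; apply: (intg_le (measurable_cont cf) (intg_wt C)) => x.
by rewrite (le_trans (hC x))// ler_norm.
Qed.

Lemma dom_integrable f (D : set R) : measurable D -> dom f ->
  mu.-integrable D (EFin \o f).
Proof.
by move=> mD /dom_intg df; exact: (@integrableS _ _ _ mu setT D _ measurableT mD (@subsetT _ D) df).
Qed.

Lemma dom_Rintegral_le f C (D : set R) : measurable D -> dom f ->
  (forall x, `|f x| <= C * wt x) ->
  `|\int[mu]_(x in D) f x| <= C * \int[mu]_(x in D) wt x.
Proof.
move=> mD df hC.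
have iwt : mu.-integrable D (EFin \o wt).
  exact: (@integrableS _ _ _ mu setT D _ measurableT mD (@subsetT _ D) integrable_wt).
apply: (le_trans (@le_normr_Rintegral _ _ _ mu D f mD (dom_integrable mD df))).
rewrite -(@RintegralZl _ _ _ mu D wt C mD)//; apply: (@le_Rintegral _ _ _ mu D) => //.
- have /(@integrable_abse _ _ _ mu) := dom_integrable mD df.
  by apply: eq_integrable.
- exact: (@integrableS _ _ _ mu setT D _ measurableT mD (@subsetT _ D) (intg_wt C)).
Qed.

(** A dominated function has a primitive that vanishes at the left end and
    recovers the Lebesgue integral at the right end; through it all integrals of
    such functions reduce to limits of primitives. *)
Definition lint f (x : R) : R := \int[mu]_(t in [set` Interval -oo%O (BRight x)]) f t.

Lemma lintP f : dom f ->
  [/\ Der (lint f) f, lint f x @[x --> -oo] --> (0 : R) &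
      lint f x @[x --> +oo] --> \int[mu]_x f x].
Proof.
move=> df; have [cf [C hC]] := df; rewrite /lint; split.
- move=> x.
  have ifx : mu.-integrable [set` Interval -oo%O (BRight (x + 1))] (EFin \o f).
    exact: dom_integrable.
  have x1 : x < x + 1 by rewrite ltrDl.
  have [dF eF] := continuous_FTC1 x1 ifx (ltNyr x) (cf x).
  by apply: DeriveDef; [exact: dF|rewrite -derive1E eF].
- apply/cvgr0Pnorm_le => e e0.
  have : C * (pi / 2 + atan x) @[x --> -oo] --> C * (pi / 2 + - (pi / 2)).
    by apply: cvgMr; apply: cvgD; [exact: cvg_cst|exact: cvgNy_atan].
  rewrite subrr mulr0 => /cvgr0Pnorm_le/(_ _ e0); apply: filterS => x.
  apply: le_trans; apply: le_trans (ler_norm _).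
  have := @dom_Rintegral_le f C `]-oo, x]%classic (measurable_itv _) df hC.
  by rewrite {2}/Rintegral integral_wtNy.
- apply/cvgrPdist_le => e e0.
  have : C * (pi / 2 - atan x) @[x --> +oo] --> C * (pi / 2 - (pi / 2)).
    by apply: cvgMr; apply: cvgB; [exact: cvg_cst|exact: cvgy_atan].
  rewrite subrr mulr0 => /cvgr0Pnorm_le/(_ _ e0); apply: filterS => x.
  apply: le_trans; apply: le_trans (ler_norm _).
  have -> : \int[mu]_x0 f x0 = \int[mu]_(t in [set` Interval -oo%O +oo%O]) f t.
    by rewrite set_itvE.
  have /= -> := @Rintegral_itvB _ f -oo%O +oo%O x _ isT isT; last first.
    exact: dom_integrable.
  rewrite Rintegral_itv_obnd_cbnd; last exact: dom_integrable.
  have := @dom_Rintegral_le f C `[x, +oo[%classic (measurable_itv _) df hC.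
  by rewrite {2}/Rintegral integral_wty.
Qed.

Lemma dom_primitive f : dom f ->
  exists F, [/\ Der F f, F x @[x --> -oo] --> (0 : R) &
                F x @[x --> +oo] --> \int[mu]_x f x].
Proof. by move=> /lintP H; exists (lint f). Qed.

Lemma domM a f : continuous a -> bnd a -> dom f -> dom (fun x => a x * f x).
Proof.
move=> ca [A hA] [cf [C hC]]; split; first by move=> x; apply: cvgM; [exact: ca|exact: cf].
by exists (A * C) => x; rewrite normrM -mulrA ler_pM.
Qed.

Lemma domD f g : dom f -> dom g -> dom (fun x => f x + g x).
Proof.
move=> [cf [C hC]] [cg [D hD]]; split.
  by move=> x; apply: cvgD; [exact: cf|exact: cg].
by exists (C + D) => x; rewrite (le_trans (ler_normD _ _))// mulrDl lerD.
Qed.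

Lemma rd_wt f : rd f -> forall m : nat,
  exists C, forall x, `|x| ^+ m * `|f x| <= C * wt x.
Proof.
move=> fr m; have [C hC] := fr m; have [D hD] := fr m.+2.
exists (C + D) => x; rewrite -ler_pdivrMr ?wt_gt0// /wt invrK mulrDr mulr1.
rewrite lerD//; apply: le_trans (hD x); rewrite -[x ^+ 2]real_normK ?num_real//.
by rewrite -[m.+2]addn2 exprD mulrAC.
Qed.

Lemma rd_dom f : continuous f -> rd f -> dom f.
Proof.
move=> cf /rd_wt/(_ 0%N)[C hC]; split=> //; exists C => x.
by have := hC x; rewrite expr0 mul1r.
Qed.

Lemma cls_rd_dom f : cls (@rd R) f -> dom f.
Proof. by move=> cf; apply: rd_dom; [exact: cls_continuous cf|exact: cls_in]. Qed.

Lemma Der_diff F G f : Der F f -> Der G f -> exists c, forall x, F x = G x + c.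
Proof.
move=> Ff Gf; exists (F 0 - G 0) => x.
have := @Der0_cst _ (fun x => F x - G x) _ x 0.
move=> <-; first by ring.
by apply: Der_eq (DerD Ff (DerN Gf)) _ => y; rewrite subrr.
Qed.

Lemma dom_limits F f : Der F f -> dom f ->
  exists a, F x @[x --> -oo] --> a /\ F x @[x --> +oo] --> a + \int[mu]_x f x.
Proof.
move=> Ff /dom_primitive[G [Gf G0 Goo]]; have [c hc] := Der_diff Ff Gf.
exists c; rewrite -[X in _ --> X]add0r; split.
  by under eq_cvg do rewrite hc; apply: cvgD => //; exact: cvg_cst.
by rewrite addrC; under eq_cvg do rewrite hc; apply: cvgD => //; exact: cvg_cst.
Qed.

Lemma dom_integral F f a b : Der F f -> dom f ->
  F x @[x --> -oo] --> a -> F x @[x --> +oo] --> b -> \int[mu]_x f x = b - a.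
Proof.
move=> Ff /(dom_limits Ff)[c [Fc Foo]] Fa Fb.
have -> : a = c by apply: cvg_unique Fa Fc.
have -> : b = c + \int[mu]_x f x by apply: cvg_unique Fb Foo.
by rewrite addrC addKr.
Qed.

Lemma Der_Catan C : Der (fun x => C * atan x) (fun x => C * wt x).
Proof. by apply: Der_eq (DerM (Der_cst C) Der_wt) _ => x; ring. Qed.

Lemma dom_boundNy F f a C x : Der F f -> (forall y, y <= x -> `|f y| <= C * wt y) ->
  F y @[y --> -oo] --> a -> `|F x - a| <= C * (atan x + pi / 2).
Proof.
move=> Ff hC Fa.
have : `|F x - F y| @[y --> -oo] --> `|F x - a|.
  by apply: cvg_norm; apply: cvgB => //; exact: cvg_cst.
have : C * (atan x - atan y) @[y --> -oo] --> C * (atan x - - (pi / 2)).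
  by apply: cvgMr; apply: cvgB; [exact: cvg_cst|exact: cvgNy_atan].
rewrite opprK => H1 H2; apply: (ler_cvg_to H2 H1).
near=> y; have yx : y <= x by near: y; by apply: nbhs_ninfty_le; exact: num_real.
rewrite mulrBr.
apply: (Der_ler_norm Ff (Der_Catan C)) => //.
by move=> z /andP[_ /hC].
Unshelve. all: by end_near. Qed.

Lemma dom_boundy F f a C x : Der F f -> (forall y, x <= y -> `|f y| <= C * wt y) ->
  F y @[y --> +oo] --> a -> `|F x - a| <= C * (pi / 2 - atan x).
Proof.
move=> Ff hC Fa.
have : `|F x - F y| @[y --> +oo] --> `|F x - a|.
  by apply: cvg_norm; apply: cvgB => //; exact: cvg_cst.
have : C * (atan y - atan x) @[y --> +oo] --> C * (pi / 2 - atan x).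
  by apply: cvgMr; apply: cvgB; [exact: cvgy_atan|exact: cvg_cst].
move=> H1 H2; apply: (ler_cvg_to H2 H1).
near=> y; have yx : x <= y by near: y; by apply: nbhs_pinfty_ge; exact: num_real.
rewrite mulrBr distrC.
apply: (Der_ler_norm Ff (Der_Catan C)) => //.
by move=> z /andP[/hC].
Unshelve. all: by end_near. Qed.

Lemma atan_le_pi (x : R) : atan x + pi / 2 <= pi.
Proof. by have := atan_ltpi2 x; move=> /ltW; lra. Qed.

(** A rapidly decreasing function of zero mean has a rapidly decreasing
    primitive: on each half-line it is the tail integral from the nearer end,
    and there the weight may be moved inside the integral. *)
Lemma rd_primitive f : cls (@rd R) f -> \int[mu]_x f x = 0 ->
  exists2 F, Der F f & cls (@rd R) F.
Proof.
move=> cf f0; have [F [Ff F0 Foo]] := dom_primitive (cls_rd_dom cf).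
rewrite f0 in Foo; exists F => //; apply: (clsI _ Ff cf) => m.
have [C hC] := rd_wt (cls_in cf) m; exists (C * pi) => x.
have C0 : 0 <= C.
  have := hC 0; rewrite /wt expr0n/= addr0 invr1 mulr1; apply: le_trans.
  by rewrite mulr_ge0 ?exprn_ge0.
have Xd : Der (fun y => `|x| ^+ m * F y) (fun y => `|x| ^+ m * f y).
  by der; ring.
have key y : `|x| <= `|y| -> `| `|x| ^+ m * f y | <= C * wt y.
  move=> xy; apply: le_trans (hC y); rewrite normrM ler_wpM2r//.
  by rewrite normrX normr_id lerXn2r ?nnegrE.
have -> : `|x| ^+ m * `|F x| = `| `|x| ^+ m * F x - 0 |.
  by rewrite subr0 normrM normrX normr_id.
have [x0|x0] := leP x 0.
  apply: le_trans (@dom_boundNy _ _ 0 C x Xd _ _) _.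
  - by move=> y yx; apply: key; rewrite !ler0_norm ?lerN2// (le_trans yx).
  - by rewrite -[X in _ --> X](mulr0 (`|x| ^+ m)); exact: cvgMr.
  - by rewrite ler_wpM2l// atan_le_pi.
apply: le_trans (@dom_boundy _ _ 0 C x Xd _ _) _.
- by move=> y yx; apply: key; rewrite (gtr0_norm x0) gtr0_norm// (lt_le_trans x0).
- by rewrite -[X in _ --> X](mulr0 (`|x| ^+ m)); exact: cvgMr.
- rewrite ler_wpM2l//; have := atan_le_pi (- x); rewrite atanN; lra.
Qed.

Lemma rd_opp f : rd f -> rd (fun x => f (- x)).
Proof.
by move=> fr m; have [C hC] := fr m; exists C => x; have := hC (- x); rewrite normrN.
Qed.

Lemma rd_cvgy f : rd f -> f x @[x --> +oo] --> (0 : R).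
Proof.
move=> /(_ 1%N)[C hC]; apply/cvgr0Pnorm_le => e e0.
near=> x; have x0 : 0 < x by near: x; by apply: nbhs_pinfty_gt; exact: num_real.
have Cx : C / e <= x by near: x; by apply: nbhs_pinfty_ge; exact: num_real.
rewrite -(ler_pM2l x0) (le_trans _ (_ : C <= _))//.
  by have := hC x; rewrite expr1 gtr0_norm.
by rewrite -ler_pdivrMr.
Unshelve. all: by end_near. Qed.

Lemma rd_cvgNy f : rd f -> f x @[x --> -oo] --> (0 : R).
Proof. by move=> fr; apply/cvgNy_compNP; apply: rd_cvgy; exact: rd_opp. Qed.


End dominated.

(** * The logarithmic derivative of a diffeomorphism *)

Section log_derivative.
Variable R : realType.
Implicit Types (f g p s u phi : R -> R).

Lemma cls_rdD f g : cls (@rd R) f -> cls (@rd R) g -> cls (@rd R) (fun x => f x + g x).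
Proof. by apply: clsD; exact: rdD. Qed.

Lemma cls_bndD f g : cls (@bnd R) f -> cls (@bnd R) g ->
  cls (@bnd R) (fun x => f x + g x).
Proof. by apply: clsD; exact: bndD. Qed.

Lemma cls_rd_bndM f g : cls (@rd R) f -> cls (@rd R) g ->
  cls (@rd R) (fun x => f x * g x).
Proof. by move=> /cls_rd_bnd; exact: cls_rdM. Qed.

(** Monotonicity makes the derivative nonnegative, and the chain rule for the smooth
    inverse keeps it from vanishing. *)
Lemma diffeo_derive_gt0 phi : diffeo_schwartz phi -> forall x, 0 < phi^`() x.
Proof.
move=> [sphi [g [sg phiK _]] incr _ _] x; rewrite lt_neqAle.
have phid : Der phi phi^`() by move/smoothE : sphi; exact: cls_derive1.
have gd : Der g g^`() by move/smoothE : sg; exact: cls_derive1.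
apply/andP; split; last first.
  apply: (@incr_derive1_ge0_itvNy _ _ true (x + 1)).
  - by move=> y _; exact: Der_derivable phid y.
  - by move=> y z _ _; exact: incr.
  - by rewrite in_itv/= ltrDl.
have e : g \o phi = id by apply/funext => y /=; rewrite phiK.
have := Der_uniq (f := fun y => g (phi y)) (Der_comp gd phid) _ x.
have -> : (fun y => g (phi y)) = id by exact: e.
move=> /(_ _ (@Der_id R)) /= H; apply/eqP => p0.
by move: H; rewrite -p0 mulr0 => /eqP; rewrite eq_sym oner_eq0.
Qed.

(** Outside a compact interval s is at most 1/2 in absolute value, and on the
    interval the minimum is attained. *)
Lemma rd_lower_bound s : continuous s -> rd s -> (forall x, 0 < 1 + s x) ->
  exists2 c, 0 < c & forall x, c <= 1 + s x.
Proof.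
move=> cs rs s0; have [C hC] := rs 1%N.
have C0 : 0 <= C by apply: le_trans (hC 0); rewrite mulr_ge0 ?exprn_ge0.
pose M := 2 * C + 1.
have M0 : - M <= M by rewrite /M; lra.
have [m mM hm] := @EVT_min _ (fun x => 1 + s x) (- M) M M0
  (continuous_subspaceT (fun x => cvgD (cvg_cst _) (cs x))).
exists (Num.min (1 + s m) 2^-1); first by rewrite lt_min s0 invr_gt0 ltr0n.
move=> x; rewrite ge_min; have [xM|xM] := boolP (x \in `[- M, M]).
  by rewrite hm.
apply/orP; right; have Mx : M < `|x|.
  by rewrite ltNge ler_norml; move: xM; rewrite in_itv.
have sx : `|s x| <= 2^-1.
  have M_gt0 : 0 < M by rewrite /M; lra.
  rewrite -(ler_pM2l (lt_trans M_gt0 Mx)); have := hC x; rewrite expr1.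
  by move=> /le_trans; apply; rewrite /M in Mx; lra.
by have := ler_norm (- s x); rewrite normrN; lra.
Qed.

(** The logarithm lies between s / (1 + s) and s. *)
Lemma rd_ln s c : 0 < c -> (forall x, c <= 1 + s x) -> rd s ->
  rd (fun x => ln (1 + s x)).
Proof.
move=> c0 hc rs m; have [C hC] := rs m; exists (C * Num.max 1 c^-1) => x.
have C0 : 0 <= C by apply: le_trans (hC x); rewrite mulr_ge0 ?exprn_ge0.
have p0 : 0 < 1 + s x by exact: lt_le_trans (hc x).
apply: (@le_trans _ _ (`|x| ^+ m * `|s x| * Num.max 1 c^-1)); last first.
  by rewrite ler_wpM2r// le_max ler01.
rewrite -mulrA ler_wpM2l ?exprn_ge0// ler_norml; apply/andP; split.
  have : ln (1 + s x)^-1 <= - s x / (1 + s x).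
    have e : (1 + s x)^-1 = 1 + - s x / (1 + s x) by field; rewrite gt_eqF.
    rewrite [X in ln X]e.
    apply: le_ln1Dx; rewrite -subr_gt0 opprK.
    have -> : - s x / (1 + s x) + 1 = (1 + s x)^-1 by field; rewrite gt_eqF.
    by rewrite invr_gt0.
  rewrite lnV ?posrE// => h; rewrite lerNl (le_trans h)//.
  rewrite (le_trans (ler_norm _))// normrM normrN ler_wpM2l// le_max.
  by rewrite ger0_norm ?invr_ge0 ?(ltW p0)// lef_pV2 ?posrE ?hc ?orbT.
apply: (@le_trans _ _ (s x)).
  by apply: le_ln1Dx; rewrite -subr_gt0 opprK addrC.
by rewrite (le_trans (ler_norm _))// ler_peMr// le_max lexx.
Qed.

Lemma log_derivative_rd phi : diffeo_schwartz phi ->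
  let u := log_derivative phi in
  cls (@rd R) u /\
  bers phi = (fun x => 2^-1 * u^`()^`() x - 4^-1 * (u^`() x) ^+ 2).
Proof.
move=> dphi u; have p0 := diffeo_derive_gt0 dphi.
have [/smoothE sphi _ _ /schwartzP cs _] := dphi.
set p := phi^`() in p0 cs.
have cp : cls (@anyf R) p by exact: cls_derivative.
have pd : Der p p^`() by exact: cls_derive1 cp.
have p'd : Der p^`() p^`()^`() by exact: cls_derive1 (cls_derivative cp).
have ps x : p x = 1 + (p x - 1) by rewrite addrC subrK.
have ud : Der u (fun x => (p x)^-1 * p^`() x) 
  by rewrite /u /log_derivative -/p; exact: (Der_ln p0 pd).
have [c c0 hc] : exists2 c, 0 < c & forall x, c <= p x.
  have [|c c0 hc] := rd_lower_bound (cls_continuous cs) (cls_in cs).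
    by move=> x; rewrite -ps.
  by exists c => // x; rewrite ps.
have sd : Der (fun x => p x - 1) p^`().
  by apply: Der_eq (DerD pd (Der_cst _)) _ => x; rewrite addr0.
have bp : cls (@bnd R) p.
  rewrite (_ : p = fun x => 1 + (p x - 1)); last by apply/funext => x; rewrite -ps.
  by apply: cls_bndD; [exact: cls_bnd_cst|exact: cls_rd_bnd].
have cu' : cls (@rd R) (fun x => (p x)^-1 * p^`() x).
  by apply: cls_rdM; [exact: (cls_bndV c0)|exact: cls_der cs sd].
split.
  apply: (clsI _ ud cu').
  rewrite (_ : u = fun x => ln (1 + (p x - 1))); last by apply/funext => x; rewrite -ps.
  by apply: (rd_ln c0) => [x|]; [rewrite -ps|exact: cls_in cs].
have u'd : Der (fun x => (p x)^-1 * p^`() x)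
    (fun x => (- p x ^- 2 * p^`() x) * p^`() x + (p x)^-1 * p^`()^`() x).
  by apply: DerM => //; apply: DerV => // x; rewrite gt_eqF.
apply/funext => x; rewrite /bers (Der_derive1 ud) (Der_derive1 u'd).
rewrite /derive1n/= -/p; move: (p x) (p0 x) (p^`() x) (p^`()^`() x) => a a0 b d.
by field; rewrite gt_eqF.
Qed.

End log_derivative.

(** * Bump functions *)

Section bump.
Variable R : realType.
Local Notation mu := (@lebesgue_measure R).
Implicit Types (f g p s u phi : R -> R).

(** The functions x^-n exp(-1/x), extended by 0 to the left; differentiation acts
    on this family, so all of them are smooth. *)
Definition flat (n : nat) (x : R) : R :=
  if 0 < x then x ^- n * expR (- x^-1) else 0.

Lemma flat_bound n (x : R) : 0 < x -> x ^- n * expR (- x^-1) <= (n.+1)`!%:R * x.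
Proof.
move=> x0; have y0 : 0 < x^-1 by rewrite invr_gt0.
have := @expR_ge1Dxn R (x^-1) n (ltW y0).
rewrite expRN -exprVn.
set y := x^-1 in y0 *; have -> : x = y^-1 by rewrite invrK.
move=> h; rewrite ler_pdivrMr ?expR_gt0// mulrAC ler_pdivlMr//.
rewrite -exprSr (le_trans _ (ler_wpM2l _ h)) ?ler0n// mulrDr mulrC.
by rewrite mul1r mulrCA divff ?mulr1 ?lerDr ?ler0n// pnatr_eq0 -lt0n fact_gt0.
Qed.

Lemma is_derive_lim f x d :
  h^-1 *: (f (h + x) - f x) @[h --> 0^'] --> d -> is_derive x (1 : R) f d.
Proof.
move=> H; have e : (fun h : R => h^-1 *: ((f \o shift x) (h *: 1) - f x)) =
                   (fun h : R => h^-1 *: (f (h + x) - f x)).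
  by apply/funext => h; rewrite /= /GRing.scale/= mulr1.
by apply: DeriveDef; [rewrite /derivable e; exact: cvgP H|
                      rewrite /derive e; exact: cvg_lim H].
Qed.

Lemma Der_flat n :
  Der (flat n) (fun x => - n%:R * flat n.+1 x + flat n.+2 x).
Proof.
move=> x; have [x0|x0|->] := ltgtP x 0.
- apply: (@near_eq_is_derive _ _ _ (cst 0)).
  + by near=> y; rewrite /flat ltNge ltW//; near: y; exact: lt_nbhsl.
  + rewrite /flat ltNge (ltW x0)/= mulr0 addr0; exact: is_derive_cst.
- apply: (@near_eq_is_derive _ _ _ (fun x : R => x ^- n * expR (- x^-1)) (flat n)).
  + by near=> y; rewrite /flat ifT//; near: y; exact: lt_nbhsr.
  + rewrite /flat x0.
    have xV : is_derive x 1 (fun x : R => x^-1) (- x ^- 2 * 1).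
      by apply: (@is_deriveV _ id); rewrite ?gt_eqF.
    have xn : is_derive x 1 (fun x : R => x ^- n) (- (x ^+ n) ^- 2 * (n%:R * x ^+ n.-1 * 1)).
      apply: (@is_deriveV _ (fun x => x ^+ n)); first by rewrite expf_neq0 ?gt_eqF.
      exact: (DerX n (@Der_id R)).
    have ex : is_derive x 1 (fun x : R => expR (- x^-1)) (expR (- x^-1) * (- (- x ^- 2 * 1))).
      apply: (@is_derive1_comp _ expR (fun x => - x^-1)); exact: is_deriveN.
    have H := is_derM xn ex; apply: (is_derive_eq H); rewrite /=.
    move=> {H xn ex xV}; case: n => [|n]; first by rewrite !exprS expr0; field; rewrite gt_eqF.
    by rewrite /= !exprS; field; rewrite expf_neq0 ?gt_eqF.
- apply: is_derive_lim; rewrite /flat ltxx mulr0 !addr0.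
  apply/cvgr0Pnorm_le => e e0.
  have F0 : 0 < (n.+2)`!%:R :> R by rewrite ltr0n fact_gt0.
  near=> h; rewrite addr0 subr0.
  have Hh : (n.+2)`!%:R * `|h| <= e.
    rewrite mulrC -ler_pdivlMr//; near: h; apply: dnbhs0_le.
    by rewrite divr_gt0.
  have [h_gt0|h_le0] := ltP 0 h; last by rewrite scaler0 normr0 ltW.
  apply: le_trans Hh.
  rewrite ger0_norm; last by rewrite mulr_ge0 ?invr_ge0 ?(ltW h_gt0)// mulr_ge0 ?expR_ge0// invr_ge0 exprn_ge0// ltW.
  rewrite /GRing.scale/= mulrA -invfM -exprS (le_trans (flat_bound _ h_gt0))//.
  by rewrite ler_wpM2l// ler_norm.
Unshelve. all: by end_near. Qed.

Lemma cls_flat n : cls (@anyf R) (flat n).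
Proof.
move=> k; elim: k n => [//|k IH] n; split=> //.
exists (fun x => - n%:R * flat n.+1 x + flat n.+2 x); first exact: Der_flat.
apply: clsnD => //; apply: (@clsnM _ (@anyf R) (@anyf R)) => //.
exact: (cls_cst (P := @anyf R)).
Qed.

Lemma cls_affine (P : (R -> R) -> Prop) a b f :
  (forall c f, P f -> P (fun x => c * f (a * x + b))) ->
  forall c, cls P f -> cls P (fun x => c * f (a * x + b)).
Proof.
move=> PP c cf n; elim: n f c cf => [|n IH] f c cf.
  by split=> //; apply: PP; exact: cls_in cf.
split; first by apply: PP; exact: cls_in cf.
have fd := cls_derive1 cf.
exists (fun x => (c * a) * f^`() (a * x + b)); last first.
  by apply: IH; exact: cls_derivative.
have ad : Der (fun x => a * x + b) (fun=> a) by der; ring.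
by apply: Der_eq (DerM (Der_cst c) (Der_comp fd ad)) _ => x; ring.
Qed.

Lemma continuous_cpt_bnd f : continuous f -> cpt f -> bnd f.
Proof.
move=> cf [M hM]; have M0 : - `|M| <= `|M| by have := normr_ge0 M; lra.
have [c _ hc] := @EVT_max _ (fun x => `|f x|) _ _ M0
  (continuous_subspaceT (fun x => cvg_norm (cf x))).
exists `|f c| => x; have [xM|xM] := boolP (x \in `[- `|M|, `|M|]); first exact: hc.
rewrite hM ?normr0// ltNge; apply: contra xM => xM.
by rewrite in_itv/= -ler_norml (le_trans xM)// ler_norm.
Qed.

Lemma cpt_rd f : bnd f -> cpt f -> rd f.
Proof.
move=> [C hC] [M hM] m; exists (`|M| ^+ m * C) => x.
have C0 : 0 <= C by exact: le_trans (hC x).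
have [xM|/hM ->] := leP `|x| M; last by rewrite normr0 mulr0 mulr_ge0 ?exprn_ge0.
rewrite ler_pM ?exprn_ge0// lerXn2r ?nnegrE//.
by rewrite (le_trans xM)// ler_norm.
Qed.

Lemma cls_cpt_rd f : cls (@cpt R) f -> cls (@rd R) f.
Proof.
move=> cf; apply/clsE => n; have /clsE/(_ n)[fd fc] := cf; split=> //.
apply: cpt_rd => //; apply: continuous_cpt_bnd => //.
exact: cls_continuous (cls_iter n cf).
Qed.

(** The primitive starting from -oo is constant on either side of the support, and
    the constant on the right is the integral. *)
Lemma cpt_primitive_continuous f : continuous f -> cpt f -> \int[mu]_x f x = 0 ->
  exists2 F, Der F f & cpt F.
Proof.
move=> cf pf f0; have df := rd_dom cf (cpt_rd (continuous_cpt_bnd cf pf) pf).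
have [F [Ff F0 Foo]] := dom_primitive df; rewrite f0 in Foo.
exists F => //; have [M hM] := pf.
exists M => x Mx; rewrite -[LHS]subr0; apply/eqP; rewrite -normr_le0.
have [x0|x0] := leP x 0.
  apply: le_trans (@dom_boundNy _ _ _ 0 0 x Ff _ F0) _; last by rewrite mul0r.
  move=> y yx; rewrite hM ?normr0 ?mul0r// (lt_le_trans Mx)//.
  by rewrite !ler0_norm ?lerN2// (le_trans yx).
apply: le_trans (@dom_boundy _ _ _ 0 0 x Ff _ Foo) _; last by rewrite mul0r.
move=> y xy; rewrite hM ?normr0 ?mul0r// (lt_le_trans Mx)//.
by rewrite (gtr0_norm x0) gtr0_norm// (lt_le_trans x0).
Qed.

Lemma cpt_primitive f : cls (@cpt R) f -> \int[mu]_x f x = 0 ->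
  exists2 F, Der F f & cls (@cpt R) F.
Proof.
move=> cf f0; have [F Ff pF] := cpt_primitive_continuous (cls_continuous cf) (cls_in cf) f0.
by exists F => //; exact: (clsI pF Ff cf).
Qed.

Lemma exists_bump : exists b : R -> R,
  [/\ cls (@cpt R) b, forall x, 0 <= b x, \int[mu]_x b x = 1 &
      forall x, (x <= 0) || (1 <= x) -> b x = 0].
Proof.
pose t x := flat 0 x * flat 0 (1 - x).
have t_ge0 x : 0 <= t x.
  by rewrite /t /flat; case: ifP; case: ifP; rewrite ?mulr0 ?mul0r// expr0 invr1 !mul1r mulr_ge0 ?expR_ge0.
have t0 x : (x <= 0) || (1 <= x) -> t x = 0.
  rewrite /t /flat; case/orP => [x0|x1]; first by rewrite ltNge x0 mul0r.
  by rewrite subr_gt0 [_ < 1]ltNge x1 mulr0.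
have ct : cls (@cpt R) t.
  apply/test_functionP; split; last first.
    exists 1 => x x1; apply: t0; move: x1; rewrite lter_normr => /orP[|] h; apply/orP; [right|left]; lra.
  apply/smoothE; apply: cls_anyM; first exact: cls_flat.
  rewrite (_ : (fun x => _) = fun x => 1 * flat 0 (-1 * x + 1)); last first.
    by apply/funext => x; rewrite mul1r mulN1r addrC.
  by apply: cls_affine => //; exact: cls_flat.
have dt := cls_rd_dom (cls_cpt_rd ct).
have [F [Ft F0 Foo]] := dom_primitive dt.
set I := \int[mu]_x t x in Foo.
have Fh := Der_homo Ft t_ge0.
have I_ge0 : 0 <= I by apply: Rintegral_ge0 => x _; exact: t_ge0.
(* with zero integral the monotone primitive would vanish, and t with it *)
have I0 : I != 0.
  apply/eqP => I0; rewrite I0 in Foo.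
  have F_0 x : F x = 0.
    apply/eqP; rewrite eq_le; apply/andP; split.
      apply: (ler_cvg_to (cvg_cst (F x)) Foo); near=> y; apply: Fh.
      by near: y; apply: nbhs_pinfty_ge; exact: num_real.
    apply: (ler_cvg_to F0 (cvg_cst (F x))); near=> y; apply: Fh.
    by near: y; apply: nbhs_ninfty_le; exact: num_real.
  have F_e : F = fun=> 0 by apply/funext.
  have := Der_uniq Ft _ 2^-1; rewrite F_e => /(_ _ (@Der_cst R 0)).
  rewrite /t /flat (_ : 1 - 2^-1 = 2^-1); last by lra.
  rewrite invr_gt0 ltr0n expr0 invr1 mul1r => /eqP; rewrite mulf_eq0 orbb.
  by rewrite gt_eqF ?expR_gt0.
exists (fun x => I^-1 * t x); split.
- by apply: cls_cptM => //; exact: (cls_cst (P := @anyf R)).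
- by move=> x; rewrite mulr_ge0 ?invr_ge0.
- rewrite RintegralZl//; first by rewrite -/I mulVf.
  exact: dom_intg.
- by move=> x /t0 ->; rewrite mulr0.
Unshelve. all: by end_near. Qed.

End bump.

(** * The linearized map on rapidly decreasing functions *)

Section linearized.
Variable R : realType.
Local Notation mu := (@lebesgue_measure R).
Implicit Types (f g h v : R -> R).

Lemma continuous_integrable_itv f (a b : R) : continuous f ->
  mu.-integrable `[a, b] (EFin \o f).
Proof.
move=> cf; apply: continuous_compact_integrable; first exact: segment_compact.
exact: continuous_subspaceT.
Qed.

(** The oriented integral is written through integrals from a common left end
    point, to which the fundamental theorem of calculus applies. *)
Lemma oriented_integralE f (a x0 x : R) : continuous f -> a < x0 -> a < x ->
  oriented_integral x0 x f =
  \int[mu]_(t in `[a, x]) f t - \int[mu]_(t in `[a, x0]) f t.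
Proof.
move=> cf; have key y z : a < y -> y <= z ->
    \int[mu]_(t in `[y, z]) f t =
    \int[mu]_(t in `[a, z]) f t - \int[mu]_(t in `[a, y]) f t.
  move=> ay yz; rewrite (@Rintegral_itvB _ f (BLeft a) (BRight z) y).
  - rewrite Rintegral_itv_obnd_cbnd//.
    have H := @continuous_integrable_itv f y z cf.
    apply: (@integrableS _ _ _ mu `[y, z] _ _ (measurable_itv _) (measurable_itv _) _ H).
    exact: subset_itv_oc_cc.
  - exact: continuous_integrable_itv.
  - by rewrite bnd_simp ltW.
  - by rewrite bnd_simp.
move=> ax0 ax; rewrite /oriented_integral; case: ifPn => [|/negP/negP].
  exact: key.
by rewrite -ltNge => /ltW xx0; rewrite (key _ _ ax xx0) opprB.
Qed.

Lemma Der_oriented f x0 : continuous f -> Der (fun x => oriented_integral x0 x f) f.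
Proof.
move=> cf x; pose a := Num.min x0 x - 1.
have ax0 : a < x0 by rewrite /a ltrBlDr gt_min ltrDl ltr01.
have ax : a < x by rewrite /a ltrBlDr gt_min [x < x + 1]ltrDl ltr01 orbT.
apply: (@near_eq_is_derive _ _ _
  (fun x => \int[mu]_(t in `[a, x]) f t + (- \int[mu]_(t in `[a, x0]) f t))).
  near=> y; rewrite (@oriented_integralE f a)//.
  by near: y; exact: lt_nbhsr.
rewrite -[f x]addr0; apply: is_deriveD.
have x1 : x < x + 1 by rewrite ltrDl.
have [dF eF] := continuous_FTC1_closed x1 (continuous_integrable_itv _ _ cf) ax (cf x).
by apply: DeriveDef; [exact: dF|rewrite -derive1E eF].
Unshelve. all: by end_near. Qed.

Definition lingrow f := exists C, forall x, `|f x| <= C * (1 + `|x|).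

Lemma Der_bnd_lingrow f df : Der f df -> bnd df -> lingrow f.
Proof.
move=> fd [C hC]; have C0 : 0 <= C by exact: le_trans (hC 0).
have cd : Der (fun x => C * x) (fun=> C) by der; ring.
exists (`|f 0| + C) => x.
have H : `|f x - f 0| <= C * `|x|.
  have [x0|x0] := leP 0 x.
    by have := Der_ler_norm fd cd (fun y _ => hC y) x0; rewrite mulr0 subr0 (ger0_norm x0).
  have := Der_ler_norm fd cd (fun y _ => hC y) (ltW x0).
  by rewrite mulr0 sub0r distrC (ltr0_norm x0) mulrN.
rewrite -[f x](subrK (f 0)) (le_trans (ler_normD _ _))//.
rewrite mulrDl !mulrDr !mulr1 addrC -addrA lerD2l (le_trans H)//.
by rewrite addrA lerDr addr_ge0// mulr_ge0.
Qed.

Lemma lingrow_rdM f g : lingrow f -> rd g -> rd (fun x => f x * g x).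
Proof.
move=> [C hC] gr m; have [D hD] := gr m; have [E hE] := gr m.+1.
have C0 : 0 <= C.
  by have := hC 0; rewrite normr0 addr0 mulr1; exact: le_trans.
exists (C * (D + E)) => x; rewrite normrM.
apply: (@le_trans _ _ (`|x| ^+ m * (C * (1 + `|x|) * `|g x|))).
  by rewrite ler_wpM2l ?exprn_ge0// ler_wpM2r.
have -> : `|x| ^+ m * (C * (1 + `|x|) * `|g x|) =
    C * (`|x| ^+ m * `|g x| + `|x| ^+ m.+1 * `|g x|) by rewrite exprS; ring.
by rewrite ler_wpM2l// lerD.
Qed.

Lemma lingrow_bndM f g : bnd f -> lingrow g -> lingrow (fun x => f x * g x).
Proof.
move=> [C hC] [D hD]; exists (C * D) => x.
by rewrite normrM -mulrA ler_pM.
Qed.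

Section with_u.
Variable u : R -> R.
Hypothesis cu : cls (@rd R) u.
Variable x0 : R.

Let ud : Der u u^`() := cls_derive1 cu.

Lemma cls_expu : cls (@bnd R) (fun x => expR (u x)).
Proof. by apply: cls_bnd_expR; exact: cls_rd_bnd. Qed.

Lemma cls_expNu : cls (@bnd R) (fun x => expR (- u x)).
Proof.
apply: cls_bnd_expR; apply: cls_rd_bnd.
rewrite (_ : (fun x => - u x) = fun x => -1 * u x); first exact: cls_rdZ.
by apply/funext => x; rewrite mulN1r.
Qed.

Lemma psi_sqr x : psi u x ^+ 2 = expR (- u x).
Proof. by rewrite /psi -expRM_natl; congr expR; field. Qed.

Lemma psi_sqrV x : psi u x ^- 2 = expR (u x).
Proof. by rewrite psi_sqr expRN invrK. Qed.

Definition psi_int x := oriented_integral x0 x (fun t => expR (u t)).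

Lemma Der_psi_int : Der psi_int (fun x => expR (u x)).
Proof. by apply: Der_oriented; exact: cls_continuous cls_expu. Qed.

Lemma lingrow_psi_int : lingrow psi_int.
Proof. by apply: Der_bnd_lingrow Der_psi_int _; exact: cls_in cls_expu. Qed.

Lemma psi_tildeE x : psi u x * psi_tilde u x0 x = expR (- u x) * psi_int x.
Proof.
rewrite /psi_tilde mulrA -expr2 psi_sqr; congr (_ * _).
by rewrite /psi_int; congr oriented_integral; apply/funext => t; exact: psi_sqrV.
Qed.

Lemma Lambda1E v : Lambda1 u v = \int[mu]_x (expR (- u x) * v x).
Proof. by rewrite /Lambda1; under eq_Rintegral do rewrite psi_sqr. Qed.

Lemma Lambda2E v :
  Lambda2 u x0 v = \int[mu]_x (expR (- u x) * psi_int x * v x).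
Proof. by rewrite /Lambda2; under eq_Rintegral do rewrite psi_tildeE. Qed.

(** The linearized map in terms of the derivative g of its argument; in
    divergence form it is exp(u) (exp(-u) g)' / 2. *)
Definition lin g x := 2^-1 * (g^`() x - u^`() x * g x).

Lemma DbersE h g : Der h g -> Dbers u h = lin g.
Proof. by move=> hg; rewrite /Dbers /derive1n/= (Der_derive1 hg). Qed.

Lemma lin_rd g : cls (@rd R) g -> cls (@rd R) (lin g).
Proof.
move=> cg; rewrite (_ : lin g = fun x => 2^-1 * (g^`() x + -1 * (u^`() x * g x))).
  apply: cls_rdZ; apply: cls_rdD; first exact: cls_derivative.
  by apply: cls_rdZ; apply: cls_rd_bndM => //; exact: cls_derivative.
by apply/funext => x; rewrite /lin; ring.
Qed.

Lemma Der_divergence g : Der g g^`() ->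
  Der (fun x => 2^-1 * (expR (- u x) * g x)) (fun x => expR (- u x) * lin g x).
Proof. by move=> gd; der; rewrite /lin; ring. Qed.

Lemma rd_cvg0 f : rd f -> f x @[x --> -oo] --> (0:R) /\ f x @[x --> +oo] --> (0:R).
Proof. by move=> fr; split; [exact: rd_cvgNy|exact: rd_cvgy]. Qed.

(** The integrand is the derivative of exp(-u) g / 2, which vanishes at both ends. *)
Lemma Lambda1_lin g : cls (@rd R) g -> Lambda1 u (lin g) = 0.
Proof.
move=> cg; rewrite Lambda1E.
have r : rd (fun x => 2^-1 * (expR (- u x) * g x)).
  by apply: cls_in; apply: cls_rdZ; apply: cls_rdM => //; exact: cls_expNu.
have [r1 r2] := rd_cvg0 r.
rewrite (dom_integral (Der_divergence (cls_derive1 cg)) _ r1 r2) ?subrr//.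
by apply: cls_rd_dom; apply: cls_rdM; [exact: cls_expNu|exact: lin_rd].
Qed.

(** In the integration by parts the derivative exp(u) of the weight cancels exp(-u),
    so that only the mean of g survives. *)
Lemma Lambda2_lin g : cls (@rd R) g ->
  Lambda2 u x0 (lin g) = - (2^-1 * \int[mu]_x g x).
Proof.
move=> cg; rewrite Lambda2E; have gd := cls_derive1 cg.
have [G [Gg G0 Goo]] := dom_primitive (cls_rd_dom cg).
have r : rd (fun x => psi_int x * (2^-1 * (expR (- u x) * g x))).
  apply: lingrow_rdM; first exact: lingrow_psi_int.
  by apply: cls_in; apply: cls_rdZ; apply: cls_rdM => //; exact: cls_expNu.
have [r1 r2] := rd_cvg0 r.
rewrite (@dom_integral _ (fun x => psi_int x * (2^-1 * (expR (- u x) * g x)) + - (2^-1 * G x)) _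
  (0 + - (2^-1 * 0)) (0 + - (2^-1 * \int[mu]_x g x))); first by ring.
- apply: Der_eq.
    apply: DerD; first exact: (DerM Der_psi_int (Der_divergence gd)).
    by apply: DerN; apply: DerM Gg; exact: Der_cst.
  move=> x /=; rewrite -[g x in X in _ + - X]mul1r -(expRxMexpNx_1 (u x)); ring.
- apply: rd_dom.
    have c1 := Der_continuous Der_psi_int; have c2 := cls_continuous cls_expNu.
    have c3 := cls_continuous (lin_rd cg).
    by move=> x; apply: cvgM; [apply: cvgM; [exact: c2|exact: c1]|exact: c3].
  apply: lingrow_rdM; last exact: cls_in (lin_rd cg).
  by apply: lingrow_bndM; [exact: cls_in cls_expNu|exact: lingrow_psi_int].
- by apply: cvgD => //; apply: cvgN; exact: cvgMr.
- by apply: cvgD => //; apply: cvgN; exact: cvgMr.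
Qed.

(** Integrating the divergence form gives g = 2 exp(u) times the integral of
    exp(-u) v from -oo; it decays at +oo because the total integral vanishes. *)
Lemma lin_surj v : cls (@rd R) v -> Lambda1 u v = 0 ->
  exists2 g, cls (@rd R) g & lin g = v.
Proof.
rewrite Lambda1E => cv v0.
have cw : cls (@rd R) (fun x => 2 * (expR (- u x) * v x)).
  by apply: cls_rdZ; apply: cls_rdM => //; exact: cls_expNu.
have [|F Fd cF] := rd_primitive cw.
  rewrite RintegralZl//; first by rewrite v0 mulr0.
  by apply: dom_intg; apply: cls_rd_dom; apply: cls_rdM => //; exact: cls_expNu.
exists (fun x => expR (u x) * F x); first by apply: cls_rdM => //; exact: cls_expu.
have gd := DerM (Der_expR ud) Fd.
apply/funext => x; rewrite /lin (Der_derive1 gd) /= -[v x in RHS]mul1r.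
by rewrite -[1 in RHS](expRxMexpNx_1 (u x)); field.
Qed.

End with_u.
End linearized.

(** * The Schwartz topology *)

Section schwartz_topology.
Variable R : realType.
Local Notation mu := (@lebesgue_measure R).
Local Notation S := (schwartzType R).
Implicit Types (v w : S).

Lemma schwartz_open_ball v m n (r : R) : 0 < r ->
  open [set g : S | schwartz_seminorm m n (g - v : S) < r].
Proof.
move=> r0.
exists [set [set g : S | schwartz_seminorm m n (g - v : S) < r]]; last first.
  by rewrite bigcup_set1.
move=> _ ->; exists [fset (v, (m, n), r)]%fset.
  by move=> i; rewrite in_fsetE => /eqP ->; exact: mem_set.
by rewrite set_fset1 bigcap_set1.
Qed.

(** Balls with arbitrary centres generate the topology, so a neighbourhood contains
    a finite intersection of balls containing v. *)
Lemma schwartz_cvg (F : set_system S) (v : S) : Filter F ->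
  (forall w m n r, schwartz_seminorm m n (v - w : S) < r ->
     F [set g : S | schwartz_seminorm m n (g - w : S) < r]) -> F --> v.
Proof.
move=> FF H A; rewrite /= nbhsE => -[B [oB Bv] BA]; apply: filterS BA _.
case: oB => D hD eB; move: Bv; rewrite -eB => -[C DC Cv].
apply: (@filterS _ _ _ C); first by move=> g Cg; exists C.
have [D' hD' eC] := hD _ DC; rewrite -eC; apply: filter_bigI => -[[w [m n]] r] iD.
have iD' : [set` D'] (w, (m, n), r) by [].
by apply: H; move: Cv; rewrite -eC => /(_ _ iD').
Qed.

Lemma schwartzK (f : R -> R) (cf : cls (@rd R) f) :
  { v : S | v = f :> (R -> R) }.
Proof. by exists (Schwartz (introT (schwartzP f) cf)). Qed.

Lemma schwartz_cls v : cls (@rd R) v.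
Proof. by apply/schwartzP; case: v. Qed.

Lemma seminorm_has_sup m n v :
  has_sup [set `|x| ^+ m * `|v^`(n) x| | x in [set: R]].
Proof.
split; first by exists (`|0 : R| ^+ m * `|v^`(n) 0|), 0.
have /clsE/(_ n)[_ /(_ m)[C hC]] := schwartz_cls v.
by exists C => _ [x _ <-].
Qed.

Lemma le_seminorm m n v x : `|x| ^+ m * `|v^`(n) x| <= schwartz_seminorm m n v.
Proof. by apply: ub_le_sup; [have [] := seminorm_has_sup m n v|exists x]. Qed.

Lemma seminorm_le m n v C : (forall x, `|x| ^+ m * `|v^`(n) x| <= C) ->
  schwartz_seminorm m n v <= C.
Proof.
move=> hC; apply: ge_sup; first by have [] := seminorm_has_sup m n v.
by move=> _ [x _ <-].
Qed.

Lemma seminorm_ge0 m n v : 0 <= schwartz_seminorm m n v.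
Proof. by apply: le_trans (le_seminorm m n v 0); rewrite mulr_ge0 ?exprn_ge0. Qed.

Lemma schwartz_derive1nD n (a : R) v w :
  (a *: v + w : S)^`(n) = (fun x => a * v^`(n) x + w^`(n) x).
Proof.
have sv : smooth v by apply/smoothE; apply: cls_any; exact: schwartz_cls.
have sw : smooth w by apply/smoothE; apply: cls_any; exact: schwartz_cls.
exact: (@derive1n_linear R a v w n sv sw).
Qed.

Lemma seminormD m n v w :
  schwartz_seminorm m n (v + w : S) <=
  schwartz_seminorm m n v + schwartz_seminorm m n w.
Proof.
apply: seminorm_le => x; rewrite -[v]scale1r schwartz_derive1nD mul1r scale1r.
apply: le_trans (lerD (le_seminorm m n v x) (le_seminorm m n w x)).
by rewrite -mulrDr ler_wpM2l ?exprn_ge0// ler_normD.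
Qed.

Lemma seminorm_self m n v e : 0 < e -> schwartz_seminorm m n (v - v : S) < e.
Proof.
move=> e0; apply: le_lt_trans e0; apply: (@seminorm_le m n (v - v)) => x.
by rewrite subrr (derive1n_cst0 R n) normr0 mulr0.
Qed.

Lemma schwartz_cvg0 (F : set_system S) (v : S) : Filter F ->
  (forall m n e, 0 < e -> F [set g : S | schwartz_seminorm m n (g - v : S) < e]) ->
  F --> v.
Proof.
move=> FF H; apply: schwartz_cvg => w m n r vw.
have e0 : 0 < r - schwartz_seminorm m n (v - w : S) by rewrite subr_gt0.
apply: filterS (H m n _ e0) => g /=; rewrite ltrBrDr; apply: le_lt_trans.
by have := seminormD m n (g - v) (v - w); rewrite addrA subrK.
Qed.

(** If L v is not zero, a small ball around v for the finitely many seminorms in the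
    bound misses the kernel. *)
Lemma closed_kernel (L : S -> R) (M : nat) C :
  (forall v w, L (v - w) = L v - L w) ->
  (forall v, `|L v| <= C * \sum_(m < M) schwartz_seminorm m 0 v) ->
  closed [set v | L v = 0].
Proof.
move=> LB hL v clv; apply/eqP; apply: contrapT => /negP Lv0.
pose e := `|L v| / ((`|C| + 1) * (M%:R + 1)).
have C1 : 0 < `|C| + 1 by rewrite ltr_wpDl.
have M1 : 0 < M%:R + 1 :> R by rewrite ltr_wpDl.
have e0 : 0 < e by rewrite divr_gt0 ?normr_gt0// mulr_gt0.
have nb : nbhs v [set g : S | forall m : 'I_M, schwartz_seminorm m 0 (g - v : S) < e].
  apply: (@filter_forall _ _ (fun (m : 'I_M) (g : S) =>
    schwartz_seminorm m 0 (g - v : S) < e) (nbhs v) (nbhs_filter v)) => m.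
  apply: open_nbhs_nbhs; split; first exact: schwartz_open_ball.
  exact: seminorm_self.
have [g [Lg Hg]] := clv _ nb.
have : `|L v| < `|L v|; last by rewrite ltxx.
have {1}-> : L v = - L (g - v) by rewrite LB Lg sub0r opprK.
rewrite normrN (le_lt_trans (hL _))//.
apply: (@le_lt_trans _ _ (`|C| * (M%:R * e))).
  apply: (@le_trans _ _ (`|C| * \sum_(m < M) schwartz_seminorm m 0 (g - v : S))).
    by rewrite ler_wpM2r ?ler_norm// sumr_ge0// => m _; exact: seminorm_ge0.
  rewrite ler_wpM2l// mulr_natl -[M in _ *+ M]card_ord -sumr_const.
  by apply: ler_sum => m _; rewrite ltW// Hg.
have -> : `|L v| = (`|C| + 1) * ((M%:R + 1) * e).
  by rewrite /e mulrA mulrCA mulfV ?mulr1// gt_eqF// mulr_gt0.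
rewrite [ltRHS]mulrDl [in ltRHS]mulrDl !mul1r.
have := mulr_ge0 (normr_ge0 C) (ltW e0); have := mulr_ge0 (ler0n R M) (ltW e0).
by rewrite mulrDr; lra.
Qed.

End schwartz_topology.

(** * The range on the Schwartz space *)

Section schwartz_range.
Variable R : realType.
Local Notation mu := (@lebesgue_measure R).
Local Notation S := (schwartzType R).
Implicit Types (v w : S) (f : R -> R).

Lemma lingrow_dom f v : continuous f -> lingrow f -> dom (fun x => f x * v x).
Proof.
move=> cf lf; have cv := schwartz_cls v; apply: rd_dom.
  by move=> x; apply: cvgM; [exact: cf|exact: (cls_continuous cv)].
by apply: lingrow_rdM => //; exact: cls_in.
Qed.

Lemma functional_linear f : continuous f -> lingrow f -> forall a v w,
  \int[mu]_x (f x * (a *: v + w : S) x) =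
  a * \int[mu]_x (f x * v x) + \int[mu]_x (f x * w x).
Proof.
move=> cf lf a v w.
have iv := dom_intg (lingrow_dom v cf lf); have iw := dom_intg (lingrow_dom w cf lf).
rewrite -RintegralZl// -RintegralD//; last exact: intgZ.
by apply: eq_Rintegral => x _; rewrite mulrDr mulrCA.
Qed.

Lemma functional_bound f : continuous f -> lingrow f -> exists C, forall v,
  `|\int[mu]_x (f x * v x)| <= C * \sum_(m < 4) schwartz_seminorm m 0 v.
Proof.
move=> cf lf; have [A hA] := lf.
have A0 : 0 <= A by have := hA 0; rewrite normr0 addr0 mulr1; exact: le_trans.
exists (A * \int[mu]_x wt x) => v; set N := \sum_(m < 4) _.
have H x : `|f x * v x| <= (A * N) * wt x.
  rewrite -ler_pdivrMr ?wt_gt0// invrK normrM.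
  apply: (@le_trans _ _ (A * (1 + `|x|) * `|v x| * (1 + x ^+ 2))).
    by rewrite ler_wpM2r ?addr_ge0 ?sqr_ge0// ler_wpM2r.
  rewrite -!mulrA ler_wpM2l// /N !big_ord_recl big_ord0 addr0 /=.
  rewrite -[x ^+ 2]real_normK ?num_real//.
  have -> : (1 + `|x|) * (`|v x| * (1 + `|x| ^+ 2)) =
    `|x| ^+ 0 * `|v x| + (`|x| ^+ 1 * `|v x| + (`|x| ^+ 2 * `|v x| + `|x| ^+ 3 * `|v x|)) by ring.
  by rewrite !lerD//; exact: (le_seminorm _ 0).
apply: le_trans (dom_Rintegral_le measurableT (lingrow_dom v cf lf) H) _.
by rewrite -!mulrA ler_wpM2l// mulrC.
Qed.

Section with_u.
Variables (u : R -> R) (x0 : R).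
Hypothesis cu : cls (@rd R) u.
Local Notation L1 := (Lambda1 u).
Local Notation L2 := (Lambda2 u x0).

Let f1 := fun x => expR (- u x).
Let f2 := fun x => expR (- u x) * psi_int u x0 x.

Let cf1 : continuous f1. Proof. exact: cls_continuous (cls_expNu cu). Qed.
Let lf1 : lingrow f1.
Proof.
have [C hC] := cls_in (cls_expNu cu); exists C => x; rewrite (le_trans (hC x))//.
by rewrite ler_peMr ?lerDl// (le_trans _ (hC 0)).
Qed.
Let cf2 : continuous f2.
Proof.
move=> x; apply: cvgM; first exact: cf1.
exact: (Der_continuous (Der_psi_int cu x0)).
Qed.
Let lf2 : lingrow f2.
Proof.
apply: lingrow_bndM; [exact: cls_in (cls_expNu cu)|exact: lingrow_psi_int].
Qed.

Lemma Lambda1_linear a v w : L1 (a *: v + w : S) = a * L1 v + L1 w.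
Proof. by rewrite !Lambda1E; exact: functional_linear cf1 lf1 a v w. Qed.

Lemma Lambda2_linear a v w : L2 (a *: v + w : S) = a * L2 v + L2 w.
Proof. by rewrite !Lambda2E; exact: functional_linear cf2 lf2 a v w. Qed.

Lemma Lambda1B v w : L1 (v - w : S) = L1 v - L1 w.
Proof. by rewrite addrC -scaleN1r Lambda1_linear addrC mulN1r. Qed.

Lemma Lambda2B v w : L2 (v - w : S) = L2 v - L2 w.
Proof. by rewrite addrC -scaleN1r Lambda2_linear addrC mulN1r. Qed.

Lemma Lambda1_0 : L1 (0 : S) = 0.
Proof. by rewrite -(subrr (0 : S)) Lambda1B subrr. Qed.

Lemma Lambda2_0 : L2 (0 : S) = 0.
Proof. by rewrite -(subrr (0 : S)) Lambda2B subrr. Qed.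

Lemma Lambda_bound : exists C, forall v,
  `|L1 v| <= C * \sum_(m < 4) schwartz_seminorm m 0 v /\
  `|L2 v| <= C * \sum_(m < 4) schwartz_seminorm m 0 v.
Proof.
have [A hA] := functional_bound cf1 lf1; have [B hB] := functional_bound cf2 lf2.
exists (Num.max A B) => v.
have N0 : 0 <= \sum_(m < 4) schwartz_seminorm m 0 v.
  by apply: sumr_ge0 => m _; exact: seminorm_ge0.
rewrite Lambda1E Lambda2E; split.
  by apply: le_trans (hA v) _; rewrite ler_wpM2r// le_max lexx.
by apply: le_trans (hB v) _; rewrite ler_wpM2r// le_max lexx orbT.
Qed.

(** A basis dual to the two functionals, made from a bump function b: the second
    vector is the image of a primitive of b, and the first is exp(u) b corrected
    by the second. *)
Lemma dual_basis : exists e0 e1 : S,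
  [/\ L1 e0 = 1, L2 e0 = 0, L1 e1 = 0 & L2 e1 = 1].
Proof.
have [b [cb _ b1 _]] := exists_bump R; have rb := cls_cpt_rd cb.
have [a ea] := schwartzK (cls_rdM (cls_expu cu) rb).
have [c ec] := schwartzK (lin_rd cu rb).
have La : L1 a = 1.
  rewrite Lambda1E ea -[RHS]b1; apply: eq_Rintegral => x _.
  by rewrite mulrA [expR _ * _]mulrC expRxMexpNx_1 mul1r.
have L1c : L1 c = 0 by rewrite ec Lambda1_lin.
have L2c : L2 c = - 2^-1 by rewrite ec Lambda2_lin// b1 mulr1.
pose e1 : S := (-2) *: c + 0.
have L1e1 : L1 e1 = 0 by rewrite /e1 Lambda1_linear L1c Lambda1_0; ring.
have L2e1 : L2 e1 = 1 by rewrite /e1 Lambda2_linear L2c Lambda2_0; field.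
exists (- L2 a *: e1 + a), e1; split=> //.
  by rewrite Lambda1_linear L1e1 La mulr0 add0r.
by rewrite Lambda2_linear L2e1 mulr1 addNr.
Qed.

Lemma Dbers_schwartz (h : S) : Dbers u h \in @schwartz R.
Proof.
have ch := schwartz_cls h; apply/schwartzP.
rewrite (DbersE u (cls_derive1 ch)); apply: lin_rd => //.
exact: cls_derivative.
Qed.

(** Since Dbers u h = lin u h', a function lin u g is in the range when g has a
    Schwartz primitive, that is zero mean; Lambda2 reads off this mean. *)
Lemma range_DbersE :
  [set v : S | exists h : S, Dbers u h = v :> (R -> R)] =
  [set v : S | L1 v = 0 /\ L2 v = 0].
Proof.
apply/seteqP; split=> v /=.
  move=> [h hv]; have ch := schwartz_cls h; have cg := cls_derivative ch.
  have hd := cls_derive1 ch; rewrite -hv (DbersE u hd) Lambda1_lin// Lambda2_lin//.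
  have [r1 r2] := rd_cvg0 (cls_in ch).
  by rewrite (dom_integral hd (cls_rd_dom cg) r1 r2) subrr mulr0 oppr0.
move=> [v1 v2]; have [g cg gv] := lin_surj cu (schwartz_cls v) v1.
have g0 : \int[mu]_x g x = 0.
  by move: v2; rewrite -gv Lambda2_lin// => /eqP; rewrite oppr_eq0 mulf_eq0 invr_eq0 pnatr_eq0 => /eqP.
have [h hg ch] := rd_primitive cg g0; have [h' eh'] := schwartzK ch.
by exists h'; rewrite eh' (DbersE u hg).
Qed.

(** The range is an intersection of two closed kernels, and the projection built
    from the dual basis splits it off. *)
Theorem schwartz_range :
  let range_S := [set v : S | exists h : S, Dbers u h = v :> (R -> R)] in
  [/\ closed range_S, split_subspace range_S & codimension 2 range_S].
Proof.
rewrite /= range_DbersE; set A := [set v | _].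
have [C hC] := Lambda_bound.
have clA : closed A.
  apply: (@closedI _ [set v : S | L1 v = 0] [set v : S | L2 v = 0]).
    exact: (closed_kernel Lambda1B (fun v => proj1 (hC v))).
  exact: (closed_kernel Lambda2B (fun v => proj2 (hC v))).
have [e0 [e1 [L10 L20 L11 L21]]] := dual_basis.
have Lc c0 c1 : L1 (c0 *: e0 + (c1 *: e1 + 0) : S) = c0 /\ L2 (c0 *: e0 + (c1 *: e1 + 0) : S) = c1.
  by rewrite !Lambda1_linear !Lambda2_linear L10 L20 L11 L21 Lambda1_0 Lambda2_0; split; ring.
pose P (v : S) : S := L1 v *: e0 + (L2 v *: e1 + 0).
have AP v : A (v - P v).
  by have [p1 p2] := Lc (L1 v) (L2 v); split; rewrite ?Lambda1B ?Lambda2B ?p1 ?p2 subrr.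
split=> //.
- split=> //.
    split; first by split; [exact: Lambda1_0|exact: Lambda2_0].
    move=> a v w [v1 v2] [w1 w2].
    by split; rewrite ?Lambda1_linear ?Lambda2_linear ?v1 ?v2 ?w1 ?w2 mulr0 addr0.
  pose T x (v : S) := v x - (P v) x.
  have TE x v : T x v = v x - L1 v * e0 x - L2 v * e1 x.
    have e : T x v = v x - (L1 v * e0 x + (L2 v * e1 x + 0)) by [].
    by rewrite e; ring.
  (* the complement is the span of e0 and e1; written as a common kernel of bounded
     functionals it is visibly closed *)
  exists [set v | forall x, T x v = 0]; split.
  + have TL x a v w : T x (a *: v + w) = a * T x v + T x w.
      rewrite !TE Lambda1_linear Lambda2_linear.
      have -> : (a *: v + w : S) x = a * v x + w x by [].
      ring.
    split=> [x|a v w Hv Hw x]; last by rewrite TL Hv Hw mulr0 addr0.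
    by have := TL x (-1) 0 0; rewrite scaler0 addr0; lra.
  + rewrite (_ : [set v | _] = \bigcap_(x in setT) [set v | T x v = 0]); last first.
      by apply/seteqP; split=> v H x; [move=> _; exact: H|exact: H].
    apply: closed_bigI => x _.
    apply: (@closed_kernel _ (T x) 4 (1 + C * (`|e0 x| + `|e1 x|))).
      move=> v w; rewrite !TE Lambda1B Lambda2B.
      have -> : (v - w : S) x = v x - w x by [].
      ring.
    move=> v; have [h1 h2] := hC v; set N := \sum_(m < 4) _ in h1 h2 *.
    have hv : `|v x| <= N.
      have := le_seminorm 0 0 v x; rewrite expr0 mul1r => /le_trans; apply.
      rewrite /N big_ord_recl lerDl; apply: sumr_ge0 => m _; exact: seminorm_ge0.
    rewrite TE (le_trans (ler_normB _ _))// (le_trans (lerD (ler_normB _ _) (lexx _)))//.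
    rewrite !normrM.
    have i1 := ler_wpM2r (normr_ge0 (e0 x)) h1.
    have i2 := ler_wpM2r (normr_ge0 (e1 x)) h2.
    rewrite (le_trans (lerD (lerD hv i1) i2))//.
    by rewrite le_eqVlt; apply/orP; left; apply/eqP; ring.
  + apply/seteqP; split=> v /=; last first.
      move=> ->; split; first by split; [exact: Lambda1_0|exact: Lambda2_0].
      by move=> x; rewrite TE Lambda1_0 Lambda2_0 !mul0r !subr0.
    move=> [[v1 v2] H]; apply: val_inj; apply/funext => x /=.
    by have := H x; rewrite TE v1 v2 !mul0r !subr0.
  + apply/seteqP; split=> // v _ /=; exists (v - P v); first exact: AP.
    exists (P v); last by rewrite subrK.
    move=> x; have [p1 p2] := Lc (L1 v) (L2 v).
    by rewrite /T [P (P v)]/P p1 p2 subrr.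
- pose e (i : 'I_2) := if i == ord0 then e0 else e1.
  exists e => v.
  have sumE (c : {ffun 'I_2 -> R}) : \sum_(i < 2) c i *: e i =
      c ord0 *: e0 + (c (lift ord0 ord0) *: e1 + 0).
    by rewrite !big_ord_recl big_ord0.
  exists [ffun i => if i == ord0 then L1 v else L2 v]; split.
    by rewrite sumE !ffunE /=; exact: AP.
  move=> c; rewrite sumE => -[].
  have [p1 p2] := Lc (c ord0) (c (lift ord0 ord0)).
  rewrite Lambda1B Lambda2B p1 p2 => /eqP + /eqP; rewrite !subr_eq0 => /eqP -> /eqP ->.
  apply/ffunP => i; rewrite ffunE; case: ifPn => [/eqP -> //|].
  by case: i => [[|[|i]] Hi]// _; congr (c _); exact: val_inj.
Qed.

End with_u.
End schwartz_range.

(** * Integrable linear systems on the line *)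

Section linear_system.
Variable R : realType.
Local Notation mu := (@lebesgue_measure R).
Implicit Types (f g q c s A B : R -> R).

Lemma Der_boundNy F f G g x : Der F f -> Der G g -> (forall y, `|f y| <= g y) ->
  F y @[y --> -oo] --> (0 : R) -> (forall y, 0 <= G y) -> `|F x| <= G x.
Proof.
move=> Ff Gg le F0 G0.
have : `|F x - F y| @[y --> -oo] --> `|F x - 0|.
  by apply: cvg_norm; apply: cvgB => //; exact: cvg_cst.
rewrite subr0 => H; apply: (ler_cvg_to H (cvg_cst (G x))).
near=> y; have yx : y <= x by near: y; apply: nbhs_ninfty_le; exact: num_real.
apply: le_trans (Der_ler_norm Ff Gg (fun z _ => le z) yx) _.
by rewrite gerBl.
Unshelve. all: by end_near. Qed.

Lemma exists_nat_gt (x : R) : exists n : nat, x < n%:R.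
Proof.
exists (archimedean.Num.truncn x).+1; exact: archimedean.Num.Theory.truncnS_gt.
Qed.

(** A sequence with geometric steps converges at a geometric rate: it is caught
    between a nondecreasing and a nonincreasing sequence. *)
Lemma geometric_limit (x : nat -> R) C : (forall n, `|x n.+1 - x n| <= C / 2 ^+ n) ->
  exists l, forall n, `|l - x n| <= 2 * C / 2 ^+ n.
Proof.
move=> h; pose y n := x n - 2 * C / 2 ^+ n; pose z n := x n + 2 * C / 2 ^+ n.
have p2 n : 0 < 2 ^+ n :> R by rewrite exprn_gt0.
have C0 : 0 <= C by have := h 0%N; rewrite expr0 divr1; exact: le_trans.
have e2 n : 2 * C / 2 ^+ n.+1 = C / 2 ^+ n :> R.
  by rewrite exprS; field; rewrite expf_neq0.
have yS n : y n <= y n.+1.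
  have := h n; rewrite ler_norml => /andP[h1 _]; rewrite /y e2.
  by rewrite -mulrA; lra.
have zS n : z n.+1 <= z n.
  have := h n; rewrite ler_norml => /andP[_ h2]; rewrite /z e2.
  by rewrite -mulrA; lra.
have ym n m : (n <= m)%N -> y n <= y m.
  by move=> nm; apply: (homo_leq (@lexx _ _) (@le_trans _ _)) nm.
have zm n m : (n <= m)%N -> z m <= z n.
  by move=> nm; apply: (homo_leq (r := fun a b => b <= a) (@lexx _ _) _) nm => // a b d ab bd; apply: le_trans bd ab.
have yz n m : y n <= z m.
  have yzn k : y k <= z k.
    by rewrite /y /z lerD2l ge0_cp// ?divr_ge0 ?mulr_ge0// ltW.
  have [nm|mn] := leqP n m; first exact: le_trans (ym _ _ nm) (yzn m).
  exact: le_trans (yzn n) (zm _ _ (ltnW mn)).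
have hs : has_sup (range y).
  by split; [exists (y 0%N), 0%N|exists (z 0%N) => _ [n _ <-]].
exists (sup (range y)) => n; rewrite ler_distl; apply/andP; split.
  by apply: ub_le_sup; [case: hs|exists n].
by apply: ge_sup; [case: hs|move=> _ [m _ <-]; exact: yz].
Qed.

Lemma continuous_uniform f :
  (forall e, 0 < e -> exists2 g, continuous g & forall x, `|f x - g x| <= e) ->
  continuous f.
Proof.
move=> h x; apply/cvgrPdist_le => e e0.
have e3 : 0 < e / 3 by rewrite divr_gt0.
have [g cg fg] := h _ e3.
have /cvgrPdist_le/(_ _ e3) := cg x; apply: filterS => y gxy.
have -> : f x - f y = (f x - g x) + (g x - g y) + (g y - f y) by ring.
rewrite (le_trans (ler_normD _ _))// (le_trans (lerD (ler_normD _ _) (lexx _)))//.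
have := fg y; rewrite distrC => gy.
by rewrite (le_trans (lerD (lerD (fg x) gxy) gy))//; lra.
Qed.

Lemma DerB f g df dg : Der f df -> Der g dg ->
  Der (fun x => f x - g x) (fun x => df x - dg x).
Proof. by move=> fd gd; apply: DerD => //; exact: DerN. Qed.

Lemma lintB f g x : dom f -> dom g -> lint f x - lint g x = lint (fun y => f y - g y) x.
Proof.
by move=> df dg; rewrite /lint RintegralB//; exact: dom_integrable.
Qed.

Lemma lint_le f C x : dom f -> (forall y, `|f y| <= C * wt y) -> `|lint f x| <= C * pi.
Proof.
move=> df hC; have [Fd F0 _] := lintP df.
have C0 : 0 <= C.
  by have := le_trans (normr_ge0 _) (hC 0); rewrite pmulr_lge0// wt_gt0.
have := dom_boundNy (x := x) Fd (fun y _ => hC y) F0; rewrite subr0 => /le_trans; apply.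
by rewrite ler_wpM2l// atan_le_pi.
Qed.

(** The first-order form of a Schrodinger equation in the coordinates of a
    solution A c + B s: the coefficient matrix has rank one. *)
Definition sys q c s A B :=
  Der A (fun x => s x * q x * (A x * c x + B x * s x)) /\
  Der B (fun x => - (c x * q x * (A x * c x + B x * s x))).

Section existence.
Variables (q c s : R -> R) (K : R).
Hypotheses (cq : continuous q) (cc : continuous c) (cs : continuous s).
Hypothesis hK : forall x, `|q x| * (`|c x| + `|s x|) ^+ 2 <= K * wt x.

Let K0 : 0 <= K.
Proof.
have := le_trans (mulr_ge0 (normr_ge0 (q 0)) (sqr_ge0 _)) (hK 0).
by rewrite pmulr_lge0// wt_gt0.
Qed.

Lemma sys_bound (p : R -> R) a b x : (forall x, `|p x| <= `|c x| + `|s x|) ->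
  `|p x * q x * (a * c x + b * s x)| <= K * wt x * (`|a| + `|b|).
Proof.
move=> hp; have := hK x; set M := `|c x| + `|s x| => hM.
apply: (@le_trans _ _ (M * `|q x| * (M * (`|a| + `|b|)))).
  rewrite !normrM ler_pM// ?mulr_ge0//; first by rewrite ler_wpM2r.
  rewrite (le_trans (ler_normD _ _))// !normrM /M.
  have := normr_ge0 (c x); have := normr_ge0 (s x).
  have := normr_ge0 a; have := normr_ge0 b; nra.
have -> : M * `|q x| * (M * (`|a| + `|b|)) = `|q x| * M ^+ 2 * (`|a| + `|b|) by ring.
by rewrite ler_wpM2r ?addr_ge0.
Qed.

Lemma hc x : `|c x| <= `|c x| + `|s x|. Proof. by rewrite lerDl. Qed.
Lemma hs x : `|s x| <= `|c x| + `|s x|. Proof. by rewrite lerDr. Qed.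

Lemma sys_dom (p A B : R -> R) M : continuous p -> continuous A -> continuous B ->
  (forall x, `|p x| <= `|c x| + `|s x|) -> (forall x, `|A x| + `|B x| <= M) ->
  dom (fun x => p x * q x * (A x * c x + B x * s x)).
Proof.
move=> cp cA cB hp hM; split.
  move=> x; apply: cvgM; first by apply: cvgM; [exact: cp|exact: cq].
  by apply: cvgD; apply: cvgM; [exact: cA|exact: cc|exact: cB|exact: cs].
exists (K * M) => x; apply: le_trans (sys_bound _ _ x hp) _.
by rewrite mulrAC ler_wpM2r ?(ltW (wt_gt0 x))// ler_wpM2l.
Qed.

Variables (a b : R).

Fixpoint picard n : (R -> R) * (R -> R) :=
  if n is m.+1 then
    let A := (picard m).1 in let B := (picard m).2 in
    (fun x => a + lint (fun x => s x * q x * (A x * c x + B x * s x)) x,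
     fun x => b - lint (fun x => c x * q x * (A x * c x + B x * s x)) x)
  else (fun=> 0, fun=> 0).

Let PA n := (picard n).1.
Let PB n := (picard n).2.
Let rA n x := s x * q x * (PA n x * c x + PB n x * s x).
Let rB n x := c x * q x * (PA n x * c x + PB n x * s x).

Lemma picard_reg n : [/\ continuous (PA n), continuous (PB n) &
  exists M, forall x, `|PA n x| + `|PB n x| <= M].
Proof.
elim: n => [|n [cA cB [M hM]]].
  by split; [exact: cst_continuous|exact: cst_continuous|exists 0 => x; rewrite !normr0 addr0].
have dA : dom (rA n) by exact: (sys_dom cs cA cB hs hM).
have dB : dom (rB n) by exact: (sys_dom cc cA cB hc hM).
have [lA _ _] := lintP dA; have [lB _ _] := lintP dB.
split.
- by move=> x; apply: cvgD; [exact: cvg_cst|exact: (Der_continuous lA)].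
- by move=> x; apply: cvgB; [exact: cvg_cst|exact: (Der_continuous lB)].
- exists (`|a| + K * M * pi + (`|b| + K * M * pi)) => x.
  have bnd p : (forall x, `|p x| <= `|c x| + `|s x|) ->
      forall y, `|p y * q y * (PA n y * c y + PB n y * s y)| <= K * M * wt y.
    move=> hp y; apply: le_trans (sys_bound _ _ y hp) _.
    by rewrite mulrAC ler_wpM2r ?(ltW (wt_gt0 y))// ler_wpM2l.
  apply: lerD; apply: le_trans (ler_normD _ _) _.
    by rewrite lerD2l; apply: lint_le => //; exact: bnd hs.
  by rewrite normrN lerD2l; apply: lint_le => //; exact: bnd hc.
Qed.

Let dA n : dom (rA n).
Proof. by have [cA cB [M hM]] := picard_reg n; exact: (sys_dom cs cA cB hs hM). Qed.
Let dB n : dom (rB n).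
Proof. by have [cA cB [M hM]] := picard_reg n; exact: (sys_dom cc cA cB hc hM). Qed.

Let M0 := (`|a| + `|b|) * expR (4 * K * pi).
Let W x := expR (4 * K * atan x).

Let Der_W C : Der (fun x => C * W x) (fun x => C * (W x * (4 * K * wt x))).
Proof.
apply: Der_eq (DerM (Der_cst C) (Der_expR (DerM (Der_cst (4 * K)) (@Der_wt R)))) _.
by move=> x; rewrite /W; ring.
Qed.

(* the weight exp(4 K atan) absorbs the constant of the system, which makes each
   step contract by a factor 2 *)
Lemma picard_step n x :
  `|PA n.+1 x - PA n x| + `|PB n.+1 x - PB n x| <= M0 / 2 ^+ n * W x.
Proof.
have M00 : 0 <= M0 by rewrite mulr_ge0 ?addr_ge0 ?expR_ge0.
elim: n x => [|n IH] x.
  have l0 (p : R -> R) y : lint (fun x => p x * q x * (0 * c x + 0 * s x)) y = 0.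
    rewrite /lint (@eq_Rintegral _ _ _ mu _ (cst 0)) ?Rintegral_cst ?mul0r//.
    by move=> z _; rewrite !mul0r addr0 mulr0.
  rewrite /PA /PB /= !l0 !subr0 addr0 expr0 divr1 /M0 -mulrA ler_peMr ?addr_ge0//.
  rewrite -expRD -expR0 ler_expR -mulrDr mulr_ge0 ?mulr_ge0// addrC.
  have := @atan_gtNpi2 R x; have := pi_gt0 R; lra.
have eA y : PA n.+2 y - PA n.+1 y = lint (fun z => rA n.+1 z - rA n z) y.
  by rewrite /PA /= -lintB//; ring.
have eB y : PB n.+2 y - PB n.+1 y = - lint (fun z => rB n.+1 z - rB n z) y.
  by rewrite /PB /= -lintB//; ring.
have bnd p : (forall x, `|p x| <= `|c x| + `|s x|) -> forall y,
    `|p y * q y * (PA n.+1 y * c y + PB n.+1 y * s y) -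
      p y * q y * (PA n y * c y + PB n y * s y)| <=
    M0 / 2 ^+ n / 4 * (W y * (4 * K * wt y)).
  move=> hp y.
  have -> : p y * q y * (PA n.+1 y * c y + PB n.+1 y * s y) -
      p y * q y * (PA n y * c y + PB n y * s y) =
    p y * q y * ((PA n.+1 y - PA n y) * c y + (PB n.+1 y - PB n y) * s y) by ring.
  apply: le_trans (sys_bound _ _ y hp) _.
  have -> : M0 / 2 ^+ n / 4 * (W y * (4 * K * wt y)) =
      K * wt y * (M0 / 2 ^+ n * W y) by field; rewrite expf_neq0.
  by rewrite ler_wpM2l ?mulr_ge0 ?(ltW (wt_gt0 y)).
have W0 y : 0 <= M0 / 2 ^+ n / 4 * W y.
  by rewrite !mulr_ge0 ?invr_ge0 ?exprn_ge0 ?expR_ge0.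
have domB f g : dom f -> dom g -> dom (fun x => f x - g x).
  move=> df [cg [D hD]]; apply: domD => //; split; first by move=> z; apply: cvgN; exact: cg.
  by exists D => z; rewrite normrN.
have [lA0 lA1 _] := lintP (domB _ _ (dA n.+1) (dA n)).
have [lB0 lB1 _] := lintP (domB _ _ (dB n.+1) (dB n)).
rewrite eA eB normrN.
have hA := Der_boundNy x lA0 (Der_W _) (bnd _ hs) lA1 W0.
have hB := Der_boundNy x lB0 (Der_W _) (bnd _ hc) lB1 W0.
apply: le_trans (lerD hA hB) _; rewrite le_eqVlt; apply/orP; left; apply/eqP.
by rewrite exprS; field; rewrite expf_neq0.
Qed.

(** Picard iteration from -oo; the coefficients are integrable up to -oo, so the
    iteration converges uniformly on the whole line. *)
Theorem sys_exists : exists A B, [/\ sys q c s A B,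
  A x @[x --> -oo] --> a & B x @[x --> -oo] --> b].
Proof.
pose C := M0 * expR (4 * K * pi).
have C0 : 0 <= C by rewrite !mulr_ge0 ?addr_ge0 ?expR_ge0.
have stepC n x : `|PA n.+1 x - PA n x| + `|PB n.+1 x - PB n x| <= C / 2 ^+ n.
  apply: le_trans (picard_step n x) _; rewrite /C mulrAC.
  rewrite ler_wpM2r ?invr_ge0 ?exprn_ge0// ler_wpM2l ?mulr_ge0 ?addr_ge0 ?expR_ge0//.
  rewrite ler_expR ler_wpM2l ?mulr_ge0//.
  by have := @atan_ltpi2 R x; have := pi_gt0 R; lra.
have /choice[A hA] x : exists l, forall n, `|l - PA n x| <= 2 * C / 2 ^+ n.
  apply: geometric_limit => n; apply: le_trans (stepC n x); by rewrite lerDl.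
have /choice[B hB] x : exists l, forall n, `|l - PB n x| <= 2 * C / 2 ^+ n.
  apply: geometric_limit => n; apply: le_trans (stepC n x); by rewrite lerDr.
have small D e : 0 <= D -> 0 < e -> exists n, D / 2 ^+ n <= e :> R.
  move=> D0 e0; have [n hn] := exists_nat_gt (D / e); exists n.
  rewrite ler_pdivrMr ?exprn_gt0// -ler_pdivrMl// mulrC; apply: ltW.
  apply: lt_le_trans hn _.
  by rewrite -natrX ler_nat ltnW// ltn_expl.
have cA : continuous A.
  apply: continuous_uniform => e e0; have [|n hn] := small (2 * C) e _ e0; first by rewrite mulr_ge0.
  by exists (PA n); [case: (picard_reg n)|move=> x; exact: le_trans (hA x n) hn].
have cB : continuous B.
  apply: continuous_uniform => e e0; have [|n hn] := small (2 * C) e _ e0; first by rewrite mulr_ge0.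
  by exists (PB n); [case: (picard_reg n)|move=> x; exact: le_trans (hB x n) hn].
have bAB : exists M, forall x, `|A x| + `|B x| <= M.
  exists (2 * C + 2 * C) => x.
  have := hA x 0%N; have := hB x 0%N; rewrite /PA /PB /= !subr0 !expr0 !divr1.
  by move=> h1 h2; exact: lerD.
have [M hM] := bAB.
have dsA : dom (fun x => s x * q x * (A x * c x + B x * s x)) by exact: (sys_dom cs cA cB hs hM).
have dsB : dom (fun x => c x * q x * (A x * c x + B x * s x)) by exact: (sys_dom cc cA cB hc hM).
have close (p : R -> R) : (forall x, `|p x| <= `|c x| + `|s x|) -> continuous p -> forall (n : nat) (x : R),
  `|lint (fun x => p x * q x * (PA n x * c x + PB n x * s x)) x -
    lint (fun x => p x * q x * (A x * c x + B x * s x)) x| <= K * (4 * C / 2 ^+ n) * pi.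
  move=> hp cp n x.
  have [cPA cPB [Mn hMn]] := picard_reg n.
  have d1 := sys_dom cp cPA cPB hp hMn; have d2 := sys_dom cp cA cB hp hM.
  rewrite lintB//; apply: lint_le.
    split; last first.
      have [_ [D1 h1]] := d1; have [_ [D2 h2]] := d2; exists (D1 + D2) => y.
      by rewrite (le_trans (ler_normB _ _))// mulrDl lerD.
    by move=> y; apply: cvgB; [case: d1 => + _; apply|case: d2 => + _; apply].
  move=> y.
  have -> : p y * q y * (PA n y * c y + PB n y * s y) -
      p y * q y * (A y * c y + B y * s y) =
    p y * q y * ((PA n y - A y) * c y + (PB n y - B y) * s y) by ring.
  apply: le_trans (sys_bound _ _ y hp) _; rewrite mulrAC ler_wpM2r ?(ltW (wt_gt0 y))//.
  rewrite ler_wpM2l// distrC [X in _ + X]distrC (le_trans (lerD (hA y n) (hB y n)))//.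
  by rewrite le_eqVlt; apply/orP; left; apply/eqP; ring.
have pi0 : 0 <= (pi : R) by rewrite ltW// pi_gt0.
have fix_eq (X Y : R) : (forall n : nat, `|X - Y| <= (2 * C / 2 + K * (4 * C) * pi) / 2 ^+ n) -> X = Y.
  move=> h; apply/eqP; rewrite -subr_eq0 -normr_le0; apply/ler_addgt0Pl => e e0; rewrite addr0.
  have [|n hn] := small (2 * C / 2 + K * (4 * C) * pi) e _ e0.
    by rewrite addr_ge0 ?mulr_ge0 ?invr_ge0 ?mulr_ge0.
  exact: le_trans (h n) hn.
have eA x : A x = a + lint (fun x => s x * q x * (A x * c x + B x * s x)) x.
  apply: fix_eq => n; have h1 := hA x n.+1; have h2 := close s hs cs n x.
  set L := lint (fun x => _ * (A x * _ + _)) x in h2 *.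
  have -> : A x - (a + L) = (A x - PA n.+1 x) + (PA n.+1 x - a - L) by ring.
  rewrite (le_trans (ler_normD _ _))//.
  have -> : PA n.+1 x - a - L = lint (rA n) x - L by rewrite /PA /=; ring.
  rewrite (le_trans (lerD h1 h2))// le_eqVlt; apply/orP; left; apply/eqP.
  by rewrite exprS; field; rewrite expf_neq0.
have eB x : B x = b - lint (fun x => c x * q x * (A x * c x + B x * s x)) x.
  apply: fix_eq => n; have h1 := hB x n.+1; have h2 := close c hc cc n x.
  set L := lint (fun x => _ * (A x * _ + _)) x in h2 *.
  have -> : B x - (b - L) = (B x - PB n.+1 x) - (b - PB n.+1 x - L) by ring.
  rewrite (le_trans (ler_normB _ _))//.
  have -> : b - PB n.+1 x - L = lint (rB n) x - L by rewrite /PB /=; ring.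
  rewrite (le_trans (lerD h1 h2))// le_eqVlt; apply/orP; left; apply/eqP.
  by rewrite exprS; field; rewrite expf_neq0.
have [lA0 lA1 _] := lintP dsA; have [lB0 lB1 _] := lintP dsB.
have eA' : A = (fun x => a + lint (fun x => s x * q x * (A x * c x + B x * s x)) x).
  by apply/funext => x; exact: eA.
have eB' : B = (fun x => b - lint (fun x => c x * q x * (A x * c x + B x * s x)) x).
  by apply/funext => x; exact: eB.
exists A, B; split.
- split; first rewrite [X in Der X _]eA'; last rewrite [X in Der X _]eB'.
    by apply: Der_eq (DerD (Der_cst a) lA0) _ => x; rewrite add0r.
  by apply: Der_eq (DerB (Der_cst b) lB0) _ => x; rewrite sub0r.
- have := cvgD (@cvg_cst _ a _ -oo%R _) lA1; rewrite addr0 => h.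
  by rewrite [X in X x @[x --> _]]eA'; exact: h.
- have := cvgB (@cvg_cst _ b _ -oo%R _) lB1; rewrite subr0 => h.
  by rewrite [X in X x @[x --> _]]eB'; exact: h.
Qed.

End existence.
End linear_system.

(** * Global estimates for integrable systems *)

Section estimates.
Variable R : realType.
Implicit Types (f g q c s A B : R -> R) (K d : R).

Lemma expR_atan_le K (x : R) : 0 <= K -> expR (K * atan x) <= expR (K * pi).
Proof.
move=> K0; rewrite ler_expR ler_wpM2l//.
by have := @atan_ltpi2 R x; have := pi_gt0 R; lra.
Qed.

Lemma Der_expatan K : Der (fun x => expR (K * atan x))
  (fun x => expR (K * atan x) * (K * wt x)).
Proof.
apply: Der_eq (Der_expR (DerM (Der_cst K) (@Der_wt R))) _ => x.
by ring.
Qed.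

Lemma cvgNy_expatan K : expR (K * atan x) @[x --> -oo] --> expR (K * - (pi / 2)).
Proof.
apply: (@cvg_comp _ _ _ (fun x => K * atan x) expR _ (nbhs (K * - (pi / 2)))).
  by apply: cvgMr; exact: cvgNy_atan.
exact: continuous_expR.
Qed.

Lemma le_of_sqr (a b : R) : 0 <= b -> a ^+ 2 <= b ^+ 2 -> `|a| <= b.
Proof. by move=> b0; rewrite -[a ^+ 2]real_normK ?num_real// ler_sqr ?nnegrE. Qed.

(** Gronwall's inequality on the whole line: the energy A^2 + B^2 + d^2 grows at
    most like the exponential of a multiple of the arctangent. *)
Lemma gronwall A B dA dB K d : 0 <= K -> 0 <= d -> Der A dA -> Der B dB ->
  (forall x, `|dA x| + `|dB x| <= K * wt x * (`|A x| + `|B x| + d)) ->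
  A x @[x --> -oo] --> (0 : R) -> B x @[x --> -oo] --> (0 : R) ->
  forall x, `|A x| + `|B x| <= 2 * expR (6 * K * pi) * d.
Proof.
move=> K0 d0 hA hB h A0 B0 x.
pose E y := A y ^+ 2 + B y ^+ 2 + d ^+ 2.
pose G y := E y * expR (- (6 * K) * atan y).
have Gd : Der G (fun y => expR (- (6 * K) * atan y) *
    (2 * A y * dA y + 2 * B y * dB y - 6 * K * wt y * E y)).
  apply: Der_eq.
    apply: DerM (Der_expatan _); apply: DerD (Der_cst _).
    by apply: DerD; [exact: (DerX 2 hA)|exact: (DerX 2 hB)].
  by move=> y; rewrite /E /=; ring.
have E0 y : 0 <= E y by rewrite !addr_ge0 ?sqr_ge0.
have neg y : expR (- (6 * K) * atan y) *
    (2 * A y * dA y + 2 * B y * dB y - 6 * K * wt y * E y) <= 0.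
  rewrite pmulr_rle0 ?expR_gt0// subr_le0.
  have w0 := ltW (wt_gt0 y).
  have nA := real_normK (num_real (A y)); have nB := real_normK (num_real (B y)).
  rewrite /E -nA -nB.
  apply: le_trans (_ : 2 * (`|A y| + `|B y|) * (`|dA y| + `|dB y|) <= _).
    have := ler_norm (A y * dA y); have := ler_norm (B y * dB y); rewrite !normrM.
    have := mulr_ge0 (normr_ge0 (A y)) (normr_ge0 (dB y)).
    have := mulr_ge0 (normr_ge0 (B y)) (normr_ge0 (dA y)).
    by rewrite -!mulrA; lra.
  move: (normr_ge0 (A y)) (normr_ge0 (B y)) (h y).
  move: (`|A y|) (`|B y|) (`|dA y| + `|dB y|) => a b e a0 b0 he.
  apply: (@le_trans _ _ (2 * (a + b) * (K * wt y * (a + b + d)))).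
    by rewrite ler_wpM2l// mulr_ge0// addr_ge0.
  have -> : 2 * (a + b) * (K * wt y * (a + b + d)) =
    K * wt y * (2 * (a + b) * (a + b + d)) by ring.
  have -> : 6 * K * wt y * (a ^+ 2 + b ^+ 2 + d ^+ 2) =
    K * wt y * (6 * (a ^+ 2 + b ^+ 2 + d ^+ 2)) by ring.
  rewrite ler_wpM2l ?mulr_ge0//.
  by have := sqr_ge0 (a - b); have := sqr_ge0 (a + b - d); nra.
have cG : G y @[y --> -oo] --> d ^+ 2 * expR (6 * K * (pi / 2)).
  have -> : 6 * K * (pi / 2) = - (6 * K) * - (pi / 2) by ring.
  apply: cvgM; last exact: cvgNy_expatan.
  rewrite -[X in _ --> X]add0r -[X in _ --> X + _]addr0 -[X in _ --> X + _ + _](mulr0 0).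
  rewrite -[X in _ --> _ + X + _](mulr0 0) /E.
  by apply: cvgD; [apply: cvgD; exact: cvgM|exact: cvg_cst].
have GE : G x <= d ^+ 2 * expR (6 * K * (pi / 2)).
  apply: (ler_cvg_to (cvg_cst (G x)) cG).
  near=> y; have yx : y <= x by near: y; apply: nbhs_ninfty_le; exact: num_real.
  have := Der_le Gd (Der_cst 0) (fun z _ => neg z) yx.
  by rewrite subrr subr_le0.
have Ex : E x <= (expR (6 * K * pi) * d) ^+ 2.
  have -> : E x = G x * expR (6 * K * atan x).
    by rewrite /G -mulrA -expRD mulNr addNr expR0 mulr1.
  apply: le_trans (ler_wpM2r (expR_ge0 _) GE) _.
  rewrite -[leLHS]mulrA exprMn [leRHS]mulrC ler_wpM2l ?sqr_ge0// -expRD expr2 -expRD ler_expR.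
  have := @atan_ltpi2 R x; have := pi_gt0 R; nra.
have C0 : 0 <= expR (6 * K * pi) * d by rewrite mulr_ge0 ?expR_ge0.
have hx : `|A x| <= expR (6 * K * pi) * d.
  by apply: le_of_sqr => //; apply: le_trans Ex; rewrite /E -addrA lerDl addr_ge0 ?sqr_ge0.
have hy : `|B x| <= expR (6 * K * pi) * d.
  by apply: le_of_sqr => //; apply: le_trans Ex; rewrite /E addrAC lerDr addr_ge0 ?sqr_ge0.
by rewrite -mulrA mulr_natl mulr2n lerD.
Unshelve. all: by end_near. Qed.

Section sys.
Variables (q c s : R -> R) (K : R).
Hypotheses (cq : continuous q) (cc : continuous c) (cs : continuous s).
Hypothesis hK : forall x, `|q x| * (`|c x| + `|s x|) ^+ 2 <= K * wt x.

Let K0 : 0 <= K.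
Proof.
have := le_trans (mulr_ge0 (normr_ge0 (q 0)) (sqr_ge0 _)) (hK 0).
by rewrite pmulr_lge0// wt_gt0.
Qed.

Lemma sys_rhs a b x :
  `|s x * q x * (a * c x + b * s x)| + `|- (c x * q x * (a * c x + b * s x))| <=
  2 * K * wt x * (`|a| + `|b|).
Proof.
rewrite normrN; apply: le_trans (lerD (sys_bound hK a b x (hs c s)) (sys_bound hK a b x (hc c s))) _.
by rewrite le_eqVlt; apply/orP; left; apply/eqP; ring.
Qed.

(** Gronwall's inequality for A^2 + B^2 in both directions from the origin. *)
Lemma sys_bounded A B : sys q c s A B -> exists M, forall x, `|A x| + `|B x| <= M.
Proof.
move=> [hA hB]; pose E y := A y ^+ 2 + B y ^+ 2.
pose dE y := 2 * A y * (s y * q y * (A y * c y + B y * s y)) +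
             2 * B y * - (c y * q y * (A y * c y + B y * s y)).
have Ed : Der E dE.
  apply: Der_eq; first by apply: DerD; [exact: (DerX 2 hA)|exact: (DerX 2 hB)].
  by move=> y; rewrite /dE /=; ring.
have E0 y : 0 <= E y by rewrite addr_ge0 ?sqr_ge0.
have hE y : `|dE y| <= 8 * K * wt y * E y.
  have w0 := ltW (wt_gt0 y); have := sys_rhs (A y) (B y) y; rewrite /dE /E.
  have nA := real_normK (num_real (A y)); have nB := real_normK (num_real (B y)).
  rewrite -nA -nB.
  move: (s y * q y * _) (- (c y * q y * _)) => p r hpr.
  apply: le_trans (ler_normD _ _) _; rewrite !normrM (ger0_norm (ler0n R 2)).
  apply: (@le_trans _ _ (2 * (`|A y| + `|B y|) * (2 * K * wt y * (`|A y| + `|B y|)))).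
    apply: le_trans (_ : 2 * (`|A y| + `|B y|) * (`|p| + `|r|) <= _).
      have := mulr_ge0 (normr_ge0 (A y)) (normr_ge0 r).
      have := mulr_ge0 (normr_ge0 (B y)) (normr_ge0 p).
      by rewrite -!mulrA; lra.
    by rewrite ler_wpM2l// mulr_ge0// addr_ge0.
  have -> : 2 * (`|A y| + `|B y|) * (2 * K * wt y * (`|A y| + `|B y|)) =
    K * wt y * (4 * (`|A y| + `|B y|) ^+ 2) by ring.
  have -> : 8 * K * wt y * (`|A y| ^+ 2 + `|B y| ^+ 2) =
    K * wt y * (8 * (`|A y| ^+ 2 + `|B y| ^+ 2)) by ring.
  rewrite ler_wpM2l ?mulr_ge0//.
  by have := sqr_ge0 (`|A y| - `|B y|); nra.
pose M := E 0 * expR (8 * K * pi) + 1.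
have EM y : E y <= M.
  suff : E y <= E 0 * expR (8 * K * pi) by rewrite /M; lra.
  have [y0|y0] := leP 0 y.
    pose G z := E z * expR (- (8 * K) * atan z).
    have Gd : Der G (fun z => expR (- (8 * K) * atan z) * (dE z - 8 * K * wt z * E z)).
      by apply: Der_eq (DerM Ed (Der_expatan _)) _ => z; ring.
    have := Der_le Gd (Der_cst 0) _ y0; rewrite subrr subr_le0 => H.
    have -> : E y = G y * expR (8 * K * atan y).
      by rewrite /G -mulrA -expRD mulNr addNr expR0 mulr1.
    have G0 : G 0 = E 0 by rewrite /G atan0 mulr0 expR0 mulr1.
    rewrite ler_pM ?expR_ge0 ?mulr_ge0 ?expR_ge0//.
      rewrite -G0; apply: H => z _; rewrite pmulr_rle0 ?expR_gt0// subr_le0.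
      exact: le_trans (ler_norm _) (hE z).
    by apply: expR_atan_le; rewrite mulr_ge0.
  pose G z := E z * expR (8 * K * atan z).
  have Gd : Der G (fun z => expR (8 * K * atan z) * (dE z + 8 * K * wt z * E z)).
    by apply: Der_eq (DerM Ed (Der_expatan _)) _ => z; ring.
  have := Der_le (Der_cst 0) Gd _ (ltW y0); rewrite subrr subr_ge0 => H.
  have -> : E y = G y * expR (8 * K * atan (- y)).
    by rewrite /G -mulrA -expRD atanN mulrN addrN expR0 mulr1.
  have G0 : G 0 = E 0 by rewrite /G atan0 mulr0 expR0 mulr1.
  rewrite ler_pM ?expR_ge0 ?mulr_ge0 ?expR_ge0//.
    rewrite -G0; apply: H => z _; rewrite mulr_ge0 ?expR_ge0//.
    by have := hE z; rewrite ler_norml => /andP[+ _]; lra.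
  by apply: expR_atan_le; rewrite mulr_ge0.
have M1 : 1 <= M by rewrite /M lerDr mulr_ge0 ?expR_ge0.
exists (M + M) => x.
have MM : M <= M ^+ 2 by nra.
have M0 : 0 <= M by lra.
apply: lerD; apply: le_of_sqr => //; apply: le_trans MM; apply: le_trans (EM x).
  by rewrite lerDl sqr_ge0.
by rewrite lerDr sqr_ge0.
Qed.

Lemma sys_continuous A B : sys q c s A B -> continuous A /\ continuous B.
Proof. by move=> [hA hB]; split; [exact: Der_continuous hA|exact: Der_continuous hB]. Qed.

Lemma dom_opp f : dom f -> dom (fun x => - f x).
Proof.
move=> [cf [C hC]]; split; first by move=> x; apply: cvgN; exact: cf.
by exists C => x; rewrite normrN.
Qed.

Lemma sys_limits A B : sys q c s A B -> exists a b a' b' : R,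
  [/\ A x @[x --> -oo] --> a, B x @[x --> -oo] --> b,
      A x @[x --> +oo] --> a' & B x @[x --> +oo] --> b'].
Proof.
move=> sAB; have [cA cB] := sys_continuous sAB; have [M hM] := sys_bounded sAB.
have [hA hB] := sAB.
have [a [a1 a2]] := dom_limits hA (sys_dom cq cc cs hK cs cA cB (hs c s) hM).
have [b [b1 b2]] := dom_limits hB (dom_opp (sys_dom cq cc cs hK cc cA cB (hc c s) hM)).
by exists a, b; eexists; eexists; split; [exact: a1|exact: b1|exact: a2|exact: b2].
Qed.

Lemma sys_comb r A B A2 B2 : sys q c s A B -> sys q c s A2 B2 ->
  sys q c s (fun x => r * A x + A2 x) (fun x => r * B x + B2 x).
Proof.
move=> [hA hB] [hA2 hB2]; split.
  by apply: Der_eq (DerD (DerM (Der_cst r) hA) hA2) _ => x; ring.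
by apply: Der_eq (DerD (DerM (Der_cst r) hB) hB2) _ => x; ring.
Qed.

Lemma sys_zero A B : sys q c s A B ->
  A x @[x --> -oo] --> (0 : R) -> B x @[x --> -oo] --> (0 : R) ->
  forall x, A x = 0 /\ B x = 0.
Proof.
move=> [hA hB] A0 B0 x.
have h y : `|s y * q y * (A y * c y + B y * s y)| +
    `|- (c y * q y * (A y * c y + B y * s y))| <= 2 * K * wt y * (`|A y| + `|B y| + 0).
  by rewrite addr0; exact: sys_rhs.
have := gronwall (mulr_ge0 (ler0n R 2) K0) (lexx 0) hA hB h A0 B0 x.
rewrite mulr0 => H; have := normr_ge0 (A x); have := normr_ge0 (B x) => b0 a0.
by split; apply/eqP; rewrite -normr_le0; lra.
Qed.

Lemma sys_bound_limit A B a b : sys q c s A B ->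
  A x @[x --> -oo] --> a -> B x @[x --> -oo] --> b ->
  forall x, `|A x| + `|B x| <= (1 + 2 * expR (6 * (2 * K) * pi)) * (`|a| + `|b|).
Proof.
move=> [hA hB] Aa Bb x.
have hA' : Der (fun x => A x - a) (fun x => s x * q x * (A x * c x + B x * s x)).
  by apply: Der_eq (DerB hA (Der_cst a)) _ => y; rewrite subr0.
have hB' : Der (fun x => B x - b) (fun x => - (c x * q x * (A x * c x + B x * s x))).
  by apply: Der_eq (DerB hB (Der_cst b)) _ => y; rewrite subr0.
have A0 : A x - a @[x --> -oo] --> (0 : R).
  by rewrite -[X in _ --> X](subrr a); apply: cvgB => //; exact: cvg_cst.
have B0 : B x - b @[x --> -oo] --> (0 : R).
  by rewrite -[X in _ --> X](subrr b); apply: cvgB => //; exact: cvg_cst.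
have nn (z w : R) : `|z| <= `|z - w| + `|w|.
  by rewrite -{1}[z](subrK w) ler_normD.
have d0 : 0 <= `|a| + `|b| by rewrite addr_ge0.
have K2 : 0 <= 2 * K by rewrite mulr_ge0.
have := gronwall K2 d0 hA' hB' _ A0 B0 x => H.
rewrite mulrDl mul1r; apply: le_trans (lerD (nn _ a) (nn _ b)) _.
rewrite addrACA addrC lerD2l; apply: H => y; apply: le_trans (sys_rhs _ _ y) _.
rewrite ler_wpM2l ?mulr_ge0 ?(ltW (wt_gt0 y))//.
by apply: le_trans (lerD (nn _ a) (nn _ b)) _; rewrite addrACA.
Qed.

Lemma sys_wronskian A B A2 B2 : sys q c s A B -> sys q c s A2 B2 ->
  exists w, forall x, A x * B2 x - A2 x * B x = w.
Proof.
move=> [hA hB] [hA2 hB2]; exists (A 0 * B2 0 - A2 0 * B 0) => x.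
apply: (@Der0_cst _ (fun x => A x * B2 x - A2 x * B x)).
by apply: Der_eq (DerB (DerM hA hB2) (DerM hA2 hB)) _ => y; ring.
Qed.

(** The difference of the solutions satisfies the inequality of gronwall with
    d = e M, since the difference of the matrices enters multiplied by the bounded
    solution (A0, B0). *)
Lemma sys_perturb q0 c0 s0 (e M : R) A B A0 B0 (a b : R) : 0 <= e ->
  (forall x, `|s x * q x * s x - s0 x * q0 x * s0 x| <= e * wt x) ->
  (forall x, `|s x * q x * c x - s0 x * q0 x * c0 x| <= e * wt x) ->
  (forall x, `|c x * q x * c x - c0 x * q0 x * c0 x| <= e * wt x) ->
  (forall x, `|A0 x| + `|B0 x| <= M) ->
  sys q c s A B -> sys q0 c0 s0 A0 B0 ->
  A x @[x --> -oo] --> a -> A0 x @[x --> -oo] --> a ->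
  B x @[x --> -oo] --> b -> B0 x @[x --> -oo] --> b ->
  forall x, `|A x - A0 x| + `|B x - B0 x| <=
    2 * expR (6 * (2 * (K + 1)) * pi) * (e * M).
Proof.
move=> e0 hss hsc hcc hM [hA hB] [hA0 hB0] Aa A0a Bb B0b.
have M0 : 0 <= M by apply: le_trans (hM 0); rewrite addr_ge0.
apply: (gronwall _ _ (DerB hA hA0) (DerB hB hB0)).
- by rewrite mulr_ge0// addr_ge0.
- by rewrite mulr_ge0.
- move=> x; have w0 := ltW (wt_gt0 x).
  have -> : s x * q x * (A x * c x + B x * s x) - s0 x * q0 x * (A0 x * c0 x + B0 x * s0 x) =
      s x * q x * ((A x - A0 x) * c x + (B x - B0 x) * s x) +
      ((s x * q x * c x - s0 x * q0 x * c0 x) * A0 x +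
       (s x * q x * s x - s0 x * q0 x * s0 x) * B0 x) by ring.
  have -> : - (c x * q x * (A x * c x + B x * s x)) - - (c0 x * q0 x * (A0 x * c0 x + B0 x * s0 x)) =
      - (c x * q x * ((A x - A0 x) * c x + (B x - B0 x) * s x)) +
      - ((c x * q x * c x - c0 x * q0 x * c0 x) * A0 x +
       (s x * q x * c x - s0 x * q0 x * c0 x) * B0 x) by ring.
  have h := sys_rhs (A x - A0 x) (B x - B0 x) x.
  have small p r : `|p| <= e * wt x -> `|r| <= e * wt x ->
      `|p * A0 x + r * B0 x| <= e * wt x * M.
    move=> hp hr; apply: le_trans (ler_normD _ _) _; rewrite !normrM.
    apply: (@le_trans _ _ (e * wt x * (`|A0 x| + `|B0 x|))).
      by rewrite mulrDr lerD// ler_wpM2r.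
    by rewrite ler_wpM2l// mulr_ge0.
  have h1 := small _ _ (hsc x) (hss x); have h2 := small _ _ (hcc x) (hsc x).
  apply: le_trans (lerD (ler_normD _ _) (ler_normD _ _)) _.
  rewrite addrACA; apply: le_trans (lerD h (lerD h1 _)) _; first by rewrite normrN; exact: h2.
  set n := `|A x - _| + _; have n0 : 0 <= n by rewrite addr_ge0.
  have := mulr_ge0 (mulr_ge0 K0 w0) (mulr_ge0 e0 M0); have := mulr_ge0 w0 n0.
  move=> h3 h4; have -> : 2 * (K + 1) * wt x * (n + e * M) =
    (2 * K * wt x * n + (e * wt x * M + e * wt x * M)) +
    2 * (wt x * n) + 2 * (K * wt x * (e * M)) by ring.
  by lra.
- by rewrite -[X in _ --> X](subrr a); exact: cvgB.
- by rewrite -[X in _ --> X](subrr b); exact: cvgB.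
Qed.

End sys.

Lemma Der_reflect f df : Der f df -> Der (fun x => f (- x)) (fun x => - df (- x)).
Proof.
move=> fd; have nd : Der (fun x : R => - x) (fun=> -1) by der; ring.
by apply: Der_eq (Der_comp fd nd) _ => x; rewrite mulrN1.
Qed.

Lemma sys_reflect q c s A B : (forall x, c (- x) = c x) -> (forall x, s (- x) = - s x) ->
  sys q c s A B ->
  sys (fun x => q (- x)) c s (fun x => A (- x)) (fun x => - B (- x)).
Proof.
move=> ce so [hA hB]; split.
  by apply: Der_eq (Der_reflect hA) _ => x; rewrite ce so; ring.
by apply: Der_eq (DerN (Der_reflect hB)) _ => x; rewrite ce so; ring.
Qed.

End estimates.

(** * Solutions of the Schrodinger equation at real momentum *)

Section momentum.
Variable R : realType.
Implicit Types (f g q A B : R -> R) (k x : R).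

(** The free solutions with initial data (1, 0) and (0, 1) at the origin; both are
    smooth in the momentum, including at zero. *)
Definition fcos k x := cos (k * x).
Definition fsin k x := if k == 0 then x else sin (k * x) / k.

Lemma fsinE k x : k * fsin k x = sin (k * x).
Proof.
rewrite /fsin; case: eqVneq => [->|k0]; first by rewrite !mul0r sin0.
by rewrite mulrCA divff ?mulr1.
Qed.

Lemma Der_fcos k : Der (fcos k) (fun x => - (k ^+ 2 * fsin k x)).
Proof.
apply: Der_eq (Der_cos (DerM (Der_cst k) (@Der_id R))) _ => x.
by rewrite -fsinE; ring.
Qed.

Lemma Der_fsin k : Der (fsin k) (fcos k).
Proof.
rewrite /fsin; case: eqVneq => [->|k0].
  by apply: Der_eq (@Der_id R) _ => x; rewrite /fcos mul0r cos0.
apply: Der_eq (DerM (Der_sin (DerM (Der_cst k) (@Der_id R))) (Der_cst k^-1)) _ => x.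
by rewrite /fcos; field.
Qed.

Lemma fcosN k x : fcos k (- x) = fcos k x.
Proof. by rewrite /fcos mulrN cosN. Qed.

Lemma fsinN k x : fsin k (- x) = - fsin k x.
Proof. by rewrite /fsin; case: eqP => // _; rewrite mulrN sinN mulNr. Qed.

Lemma fcos2 k x : fcos k x ^+ 2 + k ^+ 2 * fsin k x ^+ 2 = 1.
Proof. by rewrite -exprMn fsinE cos2Dsin2. Qed.

Lemma fcos_le1 k x : `|fcos k x| <= 1.
Proof.
rewrite -[1]normr1; apply: le_of_sqr => //; rewrite normr1 expr1n -(fcos2 k x).
by rewrite lerDl mulr_ge0 ?sqr_ge0.
Qed.

Lemma Der_le_from0 f df C x : Der f df ->
  (forall y, `|y| <= `|x| -> `|df y| <= C) -> `|f x - f 0| <= C * `|x|.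
Proof.
move=> fd h; have cd : Der (fun x => C * x) (fun=> C) by der; ring.
have [x0|x0] := leP 0 x.
  have := Der_ler_norm fd cd _ x0; rewrite mulr0 subr0 (ger0_norm x0); apply.
  by move=> y /andP[y0 yx]; apply: h; rewrite !ger0_norm.
have := Der_ler_norm fd cd _ (ltW x0); rewrite mulr0 sub0r distrC -mulrN (ltr0_norm x0); apply.
by move=> y /andP[y0 yx]; apply: h; rewrite !ler0_norm ?lerN2 ?(ltW x0).
Qed.

Lemma fsin0 k : fsin k 0 = 0.
Proof. by rewrite /fsin; case: eqP => // _; rewrite mulr0 sin0 mul0r. Qed.

Lemma fcos0 k : fcos k 0 = 1.
Proof. by rewrite /fcos mulr0 cos0. Qed.

Lemma fsin_le k x : `|fsin k x| <= `|x|.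
Proof.
have := @Der_le_from0 _ _ 1 x (Der_fsin k) (fun y _ => fcos_le1 k y).
by rewrite fsin0 subr0 mul1r.
Qed.

Lemma fcosB1 k x : `|fcos k x - 1| <= k ^+ 2 * `|x| ^+ 2.
Proof.
have := @Der_le_from0 _ _ (k ^+ 2 * `|x|) x (Der_fcos k).
rewrite fcos0 => H; rewrite expr2 mulrA; apply: H => y yx; rewrite normrN normrM ger0_norm ?sqr_ge0//.
by rewrite ler_wpM2l ?sqr_ge0// (le_trans (fsin_le k y)).
Qed.

Lemma fsinBx k x : `|fsin k x - x| <= k ^+ 2 * `|x| ^+ 3.
Proof.
have := @Der_le_from0 _ _ (k ^+ 2 * `|x| ^+ 2) x (DerB (Der_fsin k) (@Der_id R)).
rewrite fsin0 !subr0 => H; rewrite [X in _ <= _ * X]exprSr mulrA; apply: H => y yx.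
by apply: le_trans (fcosB1 k y) _; rewrite ler_wpM2l ?sqr_ge0// lerXn2r ?nnegrE.
Qed.

(** Potentials with enough decay for the first-order system and for its
    comparison with the system at zero momentum. *)
Definition adm (K : R) q :=
  continuous q /\ forall x, `|q x| * (1 + `|x|) ^+ 4 <= K * wt x.

Lemma rd_adm q : continuous q -> rd q -> exists K, adm K q.
Proof.
move=> cq rq.
have [C0 h0] := rd_wt rq 0; have [C1 h1] := rd_wt rq 1; have [C2 h2] := rd_wt rq 2.
have [C3 h3] := rd_wt rq 3; have [C4 h4] := rd_wt rq 4.
exists (C0 + 4 * C1 + 6 * C2 + 4 * C3 + C4); split=> // x.
have -> : `|q x| * (1 + `|x|) ^+ 4 = `|x| ^+ 0 * `|q x| + 4 * (`|x| ^+ 1 * `|q x|)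
  + 6 * (`|x| ^+ 2 * `|q x|) + 4 * (`|x| ^+ 3 * `|q x|) + `|x| ^+ 4 * `|q x| by ring.
have := h0 x; have := h1 x; have := h2 x; have := h3 x; have := h4 x; lra.
Qed.

Lemma admD K1 K2 q1 q2 e : adm K1 q1 -> adm K2 q2 ->
  adm (K1 + `|e| * K2) (fun x => q1 x + e * q2 x).
Proof.
move=> [c1 h1] [c2 h2]; split.
  by move=> x; apply: cvgD; [exact: c1|apply: cvgMr; exact: c2].
move=> x; have p0 : 0 <= (1 + `|x|) ^+ 4 by rewrite exprn_ge0// addr_ge0.
apply: (@le_trans _ _ ((`|q1 x| + `|e| * `|q2 x|) * (1 + `|x|) ^+ 4)).
  by rewrite ler_wpM2r// (le_trans (ler_normD _ _))// normrM.
by rewrite !mulrDl lerD// -!mulrA ler_wpM2l.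
Qed.

Lemma adm_opp K q : adm K q -> adm K (fun x => q (- x)).
Proof.
move=> [cq h]; split; last by move=> x; have := h (- x); rewrite normrN wtN.
move=> x; apply: (@cvg_comp _ _ _ (fun y => - y) q _ (nbhs (- x))); last exact: cq.
by apply: cvgN; exact: cvg_id.
Qed.

Section fixed.
Variables (q : R -> R) (K k : R).
Hypothesis aq : adm K q.
Let cq : continuous q. Proof. by case: aq. Qed.
Let cc : continuous (fcos k). Proof. exact: Der_continuous (Der_fcos k). Qed.
Let cs : continuous (fsin k). Proof. exact: Der_continuous (Der_fsin k). Qed.

Lemma adm_le (j : nat) x : (j <= 4)%N -> `|q x| * (1 + `|x|) ^+ j <= K * wt x.
Proof.
move=> j4; apply: le_trans (proj2 aq x); rewrite ler_wpM2l//.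
by apply: ler_weXn2l => //; rewrite lerDl.
Qed.

Lemma adm_sys x : `|q x| * (`|fcos k x| + `|fsin k x|) ^+ 2 <= K * wt x.
Proof.
apply: le_trans (@adm_le 2 x isT); rewrite ler_wpM2l// lerXn2r ?nnegrE ?addr_ge0//.
by rewrite lerD ?fcos_le1 ?fsin_le.
Qed.

Definition ksys := sys q (fcos k) (fsin k).

Lemma ksys_exists (a b : R) : exists A B : R -> R,
  [/\ ksys A B, A x @[x --> -oo] --> a & B x @[x --> -oo] --> b].
Proof. exact: sys_exists cq cc cs adm_sys a b. Qed.

Lemma ksys_limits A B : ksys A B -> exists a b a' b' : R,
  [/\ A x @[x --> -oo] --> a, B x @[x --> -oo] --> b,
      A x @[x --> +oo] --> a' & B x @[x --> +oo] --> b'].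
Proof. exact: sys_limits cq cc cs adm_sys A B. Qed.

Definition rsol f := exists2 f', Der f f' & Der f' (fun x => - ((q x + k ^+ 2) * f x)).

Definition ksol A B x := A x * fcos k x + B x * fsin k x.

Lemma ksys_der A B : ksys A B ->
  Der (ksol A B) (fun x => B x * fcos k x - k ^+ 2 * fsin k x * A x) /\
  Der (fun x => B x * fcos k x - k ^+ 2 * fsin k x * A x)
      (fun x => - ((q x + k ^+ 2) * ksol A B x)).
Proof.
move=> [hA hB]; have hc := Der_fcos k; have hs := Der_fsin k; split.
  apply: Der_eq (DerD (DerM hA hc) (DerM hB hs)) _ => x.
  by ring.
apply: Der_eq (DerB (DerM hB hc) (DerM (DerM (Der_cst (k ^+ 2)) hs) hA)) _ => x.
by rewrite /ksol -[q x in RHS]mulr1 -(fcos2 k x); ring.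
Qed.

Lemma ksys_rsol A B : ksys A B -> rsol (ksol A B).
Proof. by move=> /ksys_der[h1 h2]; exists (fun x => B x * fcos k x - k ^+ 2 * fsin k x * A x). Qed.

(** Variation of constants: a solution in the coordinates given by the free
    solutions satisfies the first-order system. *)
Lemma rsol_ksys f f' : Der f f' -> Der f' (fun x => - ((q x + k ^+ 2) * f x)) ->
  let A := fun x => f x * fcos k x - f' x * fsin k x in
  let B := fun x => f' x * fcos k x + k ^+ 2 * fsin k x * f x in
  ksys A B /\ f = ksol A B.
Proof.
move=> fd f'd A B; have hc := Der_fcos k; have hs := Der_fsin k.
have e x : A x * fcos k x + B x * fsin k x = f x.
  by rewrite -[RHS]mulr1 -(fcos2 k x) /A /B; ring.
split; last by apply/funext => x; rewrite /ksol e.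
split.
  apply: Der_eq (DerB (DerM fd hc) (DerM f'd hs)) _ => x.
  by rewrite e; ring.
apply: Der_eq (DerD (DerM f'd hc) (DerM (DerM (Der_cst (k ^+ 2)) hs) fd)) _ => x.
by rewrite e; ring.
Qed.

(** At k = 0 the factor fsin k x = x grows, but it can be moved inside the tail
    integral of the derivative of B, where the potential absorbs it. *)
Lemma ksys_tail A B (b : R) : ksys A B -> B x @[x --> -oo] --> b ->
  (B x - b) * fsin k x @[x --> -oo] --> (0 : R).
Proof.
move=> sAB Bb; have [M hM] := sys_bounded adm_sys sAB.
have K0 : 0 <= K.
  have := le_trans (mulr_ge0 (normr_ge0 (q 0)) (sqr_ge0 _)) (adm_sys 0).
  by rewrite pmulr_lge0// wt_gt0.
have M0 : 0 <= M by apply: le_trans (hM 0); rewrite addr_ge0.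
have [hA hB] := sAB.
have H x : x <= 0 -> `|(B x - b) * fsin k x| <= K * M * (atan x + pi / 2).
  move=> x0; rewrite normrM.
  apply: (@le_trans _ _ (`|x * B x - x * b|)).
    by rewrite -mulrBr normrM mulrC ler_wpM2r ?fsin_le.
  apply: (@dom_boundNy _ (fun y => x * B y) _ (x * b)
     (K * M) x (DerM (Der_cst x) hB)) => [y yx|]; last exact: cvgMr.
  rewrite mul0r add0r normrM normrN.
  have xy : `|x| <= 1 + `|y|.
    by rewrite !ler0_norm ?(le_trans yx)//; lra.
  have y1 : 0 <= 1 + `|y| by rewrite addr_ge0.
  rewrite !normrM; apply: (@le_trans _ _ ((1 + `|y|) * (1 * `|q y| * (M * (1 + `|y|))))).
    rewrite ler_pM ?mulr_ge0// ler_pM ?mulr_ge0// ?ler_wpM2r ?fcos_le1//.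
    apply: le_trans (ler_normD _ _) _; rewrite !normrM.
    apply: (@le_trans _ _ (`|A y| * (1 + `|y|) + `|B y| * (1 + `|y|))).
      rewrite lerD// ler_wpM2l//; last by rewrite (le_trans (fsin_le _ _))// lerDr.
      by rewrite (le_trans (fcos_le1 _ _))// lerDl.
    by rewrite -mulrDl ler_wpM2r.
  have := @adm_le 2 y isT => h.
  have -> : (1 + `|y|) * (1 * `|q y| * (M * (1 + `|y|))) =
    `|q y| * (1 + `|y|) ^+ 2 * M by ring.
  by rewrite [leRHS]mulrAC ler_wpM2r.
have : K * M * (atan x + pi / 2) @[x --> -oo] --> K * M * (- (pi / 2) + pi / 2).
  by apply: cvgMr; apply: cvgD; [exact: cvgNy_atan|exact: cvg_cst].
rewrite addNr mulr0 => H0; apply/cvgr0Pnorm_le => e e0.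
have /cvgr0Pnorm_le/(_ _ e0) H1 := H0.
near=> x; apply: le_trans (H x _) _.
  by near: x; apply: nbhs_ninfty_le; exact: num_real.
apply: le_trans (ler_norm _) _; near: x; exact: H1.
Unshelve. all: by end_near. Qed.

Lemma ksol_asymp A B (a b : R) : ksys A B ->
  A x @[x --> -oo] --> a -> B x @[x --> -oo] --> b ->
  ksol A B x - (a * fcos k x + b * fsin k x) @[x --> -oo] --> (0 : R).
Proof.
move=> sAB Aa Bb; have H := ksys_tail sAB Bb.
have : (A x - a) * fcos k x @[x --> -oo] --> (0 : R).
  have A0 : A x - a @[x --> -oo] --> (0 : R).
    by rewrite -[X in _ --> X](subrr a); apply: cvgB => //; exact: cvg_cst.
  apply/cvgr0Pnorm_le => e e0; have /cvgr0Pnorm_le/(_ _ e0) := A0.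
  apply: filterS => x; apply: le_trans; rewrite normrM ler_piMr ?fcos_le1//.
move=> /cvgD/(_ H); rewrite addr0; apply: cvg_trans; apply: near_eq_cvg.
by near=> x; rewrite /ksol !fctE; ring.
Unshelve. all: by end_near. Qed.

(** A free solution that tends to zero vanishes: the sum of its squares at two
    points a quarter period apart does not depend on the position. *)
Lemma free_zero (a b : R) : a * fcos k x + b * fsin k x @[x --> -oo] --> (0 : R) ->
  a = 0 /\ b = 0.
Proof.
set g := fun x => _; move=> g0.
have shift h : g (x - h) @[x --> -oo] --> (0 : R).
  apply/cvgr0Pnorm_le => e e0; have /cvgr0Pnorm_le/(_ _ e0)[M [Mr hM]] := g0.
  exists (M + h); split; first exact: num_real.
  by move=> x xM; apply: hM; rewrite ltrBlDr.
have [k0|k0] := eqVneq k 0.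
  have : g x - g (x - 1) @[x --> -oo] --> (0 - 0 : R) by exact: cvgB.
  rewrite subr0 => h1; have b0 : b = 0.
    apply: cvg_unique h1 => //; rewrite (_ : (fun x => _) = cst b); first exact: cvg_cst.
    by apply/funext => x; rewrite /g /fcos /fsin k0 eqxx !mul0r /=; ring.
  split=> //; apply: cvg_unique g0 => //.
  rewrite (_ : g = cst a); first exact: cvg_cst.
  by apply/funext => x; rewrite /g b0 /fcos k0 mul0r cos0 mul0r addr0 mulr1.
pose h := pi / 2 / k.
have : g x ^+ 2 + g (x - h) ^+ 2 @[x --> -oo] --> (0 ^+ 2 + 0 ^+ 2 : R).
  by apply: cvgD; rewrite !expr2; apply: cvgM.
rewrite expr0n addr0 => H.
have e : a ^+ 2 + (b / k) ^+ 2 = 0.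
  apply: cvg_unique H => //; rewrite (_ : (fun x => _) = cst (a ^+ 2 + (b / k) ^+ 2)).
    exact: cvg_cst.
  apply/funext => x; have kh : k * (x - h) = k * x - pi / 2 by rewrite /h; field.
  rewrite /g /fcos /fsin (negbTE k0) kh.
  rewrite cosB sinB cos_pihalf sin_pihalf !mulr0 !mulr1 add0r sub0r.
  by rewrite /= -[RHS]mulr1 -[1 in RHS](cos2Dsin2 (k * x)); field.
have a0 : a = 0 by apply/eqP; rewrite -sqrf_eq0 eq_le sqr_ge0 andbT -e lerDl sqr_ge0.
split=> //; apply/eqP; move: e; rewrite a0 expr0n add0r => /eqP.
by rewrite sqrf_eq0 mulf_eq0 invr_eq0 (negbTE k0) orbF.
Qed.

(** Such a solution is asymptotic to a free one, which vanishes by free_zero; hence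
    both coordinates tend to 0 at -oo and the system has only the zero solution. *)
Lemma rsol_zero f : rsol f -> f x @[x --> -oo] --> (0 : R) -> forall x, f x = 0.
Proof.
move=> [f' fd f'd] f0 x; have [sAB fE] := rsol_ksys fd f'd.
move: sAB fE; set A := fun x => _; set B := fun x => _ => sAB fE.
have [a [b [_ [_ [Aa Bb _ _]]]]] := ksys_limits sAB.
have := ksol_asymp sAB Aa Bb; rewrite -fE => h.
have : a * fcos k x + b * fsin k x @[x --> -oo] --> (0 - 0 : R).
  apply: cvg_trans (cvgB f0 h); apply: near_eq_cvg; near=> y; rewrite !fctE; ring.
rewrite subr0 => /free_zero[a0 b0].
have Aa0 : A x @[x --> -oo] --> (0 : R) by rewrite -[X in _ --> X]a0.
have Bb0 : B x @[x --> -oo] --> (0 : R) by rewrite -[X in _ --> X]b0.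
have [Ax Bx] := sys_zero adm_sys sAB Aa0 Bb0 x.
by rewrite fE /ksol Ax Bx !mul0r addr0.
Unshelve. all: by end_near. Qed.

End fixed.
End momentum.

(** * Jost solutions *)

Section jost.
Variable R : realType.
Local Notation C := (Rcomplex R).
Local Notation Re := (@complex.Re R).
Local Notation Im := (@complex.Im R).
Implicit Types (f g q A B : R -> R) (k x : R) (F G : R -> C) (z w : C).

Lemma cvg_eqfun {T : Type} {H : set_system T} {f g : T -> R} {l : R} :
  (forall t, f t = g t) -> f t @[t --> H] --> l -> g t @[t --> H] --> l.
Proof. by move=> fg; rewrite (_ : g = f)//; apply/funext => t; rewrite fg. Qed.

Lemma norm_Rcomplex z : `|z| = Num.sqrt (Re z ^+ 2 + Im z ^+ 2).
Proof. by case: z. Qed.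

Lemma norm_Re z : `|Re z| <= `|z|.
Proof.
by rewrite norm_Rcomplex -sqrtr_sqr ler_wsqrtr// lerDl sqr_ge0.
Qed.

Lemma norm_Im z : `|Im z| <= `|z|.
Proof.
by rewrite norm_Rcomplex -sqrtr_sqr ler_wsqrtr// lerDr sqr_ge0.
Qed.

Lemma norm_ReIm z : `|z| <= `|Re z| + `|Im z|.
Proof.
rewrite norm_Rcomplex -[leRHS]ger0_norm ?addr_ge0// -sqrtr_sqr ler_wsqrtr//.
rewrite -(real_normK (num_real (Re z))) -(real_normK (num_real (Im z))).
by rewrite sqrrD addrAC lerDl mulrn_wge0// mulr_ge0.
Qed.

Lemma norm_RcomplexM z w : `|(z * w : C)| = `|z| * `|w|.
Proof. exact: Normc.normcM. Qed.

Lemma norm_RcomplexV z : `|(z^-1 : C)| = `|z|^-1.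
Proof. exact: Normc.normcV. Qed.

Lemma Re_add z w : Re (z + w) = Re z + Re w. Proof. by case: z; case: w. Qed.
Lemma Im_add z w : Im (z + w) = Im z + Im w. Proof. by case: z; case: w. Qed.
Lemma Re_opp z : Re (- z) = - Re z. Proof. by case: z. Qed.
Lemma Im_opp z : Im (- z) = - Im z. Proof. by case: z. Qed.
Lemma Re_scale (a : R) z : Re (a *: z) = a * Re z. Proof. by case: z. Qed.
Lemma Im_scale (a : R) z : Im (a *: z) = a * Im z. Proof. by case: z. Qed.
Lemma Re_mul z w : Re (z * w) = Re z * Re w - Im z * Im w.
Proof. by case: z; case: w. Qed.
Lemma Im_mul z w : Im (z * w) = Re z * Im w + Im z * Re w.
Proof. by case: z; case: w. Qed.

Definition ReImE := (Re_add, Im_add, Re_opp, Im_opp, Re_scale, Im_scale, Re_mul, Im_mul).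

Lemma eq_ReIm z w : Re z = Re w -> Im z = Im w -> z = w.
Proof. by case: z => a b; case: w => c d /= -> ->. Qed.

Lemma cvg_Rcomplex {T : Type} (H : set_system T) (F : T -> C) (l : C) :
  Filter H ->
  F x @[x --> H] --> l <->
  (Re (F x) @[x --> H] --> Re l /\ Im (F x) @[x --> H] --> Im l).
Proof.
move=> FH; split.
  move=> /cvgrPdist_le h; split; apply/cvgrPdist_le => e e0;
    apply: filterS (h _ e0) => x; apply: le_trans.
  - by rewrite -Re_opp -Re_add; exact: norm_Re.
  - by rewrite -Im_opp -Im_add; exact: norm_Im.
move=> [/cvgrPdist_le h1 /cvgrPdist_le h2]; apply/cvgrPdist_le => e e0.
have e2 : 0 < e / 2 by rewrite divr_gt0.
near=> x; rewrite (le_trans (norm_ReIm _))// [e]splitr !ReImE lerD//.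
  by near: x; exact: h1.
by near: x; exact: h2.
Unshelve. all: by end_near. Qed.

Lemma is_derive_Rcomplex (F : R -> C) x (l : C) : is_derive x (1 : R) F l <->
  (is_derive x (1 : R) (fun y => Re (F y)) (Re l) /\
   is_derive x (1 : R) (fun y => Im (F y)) (Im l)).
Proof.
have eR : (fun h : R => Re (h^-1 *: ((F \o shift x) (h *: 1) - F x))) =
    (fun h : R => h^-1 *: (((fun y => Re (F y)) \o shift x) (h *: 1) - Re (F x))).
  by apply/funext => h; rewrite !ReImE.
have eI : (fun h : R => Im (h^-1 *: ((F \o shift x) (h *: 1) - F x))) =
    (fun h : R => h^-1 *: (((fun y => Im (F y)) \o shift x) (h *: 1) - Im (F x))).
  by apply/funext => h; rewrite !ReImE.
split.
  move=> [d e]; have := d; rewrite /derivable -/(derive F x 1) => /(cvg_ex _) d'.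
  have H : h^-1 *: ((F \o shift x) (h *: 1) - F x) @[h --> 0^'] --> l.
    by rewrite -e; exact: d.
  move: H => /cvg_Rcomplex[]; rewrite eR eI => h1 h2; split.
    by apply: DeriveDef; [exact: cvgP h1|exact: cvg_lim h1].
  by apply: DeriveDef; [exact: cvgP h2|exact: cvg_lim h2].
move=> [[d1 e1] [d2 e2]].
have H : h^-1 *: ((F \o shift x) (h *: 1) - F x) @[h --> 0^'] --> l.
  by apply/cvg_Rcomplex; rewrite eR eI -e1 -e2; split; [exact: d1|exact: d2].
by apply: DeriveDef; [exact: cvgP H|exact: cvg_lim H].
Qed.

Lemma schrodinger_solutionP q k F : schrodinger_solution q k F <->
  (rsol q k (fun x => Re (F x)) /\ rsol q k (fun x => Im (F x))).
Proof.
split.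
  move=> H; have d1 x : is_derive x (1 : R) F (F^`() x).
    by rewrite derive1E; apply/derivableP; case: (H x).
  have d2 x : is_derive x (1 : R) F^`() (F^`(2) x).
    by rewrite /derive1n /= derive1E; apply/derivableP; case: (H x).
  have e x : F^`(2) x = - ((q x + k ^+ 2) *: F x).
    have [_ _ h] := H x; rewrite scalerDl opprD -h opprD opprK addrA.
    by rewrite [- _ + F^`(2) x]addrC addrK.
  split.
    exists (fun x => Re (F^`() x)) => x; first by have /is_derive_Rcomplex[] := d1 x.
    have /is_derive_Rcomplex[+ _] := d2 x; rewrite e.
    by rewrite Re_opp Re_scale.
  exists (fun x => Im (F^`() x)) => x; first by have /is_derive_Rcomplex[] := d1 x.
  have /is_derive_Rcomplex[_] := d2 x; rewrite e.
  by rewrite Im_opp Im_scale.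
move=> [[f fd fdd] [g gd gdd]].
have d1 x : is_derive x (1 : R) F (Complex (f x) (g x) : C).
  by apply/is_derive_Rcomplex; split; [exact: fd|exact: gd].
have e1 : F^`() = (fun x => Complex (f x) (g x) : C).
  by apply/funext => x; rewrite derive1E; have [] := d1 x.
have d2 x : is_derive x (1 : R) F^`() (- ((q x + k ^+ 2) *: F x)).
  rewrite e1; apply/is_derive_Rcomplex; rewrite !ReImE; split; [exact: fdd|exact: gdd].
move=> x; split; [by have [] := d1 x|by have [] := d2 x|].
have -> : F^`(2) x = - ((q x + k ^+ 2) *: F x).
  by rewrite /derive1n /= derive1E; have [] := d2 x.
by rewrite opprK scalerDl addrC addKr.
Qed.

Lemma norm_expi (t : R) : `|expi t| = 1.
Proof. by rewrite norm_Rcomplex /= cos2Dsin2 sqrtr1. Qed.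

Lemma cvg_expi (H : set_system R) (F : R -> C) (t : R -> R) : Filter H ->
  F x / expi (t x) @[x --> H] --> (1 : C) <->
  (Re (F x) - cos (t x) @[x --> H] --> (0 : R) /\
   Im (F x) - sin (t x) @[x --> H] --> (0 : R)).
Proof.
move=> FH.
have e x : `|(1 - F x / expi (t x) : C)| = `|F x - expi (t x)|.
  have u : expi (t x) != 0 by rewrite -normr_gt0 norm_expi.
  rewrite -{1}(divff u) -mulrBl norm_RcomplexM norm_RcomplexV norm_expi invr1 mulr1.
  by rewrite distrC.
have -> : F x / expi (t x) @[x --> H] --> (1 : C) <->
    F x - expi (t x) @[x --> H] --> (0 : C).
  split=> [/cvgrPdist_le h|/cvgrPdist_le h]; apply/cvgrPdist_le => d d0;
    apply: filterS (h _ d0) => x; by rewrite e sub0r normrN.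
rewrite cvg_Rcomplex; split=> -[h1 h2]; split.
- by move: h1; under eq_cvg do rewrite !ReImE /=.
- by move: h2; under eq_cvg do rewrite !ReImE /=.
- by under eq_cvg do rewrite !ReImE /=.
- by under eq_cvg do rewrite !ReImE /=.
Qed.

Section minus.
Variables (q : R -> R) (K k : R).
Hypothesis aq : adm K q.

Lemma rsolB f g : rsol q k f -> rsol q k g -> rsol q k (fun x => f x - g x).
Proof.
move=> [f' fd fdd] [g' gd gdd]; exists (fun x => f' x - g' x); first exact: DerB.
by apply: Der_eq (DerB fdd gdd) _ => x; ring.
Qed.

(** Two Jost solutions differ by a solution that tends to 0 at -oo. *)
Lemma jost_minus_uniq F G : is_jost_minus q k F -> is_jost_minus q k G -> F = G.
Proof.
move=> [/schrodinger_solutionP[G1 G2] /cvg_expi[Gl1 Gl2]].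
move=> [/schrodinger_solutionP[J1 J2] /cvg_expi[Jl1 Jl2]].
apply/funext => x; apply: eq_ReIm; apply/eqP; rewrite -subr_eq0; apply/eqP.
  apply: (rsol_zero aq (rsolB G1 J1)).
  have H : (Re (F y) - cos (- (k * y))) - (Re (G y) - cos (- (k * y))) @[y --> -oo] --> (0 - 0 : R).
    exact: cvgB.
  by rewrite subr0 in H; apply: (cvg_eqfun _ H) => y; ring.
apply: (rsol_zero aq (rsolB G2 J2)).
have H : (Im (F y) - sin (- (k * y))) - (Im (G y) - sin (- (k * y))) @[y --> -oo] --> (0 - 0 : R).
    exact: cvgB.
  by rewrite subr0 in H; apply: (cvg_eqfun _ H) => y; ring.
Qed.

(** The Jost solution from the left, from the two real solutions with data (1, 0)
    and (0, 1) at -oo. *)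
Lemma is_jost_minus_ksol A1 B1 A2 B2 : ksys q k A1 B1 -> ksys q k A2 B2 ->
  A1 x @[x --> -oo] --> (1 : R) -> B1 x @[x --> -oo] --> (0 : R) ->
  A2 x @[x --> -oo] --> (0 : R) -> B2 x @[x --> -oo] --> (1 : R) ->
  is_jost_minus q k
  (fun x => Complex (ksol k A1 B1 x) (- (k * ksol k A2 B2 x)) : C).
Proof.
move=> s1 s2 A1l B1l A2l B2l.
have h1 := ksol_asymp aq s1 A1l B1l; have h2 := ksol_asymp aq s2 A2l B2l.
split.
  apply/schrodinger_solutionP; split; first exact: (ksys_rsol s1).
  have [g' gd gdd] := ksys_rsol s2; exists (fun x => - (k * g' x)).
    by apply: Der_eq (DerN (DerM (Der_cst k) gd)) _ => x; ring.
  by apply: Der_eq (DerN (DerM (Der_cst k) gdd)) _ => x /=; ring.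
apply/cvg_expi; split.
  by apply: cvg_eqfun h1 => x; rewrite /= cosN /fcos; ring.
have : - k * (ksol k A2 B2 x - (0 * fcos k x + 1 * fsin k x)) @[x --> -oo] --> - k * 0.
  exact: cvgMr.
rewrite mulr0; apply: cvg_eqfun => x.
by rewrite /= sinN -fsinE; ring.
Qed.

Lemma jost_minus_spec : is_jost_minus q k (jost_minus q k).
Proof.
have [A1 [B1 [s1 A1l B1l]]] := ksys_exists k aq 1 0.
have [A2 [B2 [s2 A2l B2l]]] := ksys_exists k aq 0 1.
have J := is_jost_minus_ksol s1 s2 A1l B1l A2l B2l.
by rewrite /jost_minus; case: xgetP => [F -> //|/(_ _ J)].
Qed.

Lemma jost_minusE A1 B1 A2 B2 : ksys q k A1 B1 -> ksys q k A2 B2 ->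
  A1 x @[x --> -oo] --> (1 : R) -> B1 x @[x --> -oo] --> (0 : R) ->
  A2 x @[x --> -oo] --> (0 : R) -> B2 x @[x --> -oo] --> (1 : R) ->
  jost_minus q k =
  (fun x => Complex (ksol k A1 B1 x) (- (k * ksol k A2 B2 x)) : C).
Proof.
move=> s1 s2 A1l B1l A2l B2l; apply: jost_minus_uniq; first exact: jost_minus_spec.
exact: is_jost_minus_ksol.
Qed.

End minus.

Lemma cvgNy_opp (f : R -> R) (l : R) :
  f x @[x --> -oo] --> l -> f (- x) @[x --> +oo] --> l.
Proof. by move=> /cvgNy_compNP. Qed.

Lemma cvgy_opp (f : R -> R) (l : R) :
  f x @[x --> +oo] --> l -> f (- x) @[x --> -oo] --> l.
Proof. by move=> /cvgy_compNP. Qed.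

Lemma rsol_reflect q k f : rsol q k f -> rsol (fun x => q (- x)) k (fun x => f (- x)).
Proof.
move=> [f' fd fdd]; exists (fun x => - f' (- x)); first exact: Der_reflect.
by apply: Der_eq (DerN (Der_reflect fdd)) _ => x; ring.
Qed.

Lemma jost_reflect q k F : is_jost_plus q k F ->
  is_jost_minus (fun x => q (- x)) k (fun x => F (- x)).
Proof.
move=> [/schrodinger_solutionP[s1 s2] /cvg_expi[l1 l2]]; split.
  by apply/schrodinger_solutionP; split; [exact: (rsol_reflect s1)|exact: (rsol_reflect s2)].
apply/cvg_expi; split.
  have := cvgy_opp l1; apply: cvg_eqfun => x.
  by rewrite mulrN.
have := cvgy_opp l2; apply: cvg_eqfun => x.
by rewrite mulrN.
Qed.

Lemma jost_reflectV q k F : is_jost_minus (fun x => q (- x)) k F ->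
  is_jost_plus q k (fun x => F (- x)).
Proof.
move=> [/schrodinger_solutionP[s1 s2] /cvg_expi[l1 l2]]; split.
  have qE : q = (fun x => (fun y => q (- y)) (- x)).
    by apply/funext => x; rewrite opprK.
  by rewrite qE; apply/schrodinger_solutionP; split; [exact: (rsol_reflect s1)|exact: (rsol_reflect s2)].
apply/cvg_expi; split.
  have := cvgNy_opp l1; apply: cvg_eqfun => x.
  by rewrite mulrN opprK.
have := cvgNy_opp l2; apply: cvg_eqfun => x.
by rewrite mulrN opprK.
Qed.

Section plus.
Variables (q : R -> R) (K k : R).
Hypothesis aq : adm K q.

Lemma ksys_existsy (a b : R) : exists A B : R -> R,
  [/\ ksys q k A B, A x @[x --> +oo] --> a & B x @[x --> +oo] --> b].
Proof.
have [A [B [s Al Bl]]] := ksys_exists k (adm_opp aq) a (- b).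
have := sys_reflect (fcosN k) (fsinN k) s => s'.
exists (fun x => A (- x)), (fun x => - B (- x)); split.
- rewrite /ksys (_ : q = (fun x => q (- - x)))//.
  by apply/funext => x; rewrite opprK.
- exact: cvgNy_opp.
- by rewrite -[b]opprK; apply: cvgN; exact: cvgNy_opp.
Qed.

Lemma jost_plus_reflect : jost_plus q k =
  (fun x => jost_minus (fun x => q (- x)) k (- x)).
Proof.
have aq' := adm_opp aq.
apply: xget_unique => [|F jF]; first exact: jost_reflectV (jost_minus_spec k aq').
apply/funext => x; rewrite -{1}[x]opprK.
have := jost_minus_uniq aq' (jost_reflect jF) (jost_minus_spec k aq').
by move=> /(congr1 (@^~ (- x))).
Qed.

Lemma jost_plusE A1 B1 A2 B2 : ksys q k A1 B1 -> ksys q k A2 B2 ->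
  A1 x @[x --> +oo] --> (1 : R) -> B1 x @[x --> +oo] --> (0 : R) ->
  A2 x @[x --> +oo] --> (0 : R) -> B2 x @[x --> +oo] --> (1 : R) ->
  jost_plus q k =
  (fun x => Complex (ksol k A1 B1 x) (k * ksol k A2 B2 x) : C).
Proof.
move=> s1 s2 A1l B1l A2l B2l.
have r1 := sys_reflect (fcosN k) (fsinN k) s1.
have r2 := sys_reflect (fcosN k) (fsinN k) s2.
(* the reflected second solution has data (0, -1); -2 r2 + r2 changes its sign *)
have E := jost_minusE (adm_opp aq) r1 (sys_comb (-2) r2 r2).
rewrite jost_plus_reflect E.
- apply/funext => x; congr (Complex _ _).
    by rewrite /ksol !opprK fcosN fsinN mulrNN.
  by rewrite /ksol !opprK fcosN fsinN; ring.
- exact: cvgy_opp.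
- by rewrite -oppr0; apply: cvgN; exact: cvgy_opp.
- have h := cvgy_opp A2l.
  have h2 : -2 * A2 (- x) @[x --> -oo] --> (-2 * 0 : R) by exact: cvgMr.
  by rewrite -[X in _ --> X]addr0 -[X in _ --> X + _](mulr0 (-2)); exact: cvgD.
- have h : - B2 (- x) @[x --> -oo] --> (- 1 : R) by apply: cvgN; exact: cvgy_opp.
  have h2 : -2 * - B2 (- x) @[x --> -oo] --> (-2 * - 1 : R) by exact: cvgMr.
  have e : -2 * -1 + -1 = 1 :> R by ring.
  by rewrite -[X in _ --> X]e; exact: cvgD.
Qed.

End plus.
End jost.

(** * First variation of the Wronskian at zero energy *)

Section ground_state.
Variable R : realType.
Local Notation C := (Rcomplex R).
Local Notation mu := (@lebesgue_measure R).
Implicit Types (f q A B : R -> R) (x : R).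

Variables (w g : R -> R).
Hypotheses (wg : Der w g) (cg : cls (@rd R) g).

(** The potential whose zero-energy equation is solved by exp(-w/2), in terms of
    the derivative g of w. *)
Definition pot x := 2^-1 * g^`() x - 4^-1 * g x ^+ 2.

Lemma pot_rd : cls (@rd R) pot.
Proof.
rewrite (_ : pot = fun x => 2^-1 * g^`() x + - 4^-1 * (g x * g x)).
  apply: cls_rdD; first by apply: cls_rdZ; exact: cls_derivative.
  by apply: cls_rdZ; exact: cls_rd_bndM.
by apply/funext => x; rewrite /pot expr2; ring.
Qed.

Lemma bnd_w : bnd w.
Proof.
have [a [wa _]] := dom_limits wg (cls_rd_dom cg).
have [_ [D hD]] := cls_rd_dom cg; exists (D * pi + `|a|) => x.
have D0 : 0 <= D.
  by have := le_trans (normr_ge0 _) (hD 0); rewrite pmulr_lge0// wt_gt0.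
have := dom_boundNy (x := x) wg (fun y _ => hD y) wa => h.
rewrite -[w x](subrK a) (le_trans (ler_normD _ _))// lerD2r (le_trans h)//.
by rewrite ler_wpM2l// atan_le_pi.
Qed.

Definition dpsi x := - (2^-1 * g x * psi w x).

Lemma Der_psi : Der (psi w) dpsi.
Proof.
rewrite /psi; apply: Der_eq (Der_expR (DerN (DerM wg (Der_cst 2^-1)))) _ => x.
by rewrite /dpsi /psi; ring.
Qed.

Lemma Der_dpsi : Der dpsi (fun x => - ((pot x + 0 ^+ 2) * psi w x)).
Proof.
apply: Der_eq (DerN (DerM (DerM (Der_cst 2^-1) (cls_derive1 cg)) Der_psi)) _ => x.
by rewrite /dpsi /pot; field.
Qed.

Lemma bnd_psi : bnd (psi w).
Proof.
have [D hD] := bnd_w; exists (expR (D / 2)) => x.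
rewrite ger0_norm ?expR_ge0// ler_expR -mulNr ler_wpM2r//.
by rewrite (le_trans _ (hD x))// -normrN ler_norm.
Qed.

Lemma dpsi_rd : rd dpsi.
Proof.
rewrite (_ : dpsi = fun x => (- 2^-1 * psi w x) * g x).
  apply: bnd_rdM (cls_in cg); apply: bndM bnd_psi.
  by exists `|- 2^-1| => _.
by apply/funext => x; rewrite /dpsi; ring.
Qed.

Definition gsA x := psi w x * fcos 0 x - dpsi x * fsin 0 x.
Definition gsB x := dpsi x * fcos 0 x + 0 ^+ 2 * fsin 0 x * psi w x.

Lemma gs_ksys : ksys pot 0 gsA gsB /\ psi w = ksol 0 gsA gsB.
Proof. exact: rsol_ksys Der_psi Der_dpsi. Qed.

Lemma gsAE x : gsA x = psi w x - x * dpsi x.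
Proof. by rewrite /gsA /fcos /fsin eqxx mul0r cos0 mulr1 [dpsi x * _]mulrC. Qed.

Lemma gsBE x : gsB x = dpsi x.
Proof. by rewrite /gsB /fcos mul0r cos0 mulr1 expr0n /= !mul0r addr0. Qed.

Lemma rd_xM f : rd f -> rd (fun x => x * f x).
Proof.
apply: lingrow_rdM; exists 1 => x; rewrite mul1r lerDr//.
Qed.

Lemma gs_cvgNy (a : R) : w x @[x --> -oo] --> a ->
  gsA x @[x --> -oo] --> expR (- (a / 2)) /\ gsB x @[x --> -oo] --> (0 : R).
Proof.
move=> wa; split; last first.
  by apply: cvg_eqfun (rd_cvgNy dpsi_rd) => x; rewrite gsBE.
have h1 : psi w x @[x --> -oo] --> expR (- (a / 2)).
  apply: (@cvg_comp _ _ _ (fun x => - (w x / 2)) expR _ (nbhs (- (a / 2)))).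
    by apply: cvgN; exact: cvgMl.
  exact: continuous_expR.
have h2 := rd_cvgNy (rd_xM dpsi_rd).
have h : psi w x - x * dpsi x @[x --> -oo] --> expR (- (a / 2)) - 0 by exact: cvgB.
by rewrite subr0 in h; apply: (cvg_eqfun _ h) => x; rewrite gsAE.
Qed.

Lemma gs_cvgy (a : R) : w x @[x --> +oo] --> a ->
  gsA x @[x --> +oo] --> expR (- (a / 2)) /\ gsB x @[x --> +oo] --> (0 : R).
Proof.
move=> wa; split; last first.
  by apply: cvg_eqfun (rd_cvgy dpsi_rd) => x; rewrite gsBE.
have h1 : psi w x @[x --> +oo] --> expR (- (a / 2)).
  apply: (@cvg_comp _ _ _ (fun x => - (w x / 2)) expR _ (nbhs (- (a / 2)))).
    by apply: cvgN; exact: cvgMl.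
  exact: continuous_expR.
have h2 := rd_cvgy (rd_xM dpsi_rd).
have h : psi w x - x * dpsi x @[x --> +oo] --> expR (- (a / 2)) - 0 by exact: cvgB.
by rewrite subr0 in h; apply: (cvg_eqfun _ h) => x; rewrite gsAE.
Qed.

End ground_state.

Section zero_energy.
Variable R : realType.
Local Notation C := (Rcomplex R).
Local Notation mu := (@lebesgue_measure R).
Implicit Types (f q A B : R -> R) (x : R).

Lemma adm_ge0 K q : adm K q -> 0 <= K.
Proof.
move=> [_ /(_ 0)]; have : 0 <= `|q 0| * (1 + `|0 : R|) ^+ 4.
  by rewrite mulr_ge0// exprn_ge0// addr_ge0.
by move=> /le_trans h /h; rewrite pmulr_lge0 ?wt_gt0.
Qed.

Lemma ksol0E A B x : ksol 0 A B x = A x + x * B x.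
Proof. by rewrite /ksol /fcos /fsin eqxx mul0r cos0 mulr1 [B x * _]mulrC. Qed.

Lemma jost_minus0E K q A B : adm K q -> ksys q 0 A B ->
  A x @[x --> -oo] --> (1 : R) -> B x @[x --> -oo] --> (0 : R) ->
  jost_minus q 0 = (fun x => Complex (ksol 0 A B x) 0 : C).
Proof.
move=> aq s A1 B0; have [A2 [B2 [s2 A2l B2l]]] := ksys_exists 0 aq 0 1.
rewrite (jost_minusE aq s s2 A1 B0 A2l B2l).
by apply/funext => x; rewrite mul0r oppr0.
Qed.

Lemma jost_plus0E K q A B : adm K q -> ksys q 0 A B ->
  A x @[x --> +oo] --> (1 : R) -> B x @[x --> +oo] --> (0 : R) ->
  jost_plus q 0 = (fun x => Complex (ksol 0 A B x) 0 : C).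
Proof.
move=> aq s A1 B0; have [A2 [B2 [s2 A2l B2l]]] := ksys_existsy 0 aq 0 1.
rewrite (jost_plusE aq s s2 A1 B0 A2l B2l).
by apply/funext => x; rewrite mul0r.
Qed.

Lemma ksys0_derive1 q A B : ksys q 0 A B ->
  (fun x => Complex (ksol 0 A B x) 0 : C)^`() = (fun x => Complex (B x) 0 : C).
Proof.
move=> /ksys_der[sd _]; apply/funext => x; rewrite derive1E.
have d : is_derive x (1 : R) (fun x => Complex (ksol 0 A B x) 0 : C) (Complex (B x) 0 : C).
  apply/is_derive_Rcomplex => /=; split; last exact: is_derive_cst.
  apply: is_derive_eq; first exact: sd.
  by rewrite /fcos mul0r cos0 mulr1 expr0n /= !mul0r subr0.
by have [] := d.
Qed.

Lemma jost_wronskian0E K q A1 B1 A2 B2 x : adm K q ->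
  ksys q 0 A1 B1 -> ksys q 0 A2 B2 ->
  A1 x @[x --> -oo] --> (1 : R) -> B1 x @[x --> -oo] --> (0 : R) ->
  A2 x @[x --> +oo] --> (1 : R) -> B2 x @[x --> +oo] --> (0 : R) ->
  jost_wronskian0 q x = real_complex R (A1 x * B2 x - A2 x * B1 x).
Proof.
move=> aq s1 s2 l1 l2 l3 l4; rewrite /jost_wronskian0 /wronskian.
rewrite (jost_minus0E aq s1 l1 l2) (jost_plus0E aq s2 l3 l4).
rewrite (ksys0_derive1 s1) (ksys0_derive1 s2).
apply: eq_ReIm; rewrite !ReImE /= !ksol0E; ring.
Qed.

(** Evaluate the constant Wronskian at +oo, where f_+ tends to 1 and its derivative
    to 0. *)
Lemma jost_wronskian0_limit K q A B x (b : R) : adm K q -> ksys q 0 A B ->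
  A x @[x --> -oo] --> (1 : R) -> B x @[x --> -oo] --> (0 : R) ->
  B x @[x --> +oo] --> b -> jost_wronskian0 q x = real_complex R (- b).
Proof.
move=> aq s l1 l2 l3; have [A2 [B2 [s2 A2l B2l]]] := ksys_existsy 0 aq 1 0.
rewrite (jost_wronskian0E x aq s s2 l1 l2 A2l B2l); congr (real_complex R _).
have [a [_ [a' [_ [_ _ Aa _]]]]] := ksys_limits aq s.
have [W hW] := sys_wronskian s s2; rewrite hW.
have H : A x * B2 x - A2 x * B x @[x --> +oo] --> (a' * 0 - 1 * b : R).
  by apply: cvgB; exact: cvgM.
rewrite mulr0 sub0r mul1r in H; apply: (cvg_unique _ _ H) => //.
by apply: (cvg_eqfun (f := cst W)) => [y|]; [rewrite hW|exact: cvg_cst].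
Qed.

Section first_variation.
Variables (u : R -> R).
Hypothesis cu : cls (@rd R) u.
Variable v : R -> R.
Hypothesis cv : cls (@rd R) v.
Let g := u^`().
Let ug : Der u g. Proof. exact: cls_derive1 cu. Qed.
Let cg : cls (@rd R) g. Proof. exact: cls_derivative. Qed.
Let q := pot g.

(** Pairing the perturbed solution with the ground state gives the Wronskian as e
    times the integral of v against their product, and the two solutions differ by
    O(e) (1 + |x|), a growth that v absorbs. *)
Lemma jost_wronskian0_variation : exists D, forall e : R, `|e| <= 1 ->
  exists2 W : R, (forall x, jost_wronskian0 (fun y => q y + e * v y) x = real_complex R W) &
    `|W - e * Lambda1 u v| <= D * e ^+ 2.
Proof.
have rq : cls (@rd R) q by exact: pot_rd.
have [K1 aq] := rd_adm (cls_continuous rq) (cls_in rq).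
have [K2 av] := rd_adm (cls_continuous cv) (cls_in cv).
have K20 := adm_ge0 av.
have [s0 psiE] := gs_ksys ug cg.
have [u1 u2] := rd_cvg0 (cls_in cu).
have [gA1 gB1] := gs_cvgNy ug cg u1; have [gA2 gB2] := gs_cvgy ug cg u2.
rewrite !mul0r oppr0 expR0 in gA1 gA2.
set A0 := gsA u g in s0 psiE gA1 gA2; set B0 := gsB u g in s0 psiE gB1 gB2.
have [M hM] := sys_bounded (adm_sys 0 aq) s0.
have [P hP] := bnd_psi ug cg.
have M0 : 0 <= M by apply: le_trans (hM 0); rewrite addr_ge0.
have P0 : 0 <= P by exact: le_trans (hP 0).
pose K := K1 + K2.
pose G := 2 * expR (6 * (2 * (K + 1)) * pi) * (K2 * M).
have G0 : 0 <= G by rewrite !mulr_ge0 ?expR_ge0.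
exists (K2 * P * G * pi) => e e1.
have aqe : adm K (fun y => q y + e * v y).
  have [ce he] := admD e aq av; split=> // x; apply: le_trans (he x) _.
  by rewrite ler_wpM2r ?(ltW (wt_gt0 x))// lerD2l ler_piMl.
have [A [B [s Al Bl]]] := ksys_exists 0 aqe 1 0.
have [_ [_ [a [b [_ _ Aa Bb]]]]] := ksys_limits aqe s.
exists (- b); first by move=> x; exact: (jost_wronskian0_limit x aqe s Al Bl Bb).
have close x : `|A x - A0 x| + `|B x - B0 x| <= G * `|e|.
  have small y : `|e * v y| * (1 + `|y|) ^+ 2 <= `|e| * K2 * wt y.
    by rewrite normrM -!mulrA ler_wpM2l//; exact: (@adm_le _ _ _ av 2).
  have fs (y : R) : `|fsin 0 y| <= 1 + `|y| by rewrite (le_trans (fsin_le 0 y))// lerDr.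
  have fc (y : R) : `|fcos 0 y| <= 1 + `|y| by rewrite (le_trans (fcos_le1 0 y))// lerDl.
  have gen p r y : `|p| <= 1 + `|y| -> `|r| <= 1 + `|y| ->
      `|p * (q y + e * v y) * r - p * q y * r| <= `|e| * K2 * wt y.
    move=> hp hr; apply: le_trans (small y).
    have -> : p * (q y + e * v y) * r - p * q y * r = (e * v y) * (p * r) by ring.
    by rewrite normrM ler_wpM2l// normrM expr2 ler_pM.
  have := sys_perturb (adm_sys 0 aqe) (mulr_ge0 (normr_ge0 e) K20)
    (fun y => gen _ _ y (fs y) (fs y)) (fun y => gen _ _ y (fs y) (fc y))
    (fun y => gen _ _ y (fc y) (fc y)) hM s s0 Al gA1 Bl gB1 x.
  move=> /le_trans; apply; rewrite le_eqVlt; apply/orP; left; apply/eqP.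
  by rewrite /G; ring.
pose f := ksol 0 A B.
have vf : dom (fun x => expR (- u x) * v x).
  by apply: cls_rd_dom; apply: cls_rdM => //; exact: cls_expNu.
have [L [Ld L0 Loo]] := dom_primitive vf; rewrite -Lambda1E in Loo.
have [hA hB] := s; have [hA0 hB0] := s0.
pose Om x := A x * B0 x - A0 x * B x - e * L x.
have Omd : Der Om (fun x => e * v x * (f x - psi u x) * psi u x).
  apply: Der_eq.
    by apply: DerB; [exact: DerB (DerM hA hB0) (DerM hA0 hB)|exact: (DerM (Der_cst e) Ld)].
  move=> x /=; rewrite -(psi_sqr u x).
  have -> : psi u x = A0 x * fcos 0 x + B0 x * fsin 0 x by rewrite psiE.
  by rewrite /f /ksol -/(q x); ring.
have Om1 : Om x @[x --> -oo] --> (0 : R).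
  have : Om x @[x --> -oo] --> (1 * 0 - 1 * 0 - e * 0 : R).
    by apply: cvgB; [apply: cvgB; exact: cvgM|exact: cvgMr].
  by rewrite !mulr0 !subr0.
have Om2 : Om x @[x --> +oo] --> (- b - e * Lambda1 u v : R).
  have : Om x @[x --> +oo] --> (a * 0 - 1 * b - e * Lambda1 u v : R).
    by apply: cvgB; [apply: cvgB; exact: cvgM|exact: cvgMr].
  by rewrite mulr0 sub0r mul1r.
have Obd x : `|e * v x * (f x - psi u x) * psi u x| <= K2 * P * G * e ^+ 2 * wt x.
  have fp : `|f x - psi u x| <= G * `|e| * (1 + `|x|).
    rewrite psiE /f !ksol0E.
    have -> : A x + x * B x - (A0 x + x * B0 x) = (A x - A0 x) + x * (B x - B0 x) by ring.
    apply: le_trans (ler_normD _ _) _; rewrite normrM.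
    have h := close x.
    have := normr_ge0 (A x - A0 x); have := normr_ge0 (B x - B0 x); have := normr_ge0 x.
    move: h; move: (`|A x - A0 x|) (`|B x - B0 x|) (`|x|) (G * `|e|) => aa bb xx gg; nra.
  rewrite !normrM -[e ^+ 2]real_normK ?num_real//.
  apply: (@le_trans _ _ (`|e| * `|v x| * (G * `|e| * (1 + `|x|)) * P)).
    by rewrite ler_pM ?mulr_ge0// ler_wpM2l ?mulr_ge0.
  have -> : `|e| * `|v x| * (G * `|e| * (1 + `|x|)) * P =
    P * G * `|e| ^+ 2 * (`|v x| * (1 + `|x|) ^+ 1) by ring.
  have -> : K2 * P * G * `|e| ^+ 2 * wt x = P * G * `|e| ^+ 2 * (K2 * wt x) by ring.
  by rewrite ler_wpM2l ?mulr_ge0 ?sqr_ge0//; exact: (@adm_le _ _ _ av 1).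
have Om3 : `|Om x| @[x --> +oo] --> `|- b - e * Lambda1 u v| by exact: cvg_norm.
apply: (ler_cvg_to Om3 (cvg_cst (K2 * P * G * pi * e ^+ 2))).
near=> x; have := dom_boundNy (x := x) Omd (fun y _ => Obd y) Om1.
rewrite subr0 => /le_trans; apply.
have -> : K2 * P * G * pi * e ^+ 2 = K2 * P * G * e ^+ 2 * pi by ring.
by rewrite ler_wpM2l ?atan_le_pi// mulr_ge0 ?sqr_ge0// !mulr_ge0.
Unshelve. all: by end_near. Qed.

Theorem wronskian_variation x :
  is_derive (0 : R) (1 : R)
    (fun e : R => jost_wronskian0 (fun y => q y + e * v y) x)
    (real_complex R (Lambda1 u v) : C).
Proof.
have [D hD] := jost_wronskian0_variation.
have /choice[W hW] (e : R) : exists W : R, `|e| <= 1 ->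
    jost_wronskian0 (fun y => q y + e * v y) x = real_complex R W /\
    `|W - e * Lambda1 u v| <= D * e ^+ 2.
  have [e1|e1] := leP `|e| 1; last by exists 0.
  by have [W W1 W2] := hD e e1; exists W => _; split.
have W0 : W 0 = 0.
  have [|_] := hW 0; first by rewrite normr0.
  by rewrite expr0n mulr0 mul0r subr0 normr_le0 => /eqP.
have near1 : \forall e \near (0 : R), `|e| <= 1 by exact: (@nbhs0_le R R 1 ltr01).
have Wd : is_derive (0 : R) (1 : R) W (Lambda1 u v).
  apply: is_derive_lim; apply/cvgrPdist_le => d d0.
  have D1 : 0 < `|D| + 1 by rewrite ltr_wpDl.
  near=> h; rewrite addr0 W0 subr0.
  have h0 : h != 0 by near: h; exact: nbhs_dnbhs_neq.
  have [|_ Wh] := hW h; first by near: h; exact: dnbhs0_le.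
  have -> : Lambda1 u v - h^-1 *: W h = - h^-1 * (W h - h * Lambda1 u v).
    by rewrite /GRing.scale /=; field.
  rewrite normrM normrN normfV ler_pdivrMl ?normr_gt0//.
  apply: le_trans Wh _; rewrite -[h ^+ 2]real_normK ?num_real// expr2 mulrCA ler_wpM2l//.
  apply: (@le_trans _ _ ((`|D| + 1) * `|h|)).
    by rewrite ler_wpM2r// (le_trans (ler_norm D))// lerDl.
  by rewrite mulrC -ler_pdivlMr//; near: h; apply: dnbhs0_le; rewrite divr_gt0.
apply/is_derive_Rcomplex; split.
  apply: (near_eq_is_derive _ Wd); apply: filterS near1 => e e1.
  by have [-> _] := hW e e1.
apply: (near_eq_is_derive _ (is_derive_cst (0 : R) (0 : R) (1 : R))).
by apply: filterS near1 => e e1; have [-> _] := hW e e1.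
Unshelve. all: by end_near. Qed.

End first_variation.
End zero_energy.

(** * The reflection coefficient of an exceptional potential at zero momentum *)

Section reflection.
Variable R : realType.
Local Notation C := (Rcomplex R).
Local Notation mu := (@lebesgue_measure R).
Local Notation Re := (@complex.Re R).
Local Notation Im := (@complex.Im R).
Implicit Types (f q A B : R -> R) (x k : R).

Lemma ksysN q k : ksys q (- k) = ksys q k.
Proof.
have ec : fcos (- k) = fcos k by apply/funext => x; rewrite /fcos mulNr cosN.
have es : fsin (- k) = fsin k.
  apply/funext => x; rewrite /fsin oppr_eq0; case: eqP => // _.
  by rewrite mulNr sinN invrN mulrNN.
by rewrite /ksys ec es.
Qed.

Lemma ksolN k A B : ksol (- k) A B = ksol k A B.
Proof.
apply/funext => x; rewrite /ksol /fcos mulNr cosN; congr (_ + _ * _).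
rewrite /fsin oppr_eq0; case: eqP => // _.
by rewrite mulNr sinN invrN mulrNN.
Qed.

Lemma ksys_zeroy K q k A B : adm K q -> ksys q k A B ->
  A x @[x --> +oo] --> (0 : R) -> B x @[x --> +oo] --> (0 : R) ->
  forall x, A x = 0 /\ B x = 0.
Proof.
move=> aq s A0 B0 x; have r := sys_reflect (fcosN k) (fsinN k) s.
have B0' : - B (- x) @[x --> -oo] --> (0 : R).
  by rewrite -oppr0; apply: cvgN; exact: cvgy_opp.
have [] := sys_zero (adm_sys k (adm_opp aq)) r (cvgy_opp A0) B0' (- x).
by rewrite opprK => -> /eqP; rewrite oppr_eq0 => /eqP ->.
Qed.

Lemma ksol_zero q k A B : ksys q k A B -> (forall x, ksol k A B x = 0) ->
  forall x, A x = 0 /\ B x = 0.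
Proof.
move=> s f0 x; have [fd _] := ksys_der s.
have f'0 : B x * fcos k x - k ^+ 2 * fsin k x * A x = 0.
  apply: (Der_uniq fd); rewrite (_ : ksol k A B = fun=> 0); first exact: Der_cst.
  by apply/funext.
have f0x := f0 x; rewrite /ksol in f0x; split.
  rewrite -[LHS]mulr1 -(fcos2 k x).
  have -> : A x * (fcos k x ^+ 2 + k ^+ 2 * fsin k x ^+ 2) =
    fcos k x * (A x * fcos k x + B x * fsin k x) -
    fsin k x * (B x * fcos k x - k ^+ 2 * fsin k x * A x) by ring.
  by rewrite f0x f'0 !mulr0 subr0.
rewrite -[LHS]mulr1 -(fcos2 k x).
have -> : B x * (fcos k x ^+ 2 + k ^+ 2 * fsin k x ^+ 2) =
  k ^+ 2 * fsin k x * (A x * fcos k x + B x * fsin k x) +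
  fcos k x * (B x * fcos k x - k ^+ 2 * fsin k x * A x) by ring.
by rewrite f0x f'0 !mulr0 addr0.
Qed.

Section coefficients.
Variables (q : R -> R) (K k : R).
Hypothesis aq : adm K q.
Hypothesis k0 : k != 0.

(** Matching the data at +oo of the two real solutions normalized at -oo gives the
    scattering coefficients. *)
Lemma reflectionE A1 B1 A2 B2 (a1 g1 a2 g2 : R) :
  ksys q k A1 B1 -> ksys q k A2 B2 ->
  A1 x @[x --> -oo] --> (1 : R) -> B1 x @[x --> -oo] --> (0 : R) ->
  A2 x @[x --> -oo] --> (0 : R) -> B2 x @[x --> -oo] --> (1 : R) ->
  A1 x @[x --> +oo] --> a1 -> B1 x @[x --> +oo] --> g1 ->
  A2 x @[x --> +oo] --> a2 -> B2 x @[x --> +oo] --> g2 ->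
  reflection q k =
    (Complex ((a1 - g2) / 2) ((- (k * a2) - g1 / k) / 2) : C) /
    (Complex ((a1 + g2) / 2) ((- (k * a2) + g1 / k) / 2) : C).
Proof.
move=> s1 s2 l1 l2 l3 l4 m1 m2 m3 m4.
have [P1 [Q1 [t1 p1 p2]]] := ksys_existsy k aq 1 0.
have [P2 [Q2 [t2 p3 p4]]] := ksys_existsy k aq 0 1.
pose X := ksol k P1 Q1; pose Y := ksol k P2 Q2.
have dec A B (a g : R) : ksys q k A B -> A x @[x --> +oo] --> a ->
    B x @[x --> +oo] --> g -> forall x, ksol k A B x = a * X x + g * Y x.
  move=> s Aa Bg x.
  have c1 := sys_comb (-1) s (sys_comb a t1 (sys_comb g t2 (sys_comb (-1) t2 t2))).
  have E1 : -1 * A x + (a * P1 x + (g * P2 x + (-1 * P2 x + P2 x))) @[x --> +oo] --> (0 : R).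
    have -> : 0 = -1 * a + (a * 1 + (g * 0 + (-1 * 0 + 0))) :> R by ring.
    by apply: cvgD; [exact: cvgMr|apply: cvgD; [exact: cvgMr|
      apply: cvgD; [exact: cvgMr|apply: cvgD; [exact: cvgMr|exact: p3]]]].
  have E2 : -1 * B x + (a * Q1 x + (g * Q2 x + (-1 * Q2 x + Q2 x))) @[x --> +oo] --> (0 : R).
    have -> : 0 = -1 * g + (a * 0 + (g * 1 + (-1 * 1 + 1))) :> R by ring.
    by apply: cvgD; [exact: cvgMr|apply: cvgD; [exact: cvgMr|
      apply: cvgD; [exact: cvgMr|apply: cvgD; [exact: cvgMr|exact: p4]]]].
  have [h1 h2] := ksys_zeroy aq c1 E1 E2 x.
  rewrite /X /Y /ksol.
  have -> : A x = a * P1 x + g * P2 x by move: h1; lra.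
  have -> : B x = a * Q1 x + g * Q2 x by move: h2; lra.
  by ring.
have jm := jost_minusE aq s1 s2 l1 l2 l3 l4.
have jp := jost_plusE aq t1 t2 p1 p2 p3 p4.
have jpN : jost_plus q (- k) = (fun x => Complex (X x) (- (k * Y x)) : C).
  have t1' := t1; have t2' := t2; rewrite -ksysN in t1' t2'.
  rewrite (jost_plusE aq t1' t2' p1 p2 p3 p4).
  by apply/funext => x; rewrite !ksolN mulNr.
pose a : C := Complex ((a1 + g2) / 2) ((- (k * a2) + g1 / k) / 2).
pose b : C := Complex ((a1 - g2) / 2) ((- (k * a2) - g1 / k) / 2).
have coef x : jost_minus q k x = a * jost_plus q (- k) x + b * jost_plus q k x.
  rewrite jm jp jpN (dec _ _ _ _ s1 m1 m2) (dec _ _ _ _ s2 m3 m4).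
  by apply: eq_ReIm; rewrite !ReImE /= -/(X x) -/(Y x); field.
have indep (z w : R) : (forall x, z * X x + w * Y x = 0) -> z = 0 /\ w = 0.
  move=> h; have c := sys_comb z t1 (sys_comb w t2 (sys_comb (-1) t2 t2)).
  have e : forall x, ksol k (fun x => z * P1 x + (w * P2 x + (-1 * P2 x + P2 x)))
      (fun x => z * Q1 x + (w * Q2 x + (-1 * Q2 x + Q2 x))) x = 0.
    by move=> x; rewrite -(h x) /X /Y /ksol; ring.
  have E := ksol_zero c e; split.
    have H : z * P1 x + (w * P2 x + (-1 * P2 x + P2 x)) @[x --> +oo] -->
        (z * 1 + (w * 0 + (-1 * 0 + 0)) : R).
      by apply: cvgD; [exact: cvgMr|apply: cvgD; [exact: cvgMr|apply: cvgD; [exact: cvgMr|exact: p3]]].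
    have -> : z = z * 1 + (w * 0 + (-1 * 0 + 0)) by ring.
    apply: (cvg_unique _ H) => //; apply: (cvg_eqfun (f := cst 0)); last exact: cvg_cst.
    by move=> x; have [->] := E x.
  have H : z * Q1 x + (w * Q2 x + (-1 * Q2 x + Q2 x)) @[x --> +oo] -->
      (z * 0 + (w * 1 + (-1 * 1 + 1)) : R).
    by apply: cvgD; [exact: cvgMr|apply: cvgD; [exact: cvgMr|apply: cvgD; [exact: cvgMr|exact: p4]]].
  have -> : w = z * 0 + (w * 1 + (-1 * 1 + 1)) by ring.
  apply: (cvg_unique _ H) => //; apply: (cvg_eqfun (f := cst 0)); last exact: cvg_cst.
  by move=> x; have [_ ->] := E x.
have scE : scattering_coefficients q k = (a, b).
  apply: xget_unique => [x|[a' b'] h]; first exact: coef.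
  have D x : (a' - a) * jost_plus q (- k) x + (b' - b) * jost_plus q k x = 0.
    have := h x; rewrite coef /= => e.
    by rewrite !mulrBl addrACA -opprD -e subrr.
  have [d1 d2] : Re (a' - a) + Re (b' - b) = 0 /\ k * (Im (a' - a) - Im (b' - b)) = 0.
    apply: indep => x; have := congr1 Re (D x).
    by rewrite jp jpN !ReImE /= -/(X x) -/(Y x) => <-; ring.
  have [d3 d4] : Im (a' - a) + Im (b' - b) = 0 /\ k * (Re (b' - b) - Re (a' - a)) = 0.
    apply: indep => x; have := congr1 Im (D x).
    by rewrite jp jpN !ReImE /= -/(X x) -/(Y x) => <-; ring.
  have k_cancel (z : R) : k * z = 0 -> z = 0.
    by move=> /eqP; rewrite mulf_eq0 (negbTE k0) => /eqP.
  have e1 := k_cancel _ d2; have e2 := k_cancel _ d4.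
  congr (_, _); apply/eqP; rewrite -subr_eq0; apply/eqP; apply: eq_ReIm => /=; lra.
by rewrite /reflection scE.
Qed.

End coefficients.

Lemma cvg_squeeze0 {T : Type} (F : set_system T) (f h : T -> R) (l : R) : Filter F ->
  (\forall t \near F, `|f t - l| <= h t) -> h t @[t --> F] --> (0 : R) ->
  f t @[t --> F] --> l.
Proof.
move=> FF fh /cvgr0Pnorm_le h0; apply/cvgrPdist_le => e e0.
near=> t; rewrite distrC; apply: (@le_trans _ _ (h t)); first by near: t.
by apply: le_trans (ler_norm _) _; near: t; exact: h0.
Unshelve. all: by end_near. Qed.

Section limit.
Variables (w g : R -> R) (H : R).
Hypotheses (wg : Der w g) (cg : cls (@rd R) g).
Hypothesis wNy : w x @[x --> -oo] --> (0 : R).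
Hypothesis wy : w x @[x --> +oo] --> H.
Let q := pot g.

Lemma pot_adm : exists K, adm K q.
Proof.
have rq : cls (@rd R) q by exact: pot_rd.
exact: rd_adm (cls_continuous rq) (cls_in rq).
Qed.

(** The ground state tends to nonzero constants at both ends, so it is a multiple of
    both Jost solutions. *)
Lemma pot_exceptional : exceptional q.
Proof.
move=> x; have [K aq] := pot_adm; have [s _] := gs_ksys wg cg.
have [l1 l2] := gs_cvgNy wg cg wNy; have [_ l4] := gs_cvgy wg cg wy.
rewrite mul0r oppr0 expR0 in l1.
by rewrite (jost_wronskian0_limit x aq s l1 l2 l4) oppr0.
Qed.

Let c := expR (- (H / 2)).

(** As k tends to 0 the data (a1, g1) at +oo of the first normalized solution
    approach those of the ground state quadratically in k, the second one stays
    bounded, and the Wronskian of the two determines the rest. *)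
Lemma transfer_limits : exists (a1 g1 a2 g2 : R -> R), exists G : R,
  (forall k, k != 0 -> reflection q k =
    (Complex ((a1 k - g2 k) / 2) ((- (k * a2 k) - g1 k / k) / 2) : C) /
    (Complex ((a1 k + g2 k) / 2) ((- (k * a2 k) + g1 k / k) / 2) : C)) /\
  (forall k, `|k| <= 1 -> [/\ `|a1 k - c| <= G * k ^+ 2, `|g1 k| <= G * k ^+ 2,
     `|a2 k| <= G & a1 k * g2 k - a2 k * g1 k = 1]).
Proof.
have [K aq] := pot_adm; have K0 := adm_ge0 aq.
have [s0 _] := gs_ksys wg cg.
have [m1 m2] := gs_cvgNy wg cg wNy; have [m3 m4] := gs_cvgy wg cg wy.
rewrite mul0r oppr0 expR0 in m1.
set A0 := gsA w g in s0 m1 m3; set B0 := gsB w g in s0 m2 m4.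
have [M hM] := sys_bounded (adm_sys 0 aq) s0.
have M0 : 0 <= M by apply: le_trans (hM 0); rewrite addr_ge0.
pose G1 := 2 * expR (6 * (2 * (K + 1)) * pi) * (2 * K * M).
pose G2 := (1 + 2 * expR (6 * (2 * K) * pi)) * (`|0 : R| + `|1 : R|).
have G10 : 0 <= G1 by rewrite !mulr_ge0 ?expR_ge0.
have G20 : 0 <= G2 by rewrite mulr_ge0 ?addr_ge0 ?mulr_ge0 ?expR_ge0.
have main (k : R) : exists t : (R * R) * (R * R),
   (k != 0 -> reflection q k =
    (Complex ((t.1.1 - t.2.2) / 2) ((- (k * t.2.1) - t.1.2 / k) / 2) : C) /
    (Complex ((t.1.1 + t.2.2) / 2) ((- (k * t.2.1) + t.1.2 / k) / 2) : C)) /\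
   (`|k| <= 1 -> [/\ `|t.1.1 - c| <= (G1 + G2) * k ^+ 2,
      `|t.1.2| <= (G1 + G2) * k ^+ 2, `|t.2.1| <= G1 + G2 &
      t.1.1 * t.2.2 - t.2.1 * t.1.2 = 1]).
  have [A1 [B1 [s1 l1 l2]]] := ksys_exists k aq 1 0.
  have [A2 [B2 [s2 l3 l4]]] := ksys_exists k aq 0 1.
  have [_ [_ [a1 [g1 [_ _ n1 n2]]]]] := ksys_limits aq s1.
  have [_ [_ [a2 [g2 [_ _ n3 n4]]]]] := ksys_limits aq s2.
  exists ((a1, g1), (a2, g2)); split=> /= [k0|k1].
    exact: (reflectionE aq k0 s1 s2 l1 l2 l3 l4 n1 n2 n3 n4).
  have k20 : 0 <= 2 * K * k ^+ 2 by rewrite mulr_ge0 ?sqr_ge0// mulr_ge0.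
  have k2 : 0 <= 2 * k ^+ 2 by rewrite mulr_ge0 ?sqr_ge0.
  have pw (n : nat) (y : R) : `|y| ^+ n <= (1 + `|y|) ^+ n.
    by rewrite lerXn2r ?nnegrE ?addr_ge0// lerDr.
  have close x : `|A1 x - A0 x| + `|B1 x - B0 x| <= G1 * k ^+ 2.
    have wq (p : R) y : `|p| <= 2 * k ^+ 2 * (1 + `|y|) ^+ 4 ->
        `|p * q y| <= 2 * K * k ^+ 2 * wt y.
      move=> hp; rewrite normrM mulrC.
      apply: (@le_trans _ _ (`|q y| * (2 * k ^+ 2 * (1 + `|y|) ^+ 4))).
        by rewrite ler_wpM2l.
      have -> : `|q y| * (2 * k ^+ 2 * (1 + `|y|) ^+ 4) =
        2 * k ^+ 2 * (`|q y| * (1 + `|y|) ^+ 4) by ring.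
      have -> : 2 * K * k ^+ 2 * wt y = 2 * k ^+ 2 * (K * wt y) by ring.
      apply: ler_wpM2l => //; exact: (adm_le aq y (j := 4)).
    have fc0 y : fcos 0 y = 1 by rewrite /fcos mul0r cos0.
    have fs0 y : fsin 0 y = y by rewrite /fsin eqxx.
    have e1 y : `|fsin k y * q y * fsin k y - fsin 0 y * q y * fsin 0 y| <= 2 * K * k ^+ 2 * wt y.
      have -> : fsin k y * q y * fsin k y - fsin 0 y * q y * fsin 0 y =
        (fsin k y - y) * (fsin k y + y) * q y by rewrite fs0; ring.
      apply: wq; rewrite normrM.
      apply: (@le_trans _ _ (k ^+ 2 * `|y| ^+ 3 * (2 * `|y|))).
        rewrite ler_pM ?fsinBx// (le_trans (ler_normD _ _))//.
        by rewrite mulr_natl mulr2n lerD2r fsin_le.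
      have -> : k ^+ 2 * `|y| ^+ 3 * (2 * `|y|) = 2 * k ^+ 2 * `|y| ^+ 4 by ring.
      by apply: ler_wpM2l => //; exact: pw.
    have e2 y : `|fsin k y * q y * fcos k y - fsin 0 y * q y * fcos 0 y| <= 2 * K * k ^+ 2 * wt y.
      have -> : fsin k y * q y * fcos k y - fsin 0 y * q y * fcos 0 y =
        ((fsin k y - y) + fsin k y * (fcos k y - 1)) * q y by rewrite fs0 fc0; ring.
      apply: wq; rewrite (le_trans (ler_normD _ _))// normrM.
      apply: (@le_trans _ _ (k ^+ 2 * `|y| ^+ 3 + `|y| * (k ^+ 2 * `|y| ^+ 2))).
        by rewrite lerD ?fsinBx// ler_pM ?fsin_le ?fcosB1.
      have -> : k ^+ 2 * `|y| ^+ 3 + `|y| * (k ^+ 2 * `|y| ^+ 2) = 2 * k ^+ 2 * `|y| ^+ 3 by ring.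
      apply: ler_wpM2l => //.
      apply: (le_trans (pw 3%N y)).
      by apply: ler_weXn2l => //; rewrite lerDl.
    have e3 y : `|fcos k y * q y * fcos k y - fcos 0 y * q y * fcos 0 y| <= 2 * K * k ^+ 2 * wt y.
      have -> : fcos k y * q y * fcos k y - fcos 0 y * q y * fcos 0 y =
        (fcos k y - 1) * (fcos k y + 1) * q y by rewrite fc0; ring.
      apply: wq; rewrite normrM.
      apply: (@le_trans _ _ (k ^+ 2 * `|y| ^+ 2 * 2)).
        rewrite ler_pM ?fcosB1// (le_trans (ler_normD _ _))// normr1.
        by have := fcos_le1 k y; lra.
      have -> : k ^+ 2 * `|y| ^+ 2 * 2 = 2 * k ^+ 2 * `|y| ^+ 2 by ring.
      apply: ler_wpM2l => //.
      apply: (le_trans (pw 2%N y)).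
      by apply: ler_weXn2l => //; rewrite lerDl.
    have := sys_perturb (adm_sys k aq) k20 e1 e2 e3 hM s1 s0 l1 m1 l2 m2 x.
    move=> /le_trans; apply; rewrite le_eqVlt; apply/orP; left; apply/eqP.
    by rewrite /G1; ring.
  have GG : G1 * k ^+ 2 <= (G1 + G2) * k ^+ 2 by rewrite ler_wpM2r ?sqr_ge0// lerDl.
  split.
  - have h : `|A1 x - A0 x| @[x --> +oo] --> `|a1 - c| by apply: cvg_norm; exact: cvgB.
    apply: le_trans GG; apply: (ler_cvg_to h (cvg_cst (G1 * k ^+ 2))).
    by near=> x; apply: le_trans (close x); rewrite lerDl.
  - have h : `|B1 x - B0 x| @[x --> +oo] --> `|g1 - 0| by apply: cvg_norm; exact: cvgB.
    rewrite subr0 in h; apply: le_trans GG; apply: (ler_cvg_to h (cvg_cst (G1 * k ^+ 2))).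
    by near=> x; apply: le_trans (close x); rewrite lerDr.
  - have h : `|A2 x| @[x --> +oo] --> `|a2| by exact: cvg_norm.
    apply: (@le_trans _ _ G2); last by rewrite lerDr.
    apply: (ler_cvg_to h (cvg_cst G2)); near=> x.
    by apply: le_trans (sys_bound_limit (adm_sys k aq) s2 l3 l4 x); rewrite lerDl.
  - have [W hW] := sys_wronskian s1 s2.
    have h1 : A1 x * B2 x - A2 x * B1 x @[x --> -oo] --> (1 * 1 - 0 * 0 : R).
      by apply: cvgB; exact: cvgM.
    have h2 : A1 x * B2 x - A2 x * B1 x @[x --> +oo] --> a1 * g2 - a2 * g1.
      by apply: cvgB; exact: cvgM.
    have cW F : ProperFilter F -> A1 x * B2 x - A2 x * B1 x @[x --> F] --> W.
      move=> PF; apply: (cvg_eqfun (f := cst W)); last exact: cvg_cst.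
      by move=> x; rewrite hW.
    rewrite -(cvg_unique _ (cW +oo _) h2)// (cvg_unique _ (cW -oo _) h1)//.
    by rewrite mul0r subr0 mulr1.
have /choice[t ht] := main.
exists (fun k => (t k).1.1), (fun k => (t k).1.2), (fun k => (t k).2.1), (fun k => (t k).2.2), (G1 + G2).
by split=> k; have [h1 h2] := ht k.
Unshelve. all: by end_near. Qed.

(** In the limit the numerator and the denominator of the reflection coefficient are
    (c - 1/c) / 2 and (c + 1/c) / 2. *)
Lemma reflection_limit :
  reflection q k @[k --> (0 : R)^'] -->
  (real_complex R ((c ^+ 2 - 1) / (c ^+ 2 + 1)) : C).
Proof.
have [a1 [g1 [a2 [g2 [G [hR hG]]]]]] := transfer_limits.
have c0 : 0 < c by exact: expR_gt0.
have k1 : \forall k \near (0 : R)^', `|k| <= 1 by exact: dnbhs0_le ltr01.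
have kn0 : \forall k \near (0 : R)^', k != 0 by exact: nbhs_dnbhs_neq.
have kk : k @[k --> (0 : R)^'] --> (0 : R) by apply: cvg_within_filter; exact: cvg_id.
have nk : `|k| @[k --> (0 : R)^'] --> (0 : R).
  by rewrite -[X in _ --> X](normr0 R); exact: cvg_norm.
have G0 : 0 <= G.
  by have [|_ _ h _] := hG 0; [rewrite normr0|exact: le_trans h].
have GN (z k : R) : `|k| <= 1 -> z <= G * k ^+ 2 -> z <= G * `|k|.
  move=> k1' /le_trans; apply; rewrite ler_wpM2l// -[k ^+ 2]real_normK ?num_real//.
  by rewrite expr2 ler_piMl.
have Gk0 : G * `|k| @[k --> (0 : R)^'] --> (0 : R).
  by rewrite -[X in _ --> X](mulr0 G); exact: cvgMr.
have ca1 : a1 k @[k --> (0 : R)^'] --> c.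
  apply: (cvg_squeeze0 (h := fun k => G * `|k|)) => //.
  by apply: filterS k1 => k k1'; have [h _ _ _] := hG k k1'; exact: GN h.
have cg1 : g1 k @[k --> (0 : R)^'] --> (0 : R).
  apply: (cvg_squeeze0 (h := fun k => G * `|k|)) => //.
  by apply: filterS k1 => k k1'; have [_ h _ _] := hG k k1'; rewrite subr0; exact: GN h.
have cg1k : g1 k / k @[k --> (0 : R)^'] --> (0 : R).
  apply: (cvg_squeeze0 (h := fun k => G * `|k|)) => //.
  near=> k; have k1' : `|k| <= 1 by near: k.
  have k0 : k != 0 by near: k.
  have [_ h _ _] := hG k k1'; rewrite subr0 normrM normfV ler_pdivrMr ?normr_gt0//.
  by rewrite -mulrA -expr2 real_normK ?num_real.
have cka2 : k * a2 k @[k --> (0 : R)^'] --> (0 : R).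
  apply: (cvg_squeeze0 (h := fun k => G * `|k|)) => //.
  apply: filterS k1 => k k1'; have [_ _ h _] := hG k k1'.
  by rewrite subr0 normrM mulrC ler_wpM2r.
have ca2g1 : a2 k * g1 k @[k --> (0 : R)^'] --> (0 : R).
  apply: (cvg_squeeze0 (h := fun k => G * (G * `|k|))).
    apply: filterS k1 => k k1'; have [_ h1 h2 _] := hG k k1'.
    by rewrite subr0 normrM ler_pM//; exact: GN h1.
  by rewrite -[X in _ --> X](mulr0 G); exact: cvgMr.
have cg2 : g2 k @[k --> (0 : R)^'] --> c^-1.
  have h : (1 + a2 k * g1 k) / a1 k @[k --> (0 : R)^'] --> (1 + 0) / c.
    apply: cvgM; first by apply: cvgD => //; exact: cvg_cst.
    by apply: cvgV => //; rewrite gt_eqF.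
  rewrite addr0 div1r in h; apply: cvg_trans h; apply: near_eq_cvg.
  near=> k; have k1' : `|k| <= 1 by near: k.
  have [_ _ _ h] := hG k k1'.
  have a0 : a1 k != 0.
    near: k; have : \forall k \near (0 : R)^', 0 < a1 k by exact: cvgr_gt ca1 _ c0.
    by apply: filterS => k; move=> /gt_eqF ->.
  have -> : 1 + a2 k * g1 k = g2 k * a1 k by move: h; lra.
  by rewrite mulfK.
pose rho := (c ^+ 2 - 1) / (c ^+ 2 + 1).
have c21 : c ^+ 2 + 1 != 0 by rewrite gt_eqF// addr_gt0// exprn_gt0.
pose d := (c + c^-1) / 2.
have d0 : 0 < d by rewrite divr_gt0// addr_gt0// invr_gt0.
have rhoE : (c - c^-1) / 2 = rho * d by rewrite /rho /d; field; rewrite c21 gt_eqF.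
have cRa : (a1 k + g2 k) / 2 @[k --> (0 : R)^'] --> d.
  by apply: cvgM; [exact: cvgD|exact: cvg_cst].
have cRb : (a1 k - g2 k) / 2 @[k --> (0 : R)^'] --> rho * d.
  by rewrite -rhoE; apply: cvgM; [exact: cvgB|exact: cvg_cst].
have cIa : (- (k * a2 k) + g1 k / k) / 2 @[k --> (0 : R)^'] --> ((- 0 + 0) / 2 : R).
  by apply: cvgM; [apply: cvgD => //; exact: cvgN|exact: cvg_cst].
have cIb : (- (k * a2 k) - g1 k / k) / 2 @[k --> (0 : R)^'] --> ((- 0 - 0) / 2 : R).
  by apply: cvgM; [apply: cvgB => //; exact: cvgN|exact: cvg_cst].
have num0 : `|(a1 k - g2 k) / 2 - rho * ((a1 k + g2 k) / 2)| +
    `|(- (k * a2 k) - g1 k / k) / 2 - rho * ((- (k * a2 k) + g1 k / k) / 2)|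
    @[k --> (0 : R)^'] --> (0 : R).
  have E : `|rho * d - rho * d| + `|(- 0 - 0) / 2 - rho * ((- 0 + 0) / 2)| = 0 :> R.
    by rewrite subrr oppr0 addr0 mul0r mulr0 subrr normr0 addr0.
  rewrite -[X in _ --> X]E; apply: cvgD; apply: cvg_norm; apply: cvgB => //; exact: cvgMr.
apply/cvgrPdist_le => e e0.
have ed : 0 < e * (d / 2) by rewrite mulr_gt0// divr_gt0.
near=> k.
have k0 : k != 0 by near: k.
have Ra : d / 2 <= (a1 k + g2 k) / 2.
  near: k; have d2 : d / 2 < d by rewrite ltr_pdivrMr// ltr_pMr// ltr1n.
  by apply: cvgr_ge cRa _ d2.
rewrite hR// distrC; set b := (Complex _ _ : C); set a := (Complex _ _ : C).
have na : d / 2 <= `|a|.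
  by apply: le_trans Ra _; apply: le_trans (ler_norm _) (norm_Re a).
have na0 : 0 < `|a| by apply: lt_le_trans na; rewrite divr_gt0.
have an0 : a != 0 by rewrite -normr_gt0.
have -> : b / a - (real_complex R rho : C) = (b - (real_complex R rho : C) * a) / a.
  by rewrite mulrBl mulfK.
rewrite norm_RcomplexM norm_RcomplexV ler_pdivrMr//.
apply: (@le_trans _ _ (e * (d / 2))); last by rewrite ler_wpM2l// ltW.
apply: le_trans (norm_ReIm _) _; rewrite !ReImE /= !mul0r subr0 addr0.
apply: le_trans (ler_norm _) _; near: k; move/cvgr0Pnorm_le: num0 => /(_ _ ed).
by apply: filterS => k; rewrite addrC.
Unshelve. all: by end_near. Qed.

Lemma reflection0E : cvg (reflection q k @[k --> (0 : R)^']) /\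
  reflection0 q = real_complex R ((expR (- H) - 1) / (expR (- H) + 1)).
Proof.
have c2 : c ^+ 2 = expR (- H) by rewrite /c -expRM_natl; congr expR; field.
have h := reflection_limit; rewrite c2 in h; split; first exact: cvgP h.
exact: cvg_lim h.
Qed.

End limit.
End reflection.

(** * Curves of exceptional potentials *)

Section quadratic_curves.
Variable R : realType.
Local Notation S := (schwartzType R).
Implicit Types (a : S * S * S) (v w : S) (t : R).

Definition quad a t : S := a.1.1 + t *: a.1.2 + t ^+ 2 *: a.2.

Definition dquad a : S * S * S := (a.1.2, 2 *: a.2, 0).

Lemma seminormZ m n (t : R) v :
  schwartz_seminorm m n (t *: v : S) <= `|t| * schwartz_seminorm m n v.
Proof.
apply: seminorm_le => x; rewrite -[t *: v]addr0 schwartz_derive1nD.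
have -> : (0 : S)^`(n) x = 0 by exact: (congr1 (fun f => f x) (derive1n_cst0 R n)).
by rewrite addr0 normrM mulrCA ler_wpM2l// le_seminorm.
Qed.

Lemma quad_derivative a t : curve_derivative (quad a) t (quad (dquad a) t).
Proof.
apply: schwartz_cvg0 => m n e e0.
pose N := schwartz_seminorm m n a.2; have N0 : 0 <= N by exact: seminorm_ge0.
have eN : 0 < e / (N + 1) by rewrite divr_gt0// ltr_wpDl.
change (\forall h \near (0 : R)^', schwartz_seminorm m n
  (h^-1 *: (quad a (t + h) - quad a t) - quad (dquad a) t) < e).
near=> h; have h0 : h != 0 by near: h; exact: nbhs_dnbhs_neq.
have -> : h^-1 *: (quad a (t + h) - quad a t) - quad (dquad a) t = h *: a.2.
  rewrite /quad /dquad /= scaler0 addr0.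
  have -> : a.1.1 + (t + h) *: a.1.2 + (t + h) ^+ 2 *: a.2 -
      (a.1.1 + t *: a.1.2 + t ^+ 2 *: a.2) =
      h *: (a.1.2 + (2 * t + h) *: a.2).
    have -> : (t + h) ^+ 2 = t ^+ 2 + h * (2 * t + h) by ring.
    move: (2 * t + h) => s; apply/eqP; rewrite subr_eq !scalerDl scalerDr scalerA [eqbRHS]addrC.
    by rewrite [eqbRHS]addrACA -!addrA.
  rewrite scalerA mulVf// scale1r scalerA opprD addrACA subrr add0r -scalerBl.
  by congr (_ *: _); ring.
apply: le_lt_trans (seminormZ _ _ _ _) _.
apply: (@le_lt_trans _ _ (`|h| * (N + 1))); first by rewrite ler_wpM2l// lerDl.
rewrite -ltr_pdivlMr ?ltr_wpDl//.
by near: h; exact: dnbhs0_lt.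
Unshelve. all: by end_near. Qed.

Lemma quad0 a : quad a 0 = a.1.1.
Proof. by rewrite /quad scale0r expr0n scale0r !addr0. Qed.

(** The derivative of a quadratic curve is again quadratic, so iterating dquad
    produces the derivatives of every order. *)
Lemma quad_smooth (I : set R) a : smooth_curve_on I (quad a).
Proof.
by exists (fun n => quad (iter n dquad a)) => // n t _; rewrite iterS; exact: quad_derivative.
Qed.

End quadratic_curves.

Section exceptional_curve.
Variable R : realType.
Local Notation C := (Rcomplex R).
Local Notation mu := (@lebesgue_measure R).
Implicit Types (t : R).

(** With y = exp(-t), the elementary bounds 1 - t <= y and y (1 + t) <= 1 are
    precise enough. *)
Lemma reflection_taylor t : `|t| <= 2^-1 ->
  `|(expR (- t) - 1) / (expR (- t) + 1) + t / 2| <= t ^+ 2.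
Proof.
set y := expR (- t); rewrite ler_norml => /andP[t1 t2].
have y0 : 0 < y by exact: expR_gt0.
have y1 : 1 - t <= y by exact: expR_ge1Dx.
have y2 : y * (1 + t) <= 1.
  have E : y * expR t = 1 by rewrite /y -expRD addNr expR0.
  by rewrite -[X in _ <= X]E ler_pM2l// expR_ge1Dx.
have -> : (y - 1) / (y + 1) + t / 2 = (y * (1 + t / 2) - 1 + t / 2) / (y + 1).
  by field; rewrite gt_eqF// addr_gt0.
rewrite normrM normfV (gtr0_norm (addr_gt0 y0 ltr01)) ler_pdivrMr ?addr_gt0//.
apply: (@le_trans _ _ (t ^+ 2)); last by rewrite ler_peMr ?sqr_ge0// lerDr ltW.
rewrite ler_norml; apply/andP; split.
  have : (1 - t) * (1 + t / 2) <= y * (1 + t / 2) by rewrite ler_wpM2r//; lra.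
  have := sqr_ge0 t; nra.
have h : (y * (1 + t / 2) - 1 + t / 2) * (1 + t) <= t ^+ 2 / 2.
  have : y * (1 + t) * (1 + t / 2) <= 1 * (1 + t / 2) by rewrite ler_wpM2r//; lra.
  nra.
have p : 0 < 1 + t by lra.
rewrite -(ler_pM2r p); apply: le_trans h _.
by rewrite ler_wpM2l ?sqr_ge0//; lra.
Qed.

Variables (u : R -> R) (x0 : R).
Hypothesis cu : cls (@rd R) u.

(** Moving along the primitive of g1, where v is the linearization applied to g1,
    keeps the ground state bounded and positive; this corrects the line q + e v by
    a term of second order only. *)
Lemma exceptional_curve (v : schwartzType R) : Lambda1 u v = 0 ->
  exists Q : R -> schwartzType R,
   [/\ forall I, smooth_curve_on I Q, Q 0 = pot u^`() :> (R -> R),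
       curve_derivative Q 0 v,
       (forall e, exists w g, [/\ Der w g, cls (@rd R) g, Q e = pot g :> (R -> R),
          exceptional (Q e) & cvg (reflection (Q e) k @[k --> (0 : R)^'])]) &
       (fun e : R => reflection0 (Q e) - real_complex R (e * Lambda2 u x0 v))
              =O_ (0 : R) (fun e : R => e ^+ 2)].
Proof.
move=> v0; have [g1 cg1 vE] := lin_surj cu (schwartz_cls v) v0.
have cg : cls (@rd R) u^`() by exact: cls_derivative.
have [h [hg hNy hy]] := dom_primitive (cls_rd_dom cg1).
set H := \int[mu]_x g1 x in hy.
have ug : Der u u^`() := cls_derive1 cu.
have [q qE] := schwartzK (pot_rd cg).
have [r rE] := schwartzK (cls_rdZ (- 4^-1) (cls_rd_bndM cg1 cg1)).
pose Q := quad (q, v, r).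
have wg e : Der (fun x => u x + e * h x) (fun x => u^`() x + e * g1 x).
  by apply: DerD ug _; apply: Der_eq (DerM (Der_cst e) hg) _ => x; rewrite mul0r add0r.
have cgg e : cls (@rd R) (fun x => u^`() x + e * g1 x).
  by apply: cls_rdD => //; exact: cls_rdZ.
have QE e : Q e = pot (fun x => u^`() x + e * g1 x) :> (R -> R).
  apply/funext => x; rewrite /Q /quad /=.
  change (q x + e * v x + e ^+ 2 * r x = pot (fun x => u^`() x + e * g1 x) x).
  have := Der_derive1 (DerD (cls_derive1 cg) (DerM (Der_cst e) (cls_derive1 cg1))).
  by rewrite qE rE -vE /pot /lin => -> /=; field.
have wNy e : u x + e * h x @[x --> -oo] --> (0 : R).
  rewrite -[X in _ --> X](addr0 0); apply: cvgD; first exact: rd_cvgNy (cls_in cu).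
  by rewrite -[X in _ --> X](mulr0 e); exact: cvgMr.
have wy e : u x + e * h x @[x --> +oo] --> e * H.
  rewrite -[X in _ --> X](add0r (e * H)); apply: cvgD; first exact: rd_cvgy (cls_in cu).
  exact: cvgMr.
have L2 : Lambda2 u x0 v = - (2^-1 * H) by rewrite -vE (Lambda2_lin cu x0 cg1).
exists Q; split.
- by move=> I; exact: quad_smooth.
- by rewrite /Q quad0 qE.
- by have := @quad_derivative R (q, v, r) 0; rewrite quad0.
- move=> e; have [k1 k2] := reflection0E (wg e) (cgg e) (wNy e) (wy e).
  exists (fun x => u x + e * h x), (fun x => u^`() x + e * g1 x).
  rewrite QE; split; [exact: wg|exact: cgg|by []| |exact: k1].
  exact: (pot_exceptional (wg e) (cgg e) (wNy e) (wy e)).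
- have eN : 0 < 2^-1 / (`|H| + 1) by rewrite divr_gt0// ltr_wpDl.
  apply/eqOP; near=> K; near=> e.
  have [k1 k2] := reflection0E (wg e) (cgg e) (wNy e) (wy e).
  rewrite QE k2 L2 -raddfB.
  have -> : e * - (2^-1 * H) = - (e * H / 2) by ring.
  rewrite opprK.
  have -> (z : R) : `|real_complex R z : C| = `|z|.
    by rewrite /Num.norm /= expr0n addr0 sqrtr_sqr.
  apply: (@le_trans _ _ ((e * H) ^+ 2)).
    apply: reflection_taylor; rewrite normrM.
    apply: (@le_trans _ _ (`|e| * (`|H| + 1))); first by rewrite ler_wpM2l// lerDl.
    rewrite -ler_pdivlMr ?ltr_wpDl//; near: e; exact: nbhs0_le eN.
  rewrite exprMn mulrC normrX real_normK ?num_real// ler_wpM2r ?sqr_ge0//.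
Unshelve. all: by end_near. Qed.

End exceptional_curve.

(** * Weak derivatives *)

Section locally_integrable.
Variable R : realType.
Local Notation mu := (@lebesgue_measure R).
Implicit Types (f g a : R -> R).

Definition loc f := locally_integrable setT f.

Lemma loc_meas f : loc f -> measurable_fun setT f. Proof. by case. Qed.

Lemma loc_itv f (M : R) : loc f -> mu.-integrable `[- M, M] (EFin \o f).
Proof.
move=> [mf _ hf]; apply/integrableP; split.
  by apply/measurable_EFinP; exact: measurable_funS mf.
by apply: hf => //; exact: segment_compact.
Qed.

Lemma locI f : measurable_fun setT f ->
  (forall M : R, 0 < M -> mu.-integrable `[- M, M] (EFin \o f)) -> loc f.
Proof.
move=> mf hf; split => // [|K _ cK]; first exact: openT.
have mK : measurable K by exact: compact_measurable.
have [M0 [_ hM]] := compact_bounded cK.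
pose M := `|M0| + 1; have M0' : 0 < M by rewrite ltr_wpDl.
have KM : K `<=` `[- M, M].
  move=> x Kx; rewrite /= in_itv/= -ler_norml; apply: (hM M) => //.
  by rewrite (le_lt_trans (ler_norm _))// ltrDl.
have /integrableP[_] := hf M M0'; apply: le_lt_trans.
apply: ge0_subset_integral => //.
by apply/measurable_EFinP; apply: measurableT_comp => //; exact: measurable_funS mf.
Qed.

Lemma intg_loc f : intg f -> loc f.
Proof. by move=> h; exact: open_integrable_locally openT h. Qed.

Lemma loc_le f g : measurable_fun setT f -> loc g ->
  (forall M : R, exists C, forall x, `|x| <= M -> `|f x| <= C * `|g x|) -> loc f.
Proof.
move=> mf lg h; apply: locI => // M M0; have [C hC] := h M.
have := @integrableZl _ _ _ mu _ (@measurable_itv R `[- M, M]) C _ (loc_itv M lg).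
apply: le_integrable => //.
  by apply/measurable_EFinP; exact: measurable_funS mf.
move=> x; rewrite /= in_itv/= -ler_norml => xM; rewrite lee_fin.
apply: le_trans (hC x xM) _; rewrite normrM.
by rewrite ler_wpM2r// ler_norm.
Qed.

Lemma continuous_itv_bnd a (M : R) : continuous a ->
  exists C, forall x, `|x| <= M -> `|a x| <= C.
Proof.
move=> ca; have [M0|M0] := ltP M 0.
  by exists 0 => x xM; have := le_lt_trans xM M0; rewrite ltNge normr_ge0.
have NM : - M <= M by lra.
have [c _ hc] := @EVT_max _ (fun x => `|a x|) _ _ NM
  (continuous_subspaceT (fun x => cvg_norm (ca x))).
by exists `|a c| => x; rewrite ler_norml => xM; exact: hc.
Qed.

Lemma loc_contM a f : continuous a -> loc f -> loc (fun x => a x * f x).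
Proof.
move=> ca lf; apply: (loc_le _ lf) => [|M].
  by apply: measurable_funM (loc_meas lf); exact: measurable_cont.
have [C hC] := continuous_itv_bnd M ca; exists C => x xM.
by rewrite normrM ler_wpM2r// hC.
Qed.

Lemma loc_cst (c : R) : loc (fun=> c).
Proof.
apply: locI => [|M M0]; first exact: measurable_cst.
exact: (@continuous_integrable_itv _ _ (- M) M (@cst_continuous _ _ c)).
Qed.

Lemma loc_cont a : continuous a -> loc a.
Proof.
move=> ca; have := loc_contM ca (loc_cst 1); congr loc.
by apply/funext => x; rewrite mulr1.
Qed.

Lemma locD f g : loc f -> loc g -> loc (fun x => f x + g x).
Proof. exact: locally_integrableD. Qed.

Lemma locN f : loc f -> loc (fun x => - f x).
Proof. exact: locally_integrableN. Qed.

Lemma locZ c f : loc f -> loc (fun x => c * f x).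
Proof. by move=> lf; apply: loc_contM lf; exact: cst_continuous. Qed.

Lemma loc_cut f (M : R) : loc f -> intg (f \_ `[- M, M]).
Proof.
move=> lf; rewrite /intg -restrict_EFin.
apply/(@integrable_mkcond _ _ _ mu _ _ (@measurable_itv R `[- M, M])).
exact: loc_itv.
Qed.

Lemma loc_cpt f a : loc f -> continuous a -> cpt a -> intg (fun x => f x * a x).
Proof.
move=> lf ca pa; have [C hC] := continuous_cpt_bnd ca pa; have [M hM] := pa.
have := intgM (measurable_cont (D := setT) ca) (ex_intro _ C hC) (loc_cut M lf).
congr intg; apply/funext => x; rewrite patchE mulrC; case: ifPn => // xM.
rewrite [in RHS]hM ?mul0r ?mulr0// ltNge; apply: contra xM => xM.
by rewrite inE /= in_itv/= -ler_norml.
Qed.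

Lemma dominated_cvgR (f_ : (R -> R)^nat) f g :
  (forall n, measurable_fun setT (f_ n)) ->
  (forall x, f_ n x @[n --> \oo] --> f x) ->
  intg g -> (forall n x, `|f_ n x| <= g x) ->
  intg f /\ \int[mu]_x f_ n x @[n --> \oo] --> \int[mu]_x f x.
Proof.
move=> mf_ f_f ig f_g.
have mf : measurable_fun setT f.
  by apply: (measurable_fun_cvg (h := f_)) => // x _; exact: f_f.
have [| | |//| |fi _ c] := @dominated_convergence _ _ _ mu setT measurableT
  (fun n => EFin \o f_ n) (EFin \o f) (EFin \o g).
- by move=> n; apply/measurable_EFinP; exact: mf_.
- exact/measurable_EFinP.
- by apply: aeW => x _; apply: cvg_EFin; [exact: nearW|exact: f_f].
- by apply: aeW => x n _; rewrite /= lee_fin.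
split => //; apply: fine_cvg; rewrite fineK//; exact: integrable_fin_num.
Qed.

End locally_integrable.

Section fundamental_lemma.
Variable R : realType.
Local Notation mu := (@lebesgue_measure R).
Implicit Types (f g h phi : R -> R).

Lemma aeS (P Q : R -> Prop) : (forall x, P x -> Q x) ->
  {ae mu, forall x, P x} -> {ae mu, forall x, Q x}.
Proof.
by move=> PQ [N [mN N0 hN]]; exists N; split => //; apply: subset_trans hN => x nQ p; apply/nQ/PQ.
Qed.

Lemma aeI (P Q : R -> Prop) : {ae mu, forall x, P x} -> {ae mu, forall x, Q x} ->
  {ae mu, forall x, P x /\ Q x}.
Proof.
move=> p q; have := @filterI _ _ (ae_filter_ringOfSetsType mu) _ _ p q.
exact: aeS.
Qed.

Lemma near_nat (y : R) : \forall n \near \oo, y <= n.+1%:R.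
Proof.
near=> n; apply: (@le_trans _ _ n%:R); last by rewrite ler_nat.
by near: n; exact: nbhs_infty_ger.
Unshelve. all: by end_near. Qed.

Lemma cls_any_affine a b f : cls (@anyf R) f -> cls (@anyf R) (fun x => f (a * x + b)).
Proof.
move=> cf; have := @cls_affine R (@anyf R) a b f (fun _ _ _ => I) 1 cf.
by rewrite (_ : (fun x => 1 * _) = fun x => f (a * x + b))//; apply/funext => x; rewrite mul1r.
Qed.

Definition is_step (S : R -> R) := [/\ cls (@bnd R) S, forall x, 0 <= S x <= 1,
  forall x, x <= 0 -> S x = 0 & forall x, 1 <= x -> S x = 1].

(** The primitive of a bump is a smooth step from 0 to 1. *)
Lemma exists_step : exists S, is_step S.
Proof.
have [b [cb b0 b1 bs]] := @exists_bump R.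
have [S [Sb S0 S1]] := dom_primitive (cls_rd_dom (cls_cpt_rd cb)).
rewrite b1 in S1; have Sh := Der_homo Sb b0.
have S_ge0 x : 0 <= S x.
  apply: (ler_cvg_to S0 (cvg_cst (S x))); near=> y; apply: Sh.
  by near: y; apply: nbhs_ninfty_le; exact: num_real.
have S_le1 x : S x <= 1.
  apply: (ler_cvg_to (cvg_cst (S x)) S1); near=> y; apply: Sh.
  by near: y; apply: nbhs_pinfty_ge; exact: num_real.
exists S; split.
- apply: (clsI _ Sb (cls_rd_bnd (cls_cpt_rd cb))).
  by exists 1 => x; rewrite ger0_norm.
- by move=> x; rewrite S_ge0 S_le1.
- move=> x x0; rewrite -[LHS]subr0; apply/eqP; rewrite -normr_le0.
  apply: le_trans (@dom_boundNy _ _ _ 0 0 x Sb _ S0) _; last by rewrite mul0r.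
  by move=> y yx; rewrite bs ?normr0 ?mul0r// (le_trans yx x0).
- move=> x x1; apply/eqP; rewrite -subr_eq0 -normr_le0.
  apply: le_trans (@dom_boundy _ _ _ 1 0 x Sb _ S1) _; last by rewrite mul0r.
  by move=> y yx; rewrite bs ?normr0 ?mul0r// (le_trans x1 yx) orbT.
Unshelve. all: by end_near. Qed.

Lemma Der_locally0 f df (D : set R) c : Der f df -> open D ->
  (forall x, D x -> f x = c) -> forall x, D x -> df x = 0.
Proof.
move=> fd oD f0 x Dx.
have h : is_derive x (1 : R) f 0.
  apply: (@near_eq_is_derive R R R (fun=> c) f x 1 0).
  by near=> y; rewrite f0//; near: y; exact: open_nbhs_nbhs.
have [_ e1] := fd x; have [_ e2] := h; by rewrite -e1 -e2.
Unshelve. all: by end_near. Qed.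

Section step.
Variable S : R -> R.
Hypothesis stepS : is_step S.

Lemma step_der : Der S S^`().
Proof. by case: stepS => cS _ _ _; exact: cls_derive1 cS. Qed.

Lemma step_derive0 x : x < 0 -> S^`() x = 0.
Proof.
case: stepS => _ _ S0 _.
by apply: (@Der_locally0 S _ [set x | x < 0] 0 step_der (@open_lt R 0)) => y /= /ltW; exact: S0.
Qed.

Lemma step_derive_cpt : cls (@cpt R) S^`().
Proof.
case: stepS => cS _ S0 S1.
apply/test_functionP; split; first by apply/smoothE; apply: cls_any; exact: cls_derivative cS.
exists 1 => x; rewrite lter_normr => /orP[h|h]; last by apply: step_derive0; lra.
apply: (@Der_locally0 S _ [set x | 1 < x] 1 step_der (@open_gt R 1)) => // y /= /ltW.
exact: S1.
Qed.

Lemma integral_step_derive : \int[mu]_x S^`() x = 1.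
Proof.
case: stepS => cS _ S0 S1.
have S0' : S x @[x --> -oo] --> (0 : R).
  by apply: cvg_near_cst; near=> x; apply: S0; near: x; apply: nbhs_ninfty_le; exact: num_real.
have S1' : S x @[x --> +oo] --> (1 : R).
  by apply: cvg_near_cst; near=> x; apply: S1; near: x; apply: nbhs_pinfty_ge; exact: num_real.
by rewrite (dom_integral step_der (cls_rd_dom (cls_cpt_rd step_derive_cpt)) S0' S1') subr0.
Unshelve. all: by end_near. Qed.

(** Translates of T, or of its reflection; if T vanishes on the negative half line
    they escape to infinity with n. *)
Definition tail (T : R -> R) (s : R) : nat -> R -> R := fun n x => T (s * x + - n%:R).

Lemma Der_tail T dT s n : Der T dT -> Der (tail T s n) (tail (fun x => s * dT x) s n).
Proof.
move=> TD; have aff : Der (fun x => s * x + - n%:R) (fun=> s) by der; ring.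
by apply: Der_eq (Der_comp TD aff) _ => x; rewrite mulrC.
Qed.

Lemma tail_lt T s : `|s| = 1 -> (forall x, x < 0 -> T x = 0) ->
  forall n x, `|x| < n%:R -> tail T s n x = 0.
Proof.
move=> s1 T0 n x xn; apply: T0; rewrite subr_lt0; apply: le_lt_trans (ler_norm _) _.
by rewrite normrM s1 mul1r.
Qed.

Lemma tail_smooth T s n : cls (@anyf R) T -> cls (@anyf R) (tail T s n).
Proof. exact: cls_any_affine. Qed.

(** Written with steps of both orientations, the derivative of the cutoff is again a
    combination of tails. *)
Definition cutoff n x : R := 1 + -1 * tail S 1 n x + -1 * tail S (-1) n x.

Lemma Der_cutoff n :
  Der (cutoff n) (fun x => -1 * tail S^`() 1 n x + tail S^`() (-1) n x).
Proof.
have D1 := Der_tail 1 n step_der; have D2 := Der_tail (-1) n step_der.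
apply: Der_eq (DerD (DerD (Der_cst 1) (DerM (Der_cst (-1)) D1)) (DerM (Der_cst (-1)) D2)) _ => x.
by rewrite /tail; ring.
Qed.

Lemma cutoff_cpt n : cls (@cpt R) (cutoff n).
Proof.
case: stepS => cS _ S0 S1.
have cT s : cls (@anyf R) (fun x => -1 * tail S s n x).
  apply: cls_anyM; first exact: (cls_cst (P := @anyf R)).
  by apply: tail_smooth; exact: cls_any cS.
have /smoothE sm : cls (@anyf R) (cutoff n).
  by apply: clsD => //; apply: clsD => //; exact: (cls_cst (P := @anyf R)).
apply/test_functionP; split => //; exists n.+1%:R => x; rewrite -natr1 /cutoff /tail.
have := ler0n R n; rewrite lter_normr => n0 /orP[h|h].
  by rewrite (S1 (1 * x + - n%:R)) ?(S0 (-1 * x + - n%:R)); lra.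
by rewrite (S1 (-1 * x + - n%:R)) ?(S0 (1 * x + - n%:R)); lra.
Qed.

Lemma cutoff_lt n x : `|x| < n%:R -> cutoff n x = 1.
Proof.
case: stepS => _ _ S0 _ xn; have S0' y : y < 0 -> S y = 0 by move=> /ltW; exact: S0.
have s2 : `|-1 : R| = 1 by rewrite normrN normr1.
by rewrite /cutoff (tail_lt (normr1 R) S0' xn) (tail_lt s2 S0' xn); ring.
Qed.

Lemma cutoff_bnd n x : `|cutoff n x| <= 3.
Proof.
case: stepS => _ S01 _ _; have /andP[h1 h2] := S01 (1 * x + - n%:R).
have /andP[h3 h4] := S01 (-1 * x + - n%:R).
by rewrite /cutoff /tail ler_norml; apply/andP; split; lra.
Qed.

End step.

(** Testing against smooth approximations of the indicator of an interval shows that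
    the primitive of h is constant, and h is its derivative almost everywhere. *)
Lemma fundamental_lemma_intg h : intg h ->
  (forall phi, cls (@cpt R) phi -> \int[mu]_x (h x * phi x) = 0) -> h = cst 0 %[ae mu].
Proof.
move=> ih h0; have [S [cS S01 S0 S1]] := exists_step.
have itv0 (a b : R) : a < b -> \int[mu]_(x in `]a, b]) h x = 0.
  move=> ab; pose phi (n : nat) x := S (n.+1%:R * x + - (n.+1%:R * a)) *
                                    S (- n.+1%:R * x + (n.+1%:R * b + 1)).
  have n0 (n : nat) : 0 < n.+1%:R :> R by rewrite ltr0n.
  have phi_bnd n x : `|phi n x| <= 1.
    have /andP[h1 h2] := S01 (n.+1%:R * x + - (n.+1%:R * a)).
    have /andP[h3 h4] := S01 (- n.+1%:R * x + (n.+1%:R * b + 1)).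
    by rewrite ger0_norm ?mulr_ge0// mulr_ile1.
  have cphi n : cls (@cpt R) (phi n).
    have /smoothE sm : cls (@anyf R) (phi n).
      by apply: cls_anyM; apply: cls_any_affine; exact: cls_any cS.
    apply/test_functionP; split => //; exists (`|a| + `|b| + 1) => x.
    have := ler_norm (- a); rewrite normrN => a1; have b1 := ler_norm b.
    have := normr_ge0 a; have := normr_ge0 b => b2 a2.
    rewrite lter_normr /phi => /orP[hx|hx].
      have : n.+1%:R * (b + 1) <= n.+1%:R * x by rewrite ler_pM2l//; lra.
      have : 1 <= n.+1%:R :> R by rewrite ler1n.
      by move=> hn; rewrite mulrDr mulr1 => hh; rewrite [X in _ * X]S0 ?mulr0//; lra.
    have : n.+1%:R * x <= n.+1%:R * a by rewrite ler_pM2l//; lra.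
    by move=> hh; rewrite S0 ?mul0r//; lra.
  have lim x : phi n x @[n --> \oo] --> ((x \in `]a, b])%:R : R).
    have [xa|ax] := leP x a.
      rewrite in_itv/= ltNge xa/=; apply: (cvg_eqfun (f := cst 0)); last exact: cvg_cst.
      move=> n; have : n.+1%:R * x <= n.+1%:R * a by rewrite ler_pM2l.
      by move=> hh; rewrite /phi S0 ?mul0r//; lra.
    have [bx|xb] := ltP b x.
      rewrite in_itv/= leNgt bx/= andbF; apply: (@cvg_near_cst); near=> n.
      have : 1 <= n.+1%:R * (x - b).
        rewrite -ler_pdivrMr ?subr_gt0//; near: n; exact: near_nat.
      by rewrite mulrBr => hh; rewrite /phi [X in _ * X]S0 ?mulr0//; lra.
    rewrite in_itv/= ax xb; apply: (@cvg_near_cst); near=> n.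
    have h1 : 1 <= n.+1%:R * (x - a).
      rewrite -ler_pdivrMr ?subr_gt0//; near: n; exact: near_nat.
    have h2 : n.+1%:R * x <= n.+1%:R * b by rewrite ler_pM2l.
    by rewrite /phi !S1 ?mulr1//; rewrite mulrBr in h1; lra.
  have bb n x : `|h x * phi n x| <= `|h x| by rewrite normrM ler_piMr.
  have [_ c] := @dominated_cvgR R (fun n x => h x * phi n x)
    (fun x => h x * (x \in `]a, b])%:R) (fun x => `|h x|)
    (fun n => measurable_funM (intg_meas ih) (measurable_cont (cls_continuous (cphi n))))
    (fun x => cvgMr (lim x)) (intg_norm ih) bb.
  rewrite Rintegral_mkcond.
  have : \int[mu]_x (h x * phi n x) @[n --> \oo] --> (0 : R).
    by apply: (cvg_eqfun (f := cst 0)); [move=> n; rewrite h0|exact: cvg_cst].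
  have -> : h \_ `]a, b] = (fun x => h x * (x \in `]a, b])%:R).
    apply/funext => x; rewrite patchE mem_setE.
    by case: ifP => _; rewrite ?mulr1 ?mulr0.
  by move=> c0; apply: (cvg_unique _ c c0).
have lE x y : lint h x = lint h y.
  wlog xy : x y / x < y => [W|].
    by have [xy|xy|->//] := ltgtP x y; [exact: W|apply/esym; exact: W].
  have hy : mu.-integrable `]-oo, y] (EFin \o h).
    exact: (@integrableS _ _ _ mu setT `]-oo, y] _ measurableT (measurable_itv _) (@subsetT _ _) ih).
  apply/esym/eqP; rewrite -subr_eq0; apply/eqP.
  have := @Rintegral_itvB _ h -oo%O (BRight y) x hy isT.
  by rewrite bnd_simp => /(_ (ltW xy)) ->; exact: itv0.
have [|N [mN N0 hN]] := FTC1Ny _ (intg_loc ih).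
  move=> y.
  exact: (@integrableS _ _ _ mu setT `]-oo, y] _ measurableT (measurable_itv _) (@subsetT _ _) ih).
exists N; split => //; apply: subset_trans hN => x /= hx [_ D]; apply: hx => _.
rewrite -D (_ : (fun x => _) = lint h)// (_ : lint h = cst (lint h 0)) ?derive1_cst//.
by apply/funext => z; exact: lE.
Unshelve. all: by end_near. Qed.

(** Multiplying by cutoffs reduces to the integrable case. *)
Lemma fundamental_lemma f : loc f ->
  (forall phi, cls (@cpt R) phi -> \int[mu]_x (f x * phi x) = 0) -> f = cst 0 %[ae mu].
Proof.
move=> lf f0; have [S stepS] := exists_step; pose X := cutoff S.
have : {ae mu, forall x, forall n, f x * X n x = 0}.
  apply: ae_foralln => n; have cX : cls (@cpt R) (X n) by exact: cutoff_cpt.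
  have : (fun x => f x * X n x) = cst 0 %[ae mu].
    apply: fundamental_lemma_intg.
      by apply: loc_cpt => //; [exact: cls_continuous cX|exact: cls_in cX].
    move=> phi cphi; rewrite -[RHS](f0 (fun x => X n x * phi x)).
      by congr Rintegral; apply/funext => x; rewrite mulrA.
    by apply: cls_cptM => //; exact: cls_any cX.
  by apply: aeS => x; exact.
apply: aeS => x fX _; have [n xn] := exists_nat_gt `|x|.
by have := fX n; rewrite /X cutoff_lt// mulr1.
Qed.

End fundamental_lemma.

Section weak_derivative.
Variable R : realType.
Local Notation mu := (@lebesgue_measure R).
Local Notation wd := (@is_weak_derivative R).
Implicit Types (f g h phi : R -> R) (i j : nat).

Lemma eq_Rintegral_ae f g : measurable_fun setT f -> measurable_fun setT g ->
  f = g %[ae mu] -> \int[mu]_x f x = \int[mu]_x g x.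
Proof.
move=> mf mg fg; rewrite /Rintegral; congr fine.
apply: ae_eq_integral => //; [exact/measurable_EFinP|exact/measurable_EFinP|].
by apply: aeS fg => x h _; rewrite h.
Qed.

Lemma RintD f g : intg f -> intg g ->
  \int[mu]_x (f x + g x) = \int[mu]_x f x + \int[mu]_x g x.
Proof. by move=> i1 i2; rewrite -(@RintegralD _ _ _ mu setT f g measurableT i1 i2). Qed.

Lemma RintB f g : intg f -> intg g ->
  \int[mu]_x (f x - g x) = \int[mu]_x f x - \int[mu]_x g x.
Proof. by move=> i1 i2; rewrite -(@RintegralB _ _ _ mu setT f g measurableT i1 i2). Qed.

Lemma RintZ c f : intg f -> \int[mu]_x (c * f x) = c * \int[mu]_x f x.
Proof. by move=> i1; rewrite (@RintegralZl _ _ _ mu setT f c measurableT i1). Qed.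

Lemma RintN f : intg f -> \int[mu]_x (- f x) = - \int[mu]_x f x.
Proof.
move=> i1; rewrite -mulN1r -RintZ//; congr Rintegral.
by apply/funext => x; rewrite mulN1r.
Qed.

Lemma loc_test f phi : loc f -> cls (@cpt R) phi -> intg (fun x => f x * phi x).
Proof.
by move=> lf cp; apply: loc_cpt => //; [exact: cls_continuous cp|exact: cls_in cp].
Qed.

Lemma wd_loc j f g : wd j f g -> loc g. Proof. by case. Qed.

Lemma wd_test j f g phi : wd j f g -> cls (@cpt R) phi ->
  \int[mu]_x (f x * phi^`(j) x) = (-1) ^+ j * \int[mu]_x (g x * phi x).
Proof. by move=> [_ h] /test_functionP; exact: h. Qed.

Lemma wdI j f g : loc g -> (forall phi, cls (@cpt R) phi ->
  \int[mu]_x (f x * phi^`(j) x) = (-1) ^+ j * \int[mu]_x (g x * phi x)) -> wd j f g.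
Proof. by move=> lg h; split=> // phi /test_functionP; exact: h. Qed.

Lemma wd_uniq j f g h : wd j f g -> wd j f h -> g = h %[ae mu].
Proof.
move=> dg dh; have lg := wd_loc dg; have lh := wd_loc dh.
have : (fun x => g x + - h x) = cst 0 %[ae mu].
  apply: fundamental_lemma => [|phi cp]; first by apply: locD => //; exact: locN.
  have -> : \int[mu]_x ((g x + - h x) * phi x) =
      \int[mu]_x (g x * phi x - h x * phi x).
    by congr Rintegral; apply/funext => x; rewrite mulrBl.
  rewrite RintB; [|exact: loc_test|exact: loc_test].
  apply/eqP; rewrite subr_eq0; apply/eqP.
  have := wd_test dg cp; rewrite (wd_test dh cp) => /(congr1 ( *%R ((-1) ^+ j))).
  by rewrite !mulrA -!expr2 !sqrr_sign !mul1r.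
by apply: aeS => x H xT; apply/eqP; rewrite -subr_eq0; apply/eqP; exact: H.
Qed.

Lemma weak_derivativeP j f g : wd j f g ->
  wd j f (weak_derivative j f) /\ weak_derivative j f = g %[ae mu].
Proof.
move=> dg; have h : wd j f (weak_derivative j f) by exact: (@xgetPex _ _ (wd j f) (ex_intro _ g dg)).
by split => //; exact: wd_uniq h dg.
Qed.

Lemma wd0 f : loc f -> wd 0 f f.
Proof. by move=> lf; apply: wdI => // phi cp; rewrite expr0 mul1r. Qed.

Lemma derive1n_comp i j phi : phi^`(i + j) = (phi^`(j))^`(i).
Proof. by rewrite /derive1n iterD. Qed.

Lemma wd_add i j f g h : wd i f g -> wd j g h -> wd (i + j) f h.
Proof.
move=> dg dh; apply: wdI => [|phi cp]; first exact: wd_loc dh.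
rewrite derive1n_comp (wd_test dg (cls_iter j cp)) (wd_test dh cp).
by rewrite mulrA -exprD.
Qed.

Lemma wd_sub i j f g h : wd i f g -> wd (i + j) f h -> wd j g h.
Proof.
move=> dg dh; apply: wdI => [|phi cp]; first exact: wd_loc dh.
have := wd_test dh cp; rewrite derive1n_comp (wd_test dg (cls_iter j cp)).
move=> /(congr1 ( *%R ((-1) ^+ i))); rewrite exprD !mulrA -!expr2 !sqrr_sign !mul1r.
by [].
Qed.

Lemma wd_aer j f g g' : loc g' -> g = g' %[ae mu] -> wd j f g -> wd j f g'.
Proof.
move=> lg gg dg; apply: wdI => // phi cp; rewrite (wd_test dg cp); congr (_ * _).
apply: eq_Rintegral_ae.
- exact: intg_meas (loc_test (wd_loc dg) cp).
- exact: intg_meas (loc_test lg cp).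
- by apply: aeS gg => x h xT; rewrite h.
Qed.

Lemma wdD j f1 f2 g1 g2 : loc f1 -> loc f2 -> wd j f1 g1 -> wd j f2 g2 ->
  wd j (fun x => f1 x + f2 x) (fun x => g1 x + g2 x).
Proof.
move=> l1 l2 d1 d2; have m1 := wd_loc d1; have m2 := wd_loc d2.
apply: wdI => [|phi cp]; first exact: locD.
have cj := cls_iter j cp.
have D (a b p : R -> R) : (fun x => (a x + b x) * p x) = (fun x => a x * p x + b x * p x).
  by apply/funext => x; rewrite mulrDl.
rewrite !D !RintD ?mulrDr; [|exact: loc_test..].
by rewrite (wd_test d1 cp) (wd_test d2 cp).
Qed.

Lemma wdZ j c f g : loc f -> wd j f g -> wd j (fun x => c * f x) (fun x => c * g x).
Proof.
move=> lf d; have lg := wd_loc d.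
apply: wdI => [|phi cp]; first exact: locZ.
have D (a p : R -> R) : (fun x => c * a x * p x) = (fun x => c * (a x * p x)).
  by apply/funext => x; rewrite mulrA.
rewrite !D !RintZ; [|exact: loc_test|exact: loc_test (cls_iter j cp)].
by rewrite (wd_test d cp) mulrCA.
Qed.

Lemma wdM a f g : cls (@anyf R) a -> loc f -> wd 1 f g ->
  wd 1 (fun x => a x * f x) (fun x => a^`() x * f x + a x * g x).
Proof.
move=> ca lf d; have lg := wd_loc d; have cda := cls_derivative ca.
apply: wdI => [|phi cp].
  by apply: locD; apply: loc_contM => //; [exact: cls_continuous cda|exact: cls_continuous ca].
have cap : cls (@cpt R) (fun x => a x * phi x) by exact: cls_cptM.
have cdap : cls (@cpt R) (fun x => a^`() x * phi x) by exact: cls_cptM.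
have E := Der_derive1 (DerM (cls_derive1 ca) (cls_derive1 cp)).
have := wd_test d cap; rewrite !derive1n1 E expr1 !mulN1r => H.
have i1 : intg (fun x => f x * (a^`() x * phi x + a x * phi^`() x)).
  by have := cls_derivative cap; rewrite E; exact: loc_test.
have -> : (fun x => a x * f x * phi^`() x) =
    (fun x => f x * (a^`() x * phi x + a x * phi^`() x) - f x * (a^`() x * phi x)).
  by apply/funext => x; ring.
rewrite RintB//; last exact: loc_test.
have -> : (fun x => (a^`() x * f x + a x * g x) * phi x) =
    (fun x => f x * (a^`() x * phi x) + g x * (a x * phi x)).
  by apply/funext => x; ring.
rewrite RintD; [|exact: loc_test|exact: loc_test].
by rewrite H opprD addrC.
Qed.

Lemma integral_Der_cpt F f : Der F f -> continuous f -> cpt F -> cpt f ->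
  \int[mu]_x f x = 0.
Proof.
move=> Ff cf pF pf; have rf := cpt_rd (continuous_cpt_bnd cf pf) pf.
have rF := cpt_rd (continuous_cpt_bnd (Der_continuous Ff) pF) pF.
by rewrite (dom_integral Ff (rd_dom cf rf) (rd_cvgNy rF) (rd_cvgy rF)) subrr.
Qed.

Lemma wd_Der F f : Der F f -> continuous f -> wd 1 F f.
Proof.
move=> Ff cf; apply: wdI => [|phi cp]; first exact: loc_cont.
have dp := cls_derive1 cp; have cdp := cls_derivative cp.
have cc : continuous (fun x : R => f x * phi x + F x * phi^`() x).
  move=> x; apply: cvgD; first by apply: cvgM; [exact: cf|exact: (cls_continuous cp)].
  by apply: cvgM; [exact: (Der_continuous Ff)|exact: (cls_continuous cdp)].
have := integral_Der_cpt (DerM Ff dp).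
rewrite RintD; last first.
- by apply: loc_test => //; apply: loc_cont; exact: Der_continuous Ff.
- by apply: loc_test => //; exact: loc_cont.
rewrite derive1n1 expr1 mulN1r => H; apply/eqP; rewrite -addr_eq0 addrC; apply/eqP; apply: H.
- exact: cc.
- have [M hM] := cls_in cp; by exists M => x /hM ->; rewrite mulr0.
- have [M hM] := cls_in cp; have [N hN] := cls_in cdp.
  exists (Num.max M N) => x; rewrite gt_max => /andP[/hM -> /hN ->].
  by rewrite !mulr0 addr0.
Qed.

(** A function annihilating all derivatives of test functions only sees their
    integral, hence is constant. *)
Lemma du_bois_reymond f : loc f ->
  (forall phi, cls (@cpt R) phi -> \int[mu]_x (f x * phi^`() x) = 0) ->
  exists c : R, f = cst c %[ae mu].
Proof.
move=> lf f0; have [b [cb _ b1 _]] := @exists_bump R.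
pose c := \int[mu]_x (f x * b x); exists c.
have : (fun x => f x + - c) = cst 0 %[ae mu].
  apply: fundamental_lemma => [|phi cp]; first by apply: locD => //; exact: loc_cst.
  pose I := \int[mu]_x phi x.
  have ip : intg phi by exact: dom_intg (cls_rd_dom (cls_cpt_rd cp)).
  have ib : intg b by exact: dom_intg (cls_rd_dom (cls_cpt_rd cb)).
  have ceta : cls (@cpt R) (fun x => phi x + - I * b x).
    apply: clsD => //; first exact: cptD.
    by apply: cls_cptM => //; exact: (cls_cst (P := @anyf R)).
  have [F dF cF] : exists2 F, Der F (fun x => phi x + - I * b x) & cls (@cpt R) F.
    apply: cpt_primitive ceta _; rewrite RintD ?RintZ ?b1//; last exact: intgZ.
    by rewrite mulr1 subrr.
  have := f0 F cF; rewrite (Der_derive1 dF).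
  have -> : (fun x => f x * (phi x + - I * b x)) =
    (fun x => f x * phi x + - I * (f x * b x)) by apply/funext => x; ring.
  rewrite RintD; [|exact: loc_test|by apply: intgZ; exact: loc_test].
  rewrite RintZ; last exact: loc_test.
  have -> : (fun x => (f x + - c) * phi x) = (fun x => f x * phi x + - c * phi x).
    by apply/funext => x; ring.
  rewrite RintD; [|exact: loc_test|by exact: intgZ].
  by rewrite RintZ// -/I -/c => <-; congr (_ + _); ring.
by apply: aeS => x H xT; apply/eqP; rewrite -subr_eq0; apply/eqP; exact: H.
Qed.

Lemma wd_zero f : loc f -> wd 1 f (cst 0) -> exists c : R, f = cst c %[ae mu].
Proof.
move=> lf d; apply: du_bois_reymond => // phi cp.
have := wd_test d cp; rewrite derive1n1 => ->.
have -> : (fun x => cst 0 x * phi x) = (fun=> 0 : R) by apply/funext => x; rewrite mul0r.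
by rewrite Rintegral_cst// mul0r mulr0.
Qed.

End weak_derivative.

Section primitive.
Variable R : realType.
Local Notation mu := (@lebesgue_measure R).
Local Notation wd := (@is_weak_derivative R).
Implicit Types (f g h phi : R -> R).

Lemma intg_itv f (i : interval R) : intg f -> mu.-integrable [set` i] (EFin \o f).
Proof.
exact: (@integrableS _ _ _ mu setT [set` i] _ measurableT (measurable_itv _) (@subsetT _ _)).
Qed.

Lemma lint_itv f (x y : R) : intg f -> x <= y ->
  lint f y - lint f x = \int[mu]_(t in `[x, y]) f t.
Proof.
move=> fi xy; have := @Rintegral_itvB _ f -oo%O (BRight y) x (intg_itv `]-oo, y] fi) isT.
rewrite bnd_simp => /(_ xy) ->; apply: Rintegral_itv_obnd_cbnd.
exact: (intg_itv `]x, y]).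
Qed.

Lemma continuous_lint f : intg f -> continuous (lint f).
Proof.
move=> fi x; have x1 : x - 1 < x + 1 by lra.
have := parameterized_integral_continuous (ltW x1) (intg_itv `[x - 1, x + 1] fi).
move/within_continuous_continuous => /(_ x x1).
rewrite in_itv/= => /(_ _); have -> : x - 1 < x < x + 1 by apply/andP; split; lra.
move=> /(_ isT) c; have e y : x - 1 <= y ->
    parameterized_integral mu (x - 1) y f + lint f (x - 1) = lint f y.
  by move=> xy; rewrite /parameterized_integral -lint_itv// subrK.
have H : parameterized_integral mu (x - 1) y f + lint f (x - 1) @[y --> x] --> lint f x.
  by rewrite -(e x); [apply: cvgD; [exact: c|exact: cvg_cst]|lra].
apply: cvg_trans H; apply: near_eq_cvg; near=> y; rewrite e//.
by apply: ltW; near: y; apply: lt_nbhsr; lra.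
Unshelve. all: by end_near. Qed.

Lemma integral_EFin f : intg f -> (\int[mu]_x (f x)%:E = (\int[mu]_x f x)%:E)%E.
Proof. by move=> fi; rewrite /Rintegral fineK//; exact: integrable_fin_num. Qed.

Let tri (x t : R) : R := if t <= x then 1 else 0.

Lemma tri_measurable : measurable_fun setT (fun z : R * R => tri z.1 z.2).
Proof.
have m : measurable [set z : R * R | z.2 <= z.1].
  have := @measurable_fun_ler _ _ R setT snd fst measurable_snd measurable_fst.
  move=> /(_ measurableT [set true] I); rewrite setTI.
  by congr measurable; apply/seteqP; split => z.
rewrite (_ : (fun z => _) = \1_[set z : R * R | z.2 <= z.1]); first exact: measurable_indic.
apply/funext => z; rewrite indicE /tri; case: ifPn => tz; first by rewrite mem_set.
by rewrite memNset//; exact/negP.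
Qed.

Lemma intg_tri f x : intg f -> intg (fun t => f t * tri x t) /\
  \int[mu]_t (f t * tri x t) = lint f x.
Proof.
move=> fi; have E : (fun t => f t * tri x t) = f \_ `]-oo, x].
  by apply/funext => t; rewrite patchE mem_setE in_itv/= /tri; case: ifP; rewrite ?mulr1 ?mulr0.
rewrite E /lint -Rintegral_mkcond; split => //.
rewrite /intg -restrict_EFin; apply/(@integrable_mkcond _ _ _ mu _ _ (@measurable_itv R `]-oo, x])).
exact: intg_itv.
Qed.

Lemma intg_triC f t : intg f -> intg (fun x => f x * tri x t) /\
  \int[mu]_x (f x * tri x t) = \int[mu]_x f x - lint f t.
Proof.
move=> fi; have E : (fun x => f x * tri x t) = f \_ `[t, +oo[.
  by apply/funext => x; rewrite patchE mem_setE in_itv/= andbT /tri; case: ifP; rewrite ?mulr1 ?mulr0.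
rewrite E -Rintegral_mkcond; split.
  rewrite /intg -restrict_EFin; apply/(@integrable_mkcond _ _ _ mu _ _ (@measurable_itv R `[t, +oo[)).
  exact: intg_itv.
have := @Rintegral_itvB _ f -oo%O +oo%O t; rewrite set_itvE => /(_ fi isT isT) ->.
by rewrite Rintegral_itv_obnd_cbnd//; exact: (intg_itv `]t, +oo[).
Qed.

(** Integration by parts for a merely integrable h, by exchanging the order of
    integration over the half plane t <= x. *)
Lemma wd_lint h : intg h -> wd 1 (lint h) h.
Proof.
move=> hi; apply: wdI => [|phi cp]; first exact: intg_loc.
rewrite derive1n1 expr1 mulN1r; set p := phi^`().
have cdp : cls (@cpt R) p by exact: cls_derivative.
have ip : intg p by exact: dom_intg (cls_rd_dom (cls_cpt_rd cdp)).
have [phiNy phiy] := rd_cvg0 (cls_in (cls_cpt_rd cp)).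
have p0 : \int[mu]_x p x = 0.
  by rewrite (dom_integral (cls_derive1 cp) (cls_rd_dom (cls_cpt_rd cdp)) phiNy phiy) subrr.
have lp t : lint p t = phi t.
  have [lp lNy _] := lintP (cls_rd_dom (cls_cpt_rd cdp)).
  have [c hc] := Der_diff lp (cls_derive1 cp).
  suff c0 : c = 0 by rewrite hc c0 addr0.
  have H : lint p x - phi x @[x --> -oo] --> (0 - 0 : R) by apply: cvgB.
  rewrite -(subr0 (0 : R)); apply: (cvg_unique _ _ H) => //.
  by apply: (cvg_eqfun (f := cst c)); [move=> x; rewrite /= hc addrC addKr|exact: cvg_cst].
pose k (z : R * R) : \bar R := (p z.1 * (h z.2 * tri z.1 z.2))%:E.
have mk : measurable_fun setT k.
  apply/measurable_EFinP; apply: measurable_funM.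
    by apply: measurableT_comp measurable_fst; exact: intg_meas.
  apply: measurable_funM tri_measurable.
  by apply: measurableT_comp measurable_snd; exact: intg_meas.
have ht x : intg (fun t => p x * (h t * tri x t)) /\
    \int[mu]_t (p x * (h t * tri x t)) = p x * lint h x.
  by have [h1 h2] := intg_tri x hi; split; [exact: intgZ|rewrite RintZ// h2].
have hx t : intg (fun x => p x * (h t * tri x t)) /\
    \int[mu]_x (p x * (h t * tri x t)) = - (h t * phi t).
  have [h1 h2] := intg_triC t ip.
  have -> : (fun x => p x * (h t * tri x t)) = (fun x => h t * (p x * tri x t)).
    by apply/funext => x; rewrite mulrCA.
  by split; [exact: intgZ|rewrite RintZ// h2 p0 lp sub0r mulrN].
have ik : (mu \x mu)%E.-integrable setT k.
  apply/integrable12ltyP => //.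
  have nh := intg_norm hi.
  have -> : (fun x => \int[mu]_t `|k (x, t)|)%E =
      (fun x => (lint (fun t => `|h t|) x * `|p x|)%:E).
    apply/funext => x; have [h1 h2] := intg_tri x nh.
    rewrite -h2 mulrC -RintZ// -integral_EFin; last exact: intgZ.
    apply: eq_integral => t _; rewrite /k /= !normrM /tri.
    by case: ifP; rewrite ?normr1 ?normr0.
  rewrite integral_EFin ?ltry//; apply: loc_cpt.
  - by apply: loc_cont; exact: continuous_lint.
  - by move=> x; apply: cvg_norm; exact: (cls_continuous cdp).
  - by have [M hM] := cls_in cdp; exists M => x /hM ->; rewrite normr0.
have := @Fubini _ _ _ _ R mu mu k ik.
have -> : (fun x => \int[mu]_t k (x, t))%E = (fun x => (lint h x * p x)%:E).
  by apply/funext => x; rewrite /k /= integral_EFin ?(proj2 (ht x)) ?(proj1 (ht x))// mulrC.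
have -> : (fun t => \int[mu]_x k (x, t))%E = (fun t => (- (h t * phi t))%:E).
  by apply/funext => t; rewrite /k /= integral_EFin ?(proj2 (hx t)) ?(proj1 (hx t)).
rewrite integral_EFin; last first.
  by apply: loc_test => //; apply: loc_cont; exact: continuous_lint.
have ihp : intg (fun t => h t * phi t) by apply: loc_test => //; exact: intg_loc.
rewrite integral_EFin; last exact: intgN.
by rewrite RintN// => -[].
Qed.

End primitive.

Section continuous_representative.
Variable R : realType.
Local Notation mu := (@lebesgue_measure R).
Local Notation wd := (@is_weak_derivative R).
Implicit Types (f g h phi P : R -> R).

(** Otherwise the integral of |h| would be at least k n for every n. *)
Lemma intg_lower_bound h (k : R) : intg h ->
  (forall n : nat, exists a : R,
    {ae mu, forall x, a <= x <= a + n%:R -> k <= `|h x|}) -> k <= 0.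
Proof.
move=> hi H; rewrite leNgt; apply/negP => k0.
pose I := \int[mu]_x `|h x|.
have [n hn] := exists_nat_gt (I / k); have [a ha] := H n.
have : k * n%:R <= I.
  rewrite -lee_fin -integral_EFin; last exact: intg_norm.
  have h1 : ((k * n%:R)%:E <= \int[mu]_(x in `[a, (a + n%:R)%R]) `|h x|%:E)%E.
    have -> : (k * n%:R)%:E = (\int[mu]_(x in `[a, (a + n%:R)%R]) (k%:E : \bar R))%E.
      have e : (mu `[a, (a + n%:R)%R] = n%:R%:E)%E.
        rewrite lebesgue_measure_itv/= lte_fin.
        case: ifPn => [_|]; first by rewrite -EFinB addrC addKr.
        rewrite -leNgt gerDl => n0.
        by congr EFin; apply/eqP; rewrite eq_le n0 ler0n.
      by rewrite integral_cst//= e EFinM.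
    apply: ae_ge0_le_integral => //.
    - by move=> x _; rewrite lee_fin ltW.
    - apply/measurable_EFinP; apply: measurable_funS (intg_meas (intg_norm hi)) => //.
  apply: (le_trans h1); apply: ge0_subset_integral => //.
  by apply/measurable_EFinP; exact: intg_meas (intg_norm hi).
by rewrite leNgt -ltr_pdivrMl// mulrC hn.
Qed.

Lemma oriented_lint f (M x : R) : loc f -> `|x| <= M ->
  oriented_integral 0 x f = lint (f \_ `[- M, M]) x - lint (f \_ `[- M, M]) 0.
Proof.
move=> lf xM; have fi := loc_cut M lf; have [M1 M2] : - M <= x /\ x <= M by apply/andP; rewrite -ler_norml.
have e (a b : R) : - M <= a -> b <= M -> a <= b ->
   lint (f \_ `[- M, M]) b - lint (f \_ `[- M, M]) a = \int[mu]_(t in `[a, b]) f t.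
  move=> a1 b1 ab; rewrite (lint_itv fi ab); apply: eq_Rintegral => t.
  rewrite inE /= in_itv/= => /andP[t1 t2]; rewrite patchE ifT// inE /= in_itv/=.
  by rewrite (le_trans a1 t1) (le_trans t2 b1).
rewrite /oriented_integral; case: ifPn => [x0|]; first by rewrite e//; lra.
by rewrite -ltNge => x0; rewrite -e ?opprB//; lra.
Qed.

(** On a bounded interval the primitive agrees, up to a constant, with that of the
    integrable restriction of f. *)
Lemma loc_primitive f : loc f ->
  continuous (fun x => oriented_integral 0 x f) /\
  wd 1 (fun x => oriented_integral 0 x f) f.
Proof.
move=> lf; have cK : continuous (fun x => oriented_integral 0 x f).
  move=> x; pose M := `|x| + 1; have fi := loc_cut M lf.
  have xM : `|x| < M by rewrite ltrDl.
  have H : lint (f \_ `[- M, M]) y - lint (f \_ `[- M, M]) 0 @[y --> x] -->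
      oriented_integral 0 x f.
    rewrite (oriented_lint lf (ltW xM)).
    by apply: cvgB; [exact: continuous_lint|exact: cvg_cst].
  apply: cvg_trans H; apply: near_eq_cvg; near=> y; rewrite (oriented_lint (M := M) lf)//.
  apply: ltW; near: y; apply: (@cvgr_lt R _ (nbhs x) _ (fun y => `|y|) `|x|) => //.
  exact: (@norm_continuous R R x).
split => //; apply: wdI => // phi cp; rewrite derive1n1 expr1 mulN1r.
have [M hM] := cls_in cp; have cdp := cls_derivative cp; have [N hN] := cls_in cdp.
pose L := Num.max M N; set F := f \_ `[- L, L]; have fi : intg F by exact: loc_cut.
have [phiNy phiy] := rd_cvg0 (cls_in (cls_cpt_rd cp)).
have p0 : \int[mu]_x phi^`() x = 0.
  by rewrite (dom_integral (cls_derive1 cp) (cls_rd_dom (cls_cpt_rd cdp)) phiNy phiy) subrr.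
have -> : (fun x => oriented_integral 0 x f * phi^`() x) =
    (fun x => lint F x * phi^`() x + - lint F 0 * phi^`() x).
  apply/funext => x; rewrite -mulrDl; have [xL|Lx] := leP `|x| L.
    by rewrite (oriented_lint lf xL).
  by rewrite hN ?mulr0//; move: Lx; rewrite gt_max => /andP[].
have ip : intg phi^`() by exact: dom_intg (cls_rd_dom (cls_cpt_rd cdp)).
rewrite RintD; [|by apply: loc_test => //; apply: loc_cont; exact: continuous_lint|exact: intgZ].
rewrite RintZ// p0 mulr0 addr0.
have := wd_test (wd_lint fi) cp; rewrite derive1n1 expr1 mulN1r => ->; congr (- _).
congr Rintegral; apply/funext => x; rewrite /F patchE; case: ifPn => // xL.
rewrite hM ?mulr0//; move: xL; rewrite notin_setE /= in_itv/= -ler_norml => /negP.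
by rewrite -ltNge gt_max => /andP[].
Unshelve. all: by end_near. Qed.

(** Subtracting a linear function reduces to the first-order case; its slope is read
    off by testing f against the derivative of a bump. *)
Lemma wd2_zero f : loc f -> wd 2 f (cst 0) ->
  exists a c : R, f = (fun x => a + c * x) %[ae mu].
Proof.
move=> lf d; have [b [cb _ b1 _]] := @exists_bump R.
have cdb := cls_derivative cb.
pose c := - \int[mu]_x (f x * b^`() x).
have lx : loc (fun x => - c * x).
  by apply: loc_cont; exact: Der_continuous (DerM (Der_cst (- c)) (@Der_id R)).
have [||a fa] := @du_bois_reymond R (fun x => f x + - c * x).
- exact: locD.
- move=> phi cp; have cdp := cls_derivative cp.
  pose I := \int[mu]_x phi x.
  have ip : intg phi by exact: dom_intg (cls_rd_dom (cls_cpt_rd cp)).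
  have ib : intg b by exact: dom_intg (cls_rd_dom (cls_cpt_rd cb)).
  have ceta : cls (@cpt R) (fun x => phi x + - I * b x).
    apply: clsD => //; first exact: cptD.
    by apply: cls_cptM => //; exact: (cls_cst (P := @anyf R)).
  have [F dF cF] : exists2 F, Der F (fun x => phi x + - I * b x) & cls (@cpt R) F.
    apply: cpt_primitive ceta _; rewrite RintD ?RintZ ?b1//; last exact: intgZ.
    by rewrite mulr1 subrr.
  have dF2 : F^`(2) = (fun x => phi^`() x + - I * b^`() x).
    rewrite derive1nS derive1n1 (Der_derive1 dF).
    have := DerD (cls_derive1 cp) (DerM (Der_cst (- I)) (cls_derive1 cb)).
    by move=> /Der_derive1 ->; apply/funext => x; rewrite mul0r add0r.
  have := wd_test d cF; rewrite dF2.
  have -> : (fun x => cst 0 x * F x) = (fun=> 0 : R) by apply/funext => x; rewrite mul0r.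
  rewrite Rintegral_cst// mul0r mulr0.
  have -> : (fun x => f x * (phi^`() x + - I * b^`() x)) =
    (fun x => f x * phi^`() x + - I * (f x * b^`() x)) by apply/funext => x; ring.
  rewrite RintD; [|exact: loc_test|by apply: intgZ; exact: loc_test].
  rewrite RintZ; last exact: loc_test.
  have -> : (fun x => (f x + - c * x) * phi^`() x) =
     (fun x => f x * phi^`() x + - c * x * phi^`() x).
    by apply/funext => x; ring.
  rewrite RintD; [|exact: loc_test|exact: loc_test].
  have dx := wd_Der (DerM (Der_cst (- c)) (@Der_id R)).
  have {dx} := wd_test (dx _) cp; rewrite derive1n1 => -> //; last first.
    by move=> x; apply: continuousD; apply: continuousM => //; exact: cst_continuous.
  have -> : (fun x => (0 * x + - c * 1) * phi x) = (fun x => - c * phi x).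
    by apply/funext => x; ring.
  rewrite RintZ// -/I expr1 /c.
  set A := Rintegral _ _ _; set B := Rintegral _ _ _; move: A B => A B E.
  by have -> : A + -1 * (- - B * I) = A + - I * B by ring.
exists a, c; apply: aeS fa => x H xT; have := H xT; rewrite /=; lra.
Qed.

(** P and a double primitive of c P have the same second weak derivative, hence
    differ by an affine function; after this P is continuous up to a null set, and
    so is c P. *)
Lemma wd2_regular (c : R -> R) P : continuous c -> loc P ->
  wd 2 P (fun x => c x * P x) ->
  exists Y Y1, [/\ P = Y %[ae mu], Der Y Y1 & Der Y1 (fun x => c x * Y x)].
Proof.
move=> cc lP dP; pose H := fun x => c x * P x.
have lH : loc H by exact: wd_loc dP.
pose K1 x := oriented_integral 0 x H; have [cK1 wK1] := loc_primitive lH.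
pose K2 x := oriented_integral 0 x K1; have K2d : Der K2 K1 by exact: Der_oriented.
have wK2 : wd 2 K2 H by exact: (wd_add (wd_Der K2d cK1) wK1).
have lK2 : loc K2 by apply: loc_cont; exact: Der_continuous K2d.
have [||a [b hab]] := @wd2_zero (fun x => P x + -1 * K2 x).
- by apply: locD => //; exact: locZ.
- have := wdD lP (locZ (-1) lK2) dP (wdZ (-1) lK2 wK2); congr is_weak_derivative.
  by apply/funext => x; rewrite mulN1r subrr.
pose Y x := K2 x + (a + b * x); pose Y1 x := K1 x + b.
have Yd : Der Y Y1.
  apply: DerD K2d _; have := DerD (Der_cst a) (DerM (Der_cst b) (@Der_id R)).
  by move=> h; apply: (Der_eq h) => x; ring.
have PY : P = Y %[ae mu].
  by apply: aeS hab => x h xT; have := h xT; rewrite /Y; lra.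
exists Y, Y1; split => //.
have ccY : continuous (fun x => c x * Y x).
  by move=> x; apply: cvgM; [exact: cc|exact: (Der_continuous Yd)].
have K1E : K1 = (fun x => oriented_integral 0 x (fun x => c x * Y x)).
  have e (i : interval R) : \int[mu]_(x in [set` i]) H x = \int[mu]_(x in [set` i]) (c x * Y x).
    rewrite /Rintegral; congr fine; apply: ae_eq_integral => //.
    - by apply/measurable_EFinP; exact: measurable_funS (loc_meas lH).
    - by apply/measurable_EFinP; exact: measurable_cont.
    - by apply: aeS PY => x h _; rewrite /= /H h.
  by apply/funext => x; rewrite /K1 /oriented_integral !e.
have := DerD (Der_oriented 0 ccY) (Der_cst b).
rewrite /Y1 K1E => h; apply: (Der_eq h) => x; by rewrite addr0.
Qed.

End continuous_representative.

(** * Absence of negative eigenvalues *)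

Section eigenvalues.
Variable R : realType.
Local Notation C := (Rcomplex R).
Local Notation mu := (@lebesgue_measure R).
Local Notation wd := (@is_weak_derivative R).
Variables (w g : R -> R).
Hypotheses (wg : Der w g) (cg : cls (@rd R) g).

Let cpot : continuous (pot g). Proof. exact: cls_continuous (pot_rd cg). Qed.

Lemma psi_lower_bound : exists2 m : R, 0 < m & forall x, m <= psi w x.
Proof.
have [D hD] := bnd_w wg cg; exists (expR (- (D / 2))); first exact: expR_gt0.
by move=> x; rewrite /psi ler_expR lerN2 ler_wpM2r// (le_trans (ler_norm _)).
Qed.

(** Divide a solution Y of Y'' = -(pot + lam) Y by the ground state. The flux
    psi^2 W W' of the quotient W is nondecreasing for lam < 0, so that unless it
    vanishes identically W^2 grows linearly at one of the ends, which contradicts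
    square integrability since psi is bounded below; and if it vanishes identically,
    so does its derivative, which dominates -lam Y^2. *)
Lemma no_square_integrable_solution (lam : R) Y Y1 : lam < 0 ->
  Der Y Y1 -> Der Y1 (fun x => - (pot g x + lam) * Y x) ->
  intg (fun x => Y x ^+ 2) -> forall x, Y x = 0.
Proof.
move=> lam0 YD Y1D Y2.
have psi0 x : 0 < psi w x by exact: expR_gt0.
have psiN x : psi w x != 0 by rewrite gt_eqF.
have pD : Der (psi w) (dpsi w g) by exact: Der_psi.
have dpD : Der (dpsi w g) (fun x => - (pot g x * psi w x)).
  by apply: Der_eq (Der_dpsi wg cg) _ => x; rewrite expr0n addr0.
pose N x := Y1 x * psi w x - Y x * dpsi w g x.
have ND : Der N (fun x => - lam * (Y x * psi w x)).
  by apply: Der_eq (DerB (DerM Y1D pD) (DerM YD dpD)) _ => x; ring.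
have VD : Der (fun x => (psi w x)^-1) (fun x => - (dpsi w g x / psi w x ^+ 2)).
  by apply: Der_eq (DerV psiN pD) _ => x; field.
pose W x := Y x / psi w x.
have WD : Der W (fun x => N x / psi w x ^+ 2).
  by apply: Der_eq (DerM YD VD) _ => x; rewrite /N; field.
pose F x := N x * W x.
have FD : Der F (fun x => - lam * Y x ^+ 2 + N x ^+ 2 / psi w x ^+ 2).
  by apply: Der_eq (DerM ND WD) _ => x; rewrite /W; field.
have NW0 x : 0 <= N x ^+ 2 / psi w x ^+ 2 by rewrite divr_ge0 ?sqr_ge0.
have lY x : 0 <= - lam * Y x ^+ 2 by rewrite mulr_ge0 ?sqr_ge0// oppr_ge0 ltW.
have Fh := Der_homo FD (fun x => addr_ge0 (lY x) (NW0 x)).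
have W2D : Der (fun x => W x * W x) (fun x => 2 * F x / psi w x ^+ 2).
  by apply: Der_eq (DerM WD WD) _ => x; rewrite /F; field.
have [m m0 hm] := psi_lower_bound.
have [B hB] := bnd_psi wg cg.
have B0 : 0 < B.
  by apply: lt_le_trans (hB 0); rewrite ger0_norm ?ltW.
have psiB x : psi w x ^+ 2 <= B ^+ 2.
  by rewrite lerXn2r ?nnegrE ?(ltW (psi0 x)) ?(ltW B0)// (le_trans (ler_norm _)).
have YW x : m ^+ 2 * (W x * W x) <= Y x ^+ 2.
  have -> : Y x ^+ 2 = psi w x ^+ 2 * (W x * W x) by rewrite /W; field.
  rewrite ler_wpM2r//; first by rewrite -expr2 sqr_ge0.
  by rewrite lerXn2r ?nnegrE ?(ltW (psi0 x)) ?(ltW m0).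
have linD (c : R) : Der (fun x => c * x) (fun=> c) by der; ring.
(* a nonzero flux at p forces Y^2 to be bounded below on arbitrarily long intervals *)
have grow (p : R) : F p = 0.
  apply/eqP/negPn/negP => Fp; pose d := 2 * `|F p| / B ^+ 2.
  have d0 : 0 < d by rewrite !mulr_gt0 ?normr_gt0// invr_gt0 exprn_gt0.
  suff : m ^+ 2 * d <= 0 by rewrite leNgt mulr_gt0// exprn_gt0.
  have low x : d <= W x * W x -> m ^+ 2 * d <= `|Y x ^+ 2|.
    move=> h; rewrite ger0_norm ?sqr_ge0//; apply: le_trans (YW x).
    by rewrite ler_wpM2l// sqr_ge0.
  have W2 x : 0 <= W x * W x by rewrite -expr2 sqr_ge0.
  have [Fp0|Fp0] := ltP 0 (F p).
    apply: (intg_lower_bound Y2) => n; exists (p + 1); apply: aeW => x /andP[px _].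
    apply: low; have px' : p <= x by lra.
    have le1 y : p <= y <= x -> d <= 2 * F y / psi w y ^+ 2.
      move=> /andP[py _]; rewrite /d gtr0_norm// ler_pM//; first by rewrite mulr_ge0// ltW.
      - by rewrite invr_ge0 sqr_ge0.
      - by rewrite ler_pM2l//; exact: Fh.
      - by rewrite lef_pV2 ?posrE ?exprn_gt0.
    have h := Der_le (linD d) W2D le1 px'.
    have := W2 p; have : d * 1 <= d * (x - p) by rewrite ler_pM2l//; lra.
    by rewrite mulr1 mulrBr; lra.
  have Fp1 : F p < 0 by rewrite lt_neqAle Fp.
  apply: (intg_lower_bound Y2) => n; exists (p - 1 - n%:R); apply: aeW => x /andP[_ px].
  apply: low; have px' : x <= p by have := ler0n R n; lra.
  have le1 y : x <= y <= p -> 2 * F y / psi w y ^+ 2 <= - d.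
    move=> /andP[_ yp]; rewrite /d ltr0_norm// -mulNr -mulrN opprK -[leRHS]mulrA -[leLHS]mulrA.
    rewrite ler_pM2l//; apply: (@le_trans _ _ (F p / psi w y ^+ 2)).
      by rewrite ler_wpM2r ?invr_ge0 ?sqr_ge0//; exact: Fh.
    by apply: ler_wnM2l; rewrite ?lef_pV2 ?posrE ?exprn_gt0.
  have h := Der_le W2D (linD (- d)) le1 px'.
  have := W2 p; have : d * 1 <= d * (p - x) by rewrite ler_pM2l//; lra.
  by rewrite mulr1 mulrBr; lra.
move=> x; have F0 : F = fun=> 0 by apply/funext.
have := Der_uniq FD _ x; rewrite F0 => /(_ _ (Der_cst 0)) E.
have := lY x; have := NW0 x => h1 h2.
have : - lam * Y x ^+ 2 = 0 by apply/eqP; rewrite eq_le h2 andbT; lra.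
by move=> /eqP; rewrite mulf_eq0 oppr_eq0 lt_eqF//= sqrf_eq0 => /eqP.
Qed.

Lemma Lfun2_loc f : f \in Lfun mu 2%:E -> loc f.
Proof.
move=> f2; have i2 := Lfun2_integrable_sqr f2.
have mf : measurable_fun setT f by move: (sub_Lfun_mfun f2); rewrite inE.
apply: (@loc_le R _ (fun x => 1 + f x ^+ 2) mf) => [|M].
  by apply: locD; [exact: loc_cst|exact: intg_loc].
exists 1 => x _; rewrite mul1r [leRHS]ger0_norm ?addr_ge0 ?sqr_ge0//.
rewrite -[f x ^+ 2]real_normK ?num_real//.
have := sqr_ge0 (`|f x| - 2^-1); have := normr_ge0 (f x); nra.
Qed.

(** The weak equation has a classical solution as representative, to which
    no_square_integrable_solution applies. *)
Lemma L2_weak_solution_zero (lam : R) P : lam < 0 -> sobolev 2 2%:E P ->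
  (fun x => - weak_derivative 2 P x - pot g x * P x) = (fun x => lam * P x) %[ae mu] ->
  P = cst 0 %[ae mu].
Proof.
move=> lam0 [P2 sP] eqP; have lP := Lfun2_loc P2.
have [G _ dG] := sP 2%N isT; have [dP _] := weak_derivativeP dG.
pose c x := - (pot g x + lam).
have cc : continuous c.
  by move=> x; apply: cvgN; apply: cvgD; [exact: cpot|exact: cvg_cst].
have dP' : wd 2 P (fun x => c x * P x).
  apply: (wd_aer _ _ dP); first exact: loc_contM.
  by apply: aeS eqP => x h xT; have := h xT; rewrite /c; lra.
have [Y [Y1 [PY YD Y1D]]] := wd2_regular cc lP dP'.
have i2 : intg (fun x => P x ^+ 2) by exact: Lfun2_integrable_sqr P2.
have Y2 : intg (fun x => Y x ^+ 2).
  have mY : measurable_fun setT (fun x => Y x ^+ 2).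
    by apply: measurable_funX; apply: measurable_cont; exact: Der_continuous YD.
  apply/integrableP; split; first exact/measurable_EFinP.
  have /integrableP[mP] := i2; congr (_ < _)%E; apply: ae_eq_integral => //.
  - by apply/measurable_EFinP; apply: measurableT_comp => //; exact: intg_meas i2.
  - by apply/measurable_EFinP; apply: measurableT_comp.
  - by apply: aeS PY => x h xT; rewrite /= h.
have Y0 := no_square_integrable_solution lam0 YD Y1D Y2.
by apply: aeS PY => x h xT; rewrite h// Y0.
Qed.

Lemma no_negative_eigenvalue (lam : R) : lam < 0 -> ~ is_eigenvalue (pot g) lam.
Proof.
move=> lam0 [f [sRe sIm fN0 eqf]]; apply: fN0.
have h1 : (fun x => complex.Re (f x)) = cst 0 %[ae mu].
  apply: (L2_weak_solution_zero lam0 sRe).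
  by apply: aeS eqf => x h xT; have := congr1 (@complex.Re R) (h xT); rewrite !ReImE.
have h2 : (fun x => complex.Im (f x)) = cst 0 %[ae mu].
  apply: (L2_weak_solution_zero lam0 sIm).
  by apply: aeS eqf => x h xT; have := congr1 (@complex.Im R) (h xT); rewrite !ReImE.
by apply: aeS (aeI h1 h2) => x [e1 e2] xT; apply: eq_ReIm; [exact: e1|exact: e2].
Qed.

End eigenvalues.

(** * Sobolev spaces *)

Section weak_classes.
Variable R : realType.
Local Notation mu := (@lebesgue_measure R).
Local Notation wd := (@is_weak_derivative R).
Local Notation seqf := (nat -> R -> R).
Implicit Types (F G a : seqf) (P Q S A : seqf -> Prop) (f g : R -> R) (k : nat).

(** Sequences of functions whose weak derivatives of order at most k, as sequences,
    all satisfy P: the analogue of clsn. Working with sequences turns the statement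
    that all derivatives tend to 0 in L^1 into a class closed under sums, for which
    the Leibniz rule needs no constants. A single function is a constant sequence. *)
Fixpoint wcls k P F : Prop :=
  [/\ P F, forall n, loc (F n) &
   if k is m.+1 then exists2 G, forall n, wd 1 (F n) (G n) & wcls m P G else True].

(** The counterpart of wcls for smooth multipliers, with classical derivatives. *)
Fixpoint scls k A a : Prop :=
  [/\ A a, forall n, cls (@anyf R) (a n) &
   if k is m.+1 then scls m A (fun n => (a n)^`()) else True].

Lemma wcls_in k P F : wcls k P F -> P F. Proof. by case: k => [|k] []. Qed.

Lemma scls_in k A a : scls k A a -> A a. Proof. by case: k => [|k] []. Qed.

Lemma wclsS k P F : wcls k.+1 P F -> wcls k P F.
Proof.
elim: k F => [|k IH] F; first by case.
by move=> [pF lF [G dG wG]]; split => //; exists G => //; exact: IH.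
Qed.

Lemma sclsS k A a : scls k.+1 A a -> scls k A a.
Proof.
elim: k a => [|k IH] a; first by case.
by move=> [pF lF wG]; split => //; exact: IH.
Qed.

Lemma wcls_sub k P Q F : (forall F, P F -> Q F) -> wcls k P F -> wcls k Q F.
Proof.
move=> PQ; elim: k F => [|k IH] F [pF lF]; first by move=> _; split => //; exact: PQ.
by move=> [G dG wG]; split => //; [exact: PQ|exists G => //; exact: IH].
Qed.

Lemma wclsD k P Q S F G : (forall F G, P F -> Q G -> S (fun n x => F n x + G n x)) ->
  wcls k P F -> wcls k Q G -> wcls k S (fun n x => F n x + G n x).
Proof.
move=> PQ; elim: k F G => [|k IH] F G.
  move=> [pF lF _] [pG lG _]; split => //; first exact: PQ.
  by move=> n; exact: locD.
move=> [pF lF [F' dF wF]] [pG lG [G' dG wG]]; split; first exact: PQ.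
  by move=> n; exact: locD.
exists (fun n x => F' n x + G' n x); last exact: IH.
by move=> n; exact: wdD.
Qed.

(** By the Leibniz rule the derivatives of the product are sums of products of a
    derivative of a by a derivative of F, which lie in S. *)
Lemma wclsM k A P S a F : (forall a F, A a -> P F -> S (fun n x => a n x * F n x)) ->
  (forall F G, S F -> S G -> S (fun n x => F n x + G n x)) ->
  scls k A a -> wcls k P F -> wcls k S (fun n x => a n x * F n x).
Proof.
move=> AP SS; elim: k a F => [|k IH] a F.
  move=> [pa sa _] [pF lF _]; split => //; first exact: AP.
  by move=> n; apply: loc_contM => //; exact: cls_continuous (sa n).
move=> ha hF; have [pa sa da] := ha; have [pF lF [F' dF wF]] := hF.
split; first exact: AP.
  by move=> n; apply: loc_contM => //; exact: cls_continuous (sa n).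
exists (fun n x => (a n)^`() x * F n x + a n x * F' n x).
  by move=> n; exact: wdM.
by apply: (wclsD SS); apply: IH => //; [exact: wclsS|exact: sclsS].
Qed.

Lemma scls_wcls k A P a : (forall a, A a -> P a) -> scls k A a -> wcls k P a.
Proof.
move=> AP; elim: k a => [|k IH] a [pa sa].
  by split => // [|n]; [exact: AP|exact: loc_cont (cls_continuous (sa n))].
move=> da; split => // [|n|]; [exact: AP|exact: loc_cont (cls_continuous (sa n))|].
exists (fun n => (a n)^`()); last exact: IH.
move=> n; apply: wd_Der; first exact: cls_derive1 (sa n).
exact: cls_continuous (cls_derivative (sa n)).
Qed.

Lemma wcls_iter k P F : wcls k P F ->
  forall j, (j <= k)%N -> exists2 G, P G & forall n, wd j (F n) (G n).
Proof.
elim: k F => [|k IH] F.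
  by move=> [pF lF _] [|//] _; exists F => // n; exact: wd0.
move=> [pF lF [G dG wG]] [_|j jk]; first by exists F => // n; exact: wd0.
have [H pH dH] := IH G wG j jk; exists H => // n.
by rewrite -add1n; exact: wd_add (dG n) (dH n).
Qed.

Lemma wclsI k P F : (forall n, loc (F n)) ->
  (forall j, (j <= k)%N -> exists2 G, P G & forall n, wd j (F n) (G n)) ->
  P F -> wcls k P F.
Proof.
elim: k F => [|k IH] F lF h pF; first by split.
have [G pG dG] := h 1%N isT; split => //; exists G => //.
apply: IH => // [n|j jk]; first exact: wd_loc (dG n).
have [H pH dH] := h j.+1 jk; exists H => // n.
by apply: wd_sub (dG n) _; rewrite add1n.
Qed.

Definition L1seq F := forall n, intg (F n).

Definition cseq f : seqf := fun=> f.

Definition L1cst F := exists2 f, intg f & F = cseq f.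

Lemma Lfun1P f : f \in Lfun mu 1 <-> intg f.
Proof. exact: Lfun1_integrable. Qed.

Lemma wcls_sobolev k F n : wcls k L1seq F -> sobolev k 1 (F n).
Proof.
move=> wF; split; first by apply/Lfun1P; exact: (wcls_in wF).
move=> j jk; have [G hG dG] := wcls_iter wF jk; exists (G n) => //.
by apply/Lfun1P; exact: hG.
Qed.

Lemma sobolev_intg k f : sobolev k 1 f -> intg f.
Proof. by move=> [/Lfun1P]. Qed.

Lemma sobolev_wcls k f : sobolev k 1 f -> wcls k L1cst (cseq f).
Proof.
move=> [/Lfun1P fi h]; apply: wclsI; first by move=> n; exact: intg_loc.
  move=> j /h[g /Lfun1P gi dg]; exists (cseq g) => //; by exists g.
by exists f.
Qed.

Lemma L1cst_seq F : L1cst F -> L1seq F.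
Proof. by move=> [f fi ->] n. Qed.

Lemma L1seqD F G : L1seq F -> L1seq G -> L1seq (fun n x => F n x + G n x).
Proof. by move=> hF hG n; exact: intgD. Qed.

Lemma L1cstD F G : L1cst F -> L1cst G -> L1cst (fun n x => F n x + G n x).
Proof.
by move=> [f fi ->] [g gi ->]; exists (fun x => f x + g x) => //; exact: intgD.
Qed.

Definition bndseq a := exists C : R, forall n x, `|a n x| <= C.

Lemma bndseqM a F : (forall n, measurable_fun setT (a n)) -> bndseq a -> L1seq F ->
  L1seq (fun n x => a n x * F n x).
Proof. by move=> ma [C hC] hF n; apply: intgM => //; exists C. Qed.

Lemma sobolevD k f g : sobolev k 1 f -> sobolev k 1 g -> sobolev k 1 (fun x => f x + g x).
Proof.
move=> /sobolev_wcls hf /sobolev_wcls hg.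
apply: (@wcls_sobolev k (fun n x => cseq f n x + cseq g n x) 0).
by apply: (@wcls_sub _ L1cst); [exact: L1cst_seq|exact: wclsD L1cstD hf hg].
Qed.

Lemma sobolevM k (a f : R -> R) : cls (@bnd R) a -> sobolev k 1 f -> sobolev k 1 (fun x => a x * f x).
Proof.
move=> ca /sobolev_wcls hf.
apply: (@wcls_sobolev k (fun n x => cseq a n x * cseq f n x) 0).
pose A (a : seqf) := bndseq a /\ forall n, continuous (a n).
apply: (@wclsM _ A L1cst) hf => [b F [bb cb] hF|F G|].
- by apply: bndseqM => // [n|]; [exact: measurable_cont|exact: L1cst_seq].
- exact: L1seqD.
- elim: k a ca => [|k IH] a ca; (split; first split).
  + by have [C hC] := cls_in ca; exists C.
  + by move=> n; exact: cls_continuous ca.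
  + by move=> n; exact: cls_any ca.
  + by [].
  + by have [C hC] := cls_in ca; exists C.
  + by move=> n; exact: cls_continuous ca.
  + by move=> n; exact: cls_any ca.
  + exact: (IH _ (cls_derivative ca)).
Qed.

Lemma sobolevZ k (c : R) f : sobolev k 1 f -> sobolev k 1 (fun x => c * f x).
Proof. by apply: sobolevM; exact: cls_bnd_cst. Qed.

Lemma sobolevB k f g : sobolev k 1 f -> sobolev k 1 g -> sobolev k 1 (fun x => f x - g x).
Proof.
move=> hf /(sobolevZ (-1)) hg; have := sobolevD hf hg; congr sobolev.
by apply/funext => x; rewrite mulN1r.
Qed.

Lemma sobolev_weak_derivative i k f : sobolev (i + k) 1 f ->
  sobolev k 1 (weak_derivative i f).
Proof.
move=> [_ h]; have [g gi dg] := h i (leq_addr _ _).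
have [dw we] := weak_derivativeP dg.
have L1w j f' g' : g' \in Lfun mu 1 -> wd j f' g' -> forall g'', wd j f' g'' -> g'' \in Lfun mu 1.
  move=> /Lfun1P gi' dg' g'' dg''; apply/Lfun1P; apply/integrableP.
  have mg := loc_meas (wd_loc dg''); split; first exact/measurable_EFinP.
  have /integrableP[mg' ] := gi'; congr (_ < _)%E; apply: ae_eq_integral => //.
  - by apply/measurable_EFinP; apply: measurableT_comp => //; exact: intg_meas gi'.
  - by apply/measurable_EFinP; apply: measurableT_comp.
  - by apply: aeS (wd_uniq dg' dg'') => x e xT; rewrite /= e.
split; first exact: L1w gi dg _ dw.
move=> j jk; have [g' gi' dg'] := h (i + j)%N (leq_add (leqnn i) jk).
by exists g' => //; exact: wd_sub dw dg'.
Qed.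

Definition N1 f := \int[mu]_x `|f x|.

Lemma N1_ge0 f : 0 <= N1 f.
Proof. by apply: Rintegral_ge0 => x _. Qed.

Lemma N1D f g : intg f -> intg g -> N1 (fun x => f x + g x) <= N1 f + N1 g.
Proof.
move=> fi gi; rewrite /N1 -RintD; [|exact: intg_norm|exact: intg_norm].
apply: (@le_Rintegral _ _ _ mu setT) => //.
- exact: intg_norm (intgD fi gi).
- by apply: intgD; exact: intg_norm.
- by move=> x _; exact: ler_normD.
Qed.

Lemma N1_ae f g : measurable_fun setT f -> measurable_fun setT g -> f = g %[ae mu] ->
  N1 f = N1 g.
Proof.
move=> mf mg fg; apply: eq_Rintegral_ae.
- exact: measurableT_comp.
- exact: measurableT_comp.
- by apply: aeS fg => x e xT; rewrite e.
Qed.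

Lemma N1_weak_derivative j f g : wd j f g -> N1 (weak_derivative j f) = N1 g.
Proof.
move=> dg; have [dw e] := weak_derivativeP dg.
by apply: N1_ae e; apply: loc_meas; [exact: wd_loc dw|exact: wd_loc dg].
Qed.

Definition nullseq F := L1seq F /\ N1 (F n) @[n --> \oo] --> (0 : R).

Lemma nullseqD F G : nullseq F -> nullseq G -> nullseq (fun n x => F n x + G n x).
Proof.
move=> [iF cF] [iG cG]; split; first exact: L1seqD.
have h : N1 (F n) + N1 (G n) @[n --> \oo] --> (0 : R).
  by rewrite -[X in _ --> X](addr0 0); exact: cvgD.
apply: (cvg_squeeze0 (h := fun n => N1 (F n) + N1 (G n))) => //; near=> n.
by rewrite subr0 ger0_norm ?N1_ge0//; exact: N1D.
Unshelve. all: by end_near. Qed.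

Lemma wcls_null_norm k F : wcls k nullseq F ->
  sobolev1_norm k (F n) @[n --> \oo] --> (0 : R).
Proof.
move=> wF; suff H m : (m <= k.+1)%N -> \sum_(j < m) N1 (weak_derivative j (F n)) @[n --> \oo] --> (0 : R).
  exact: (H k.+1 (leqnn _)).
elim: m => [_|m IH mk].
  by apply: (cvg_eqfun (f := cst 0)); [move=> n; rewrite big_ord0|exact: cvg_cst].
have [G [_ cG] dG] := wcls_iter wF (j := m) mk.
have h : \sum_(j < m) N1 (weak_derivative j (F n)) + N1 (G n) @[n --> \oo] --> (0 + 0 : R).
  by apply: cvgD => //; exact: IH (ltnW mk).
rewrite addr0 in h; apply: (cvg_eqfun _ h) => n.
by rewrite big_ord_recr /= (N1_weak_derivative (dG n)).
Qed.

Section topology.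
Variable k : nat.
Local Notation W := (sobolev1Type R k).

Lemma sobolev1P (v : W) : sobolev k 1 v.
Proof. by case: v => f fs /=; exact: set_mem fs. Qed.

Lemma sobolev1K f : sobolev k 1 f -> {v : W | v = f :> (R -> R)}.
Proof. by move=> h; exists (Sobolev1 (mem_set h)). Qed.

Lemma sobolev1_normD f g : sobolev k 1 f -> sobolev k 1 g ->
  sobolev1_norm k (fun x => f x + g x) <= sobolev1_norm k f + sobolev1_norm k g.
Proof.
move=> [/Lfun1P fi hf] [/Lfun1P gi hg]; rewrite /sobolev1_norm -big_split /=.
apply: ler_sum => j _; have [f' /Lfun1P fi' df] := hf j (leq_ord j).
have [g' /Lfun1P gi' dg] := hg j (leq_ord j).
have := N1_weak_derivative (wdD (intg_loc fi) (intg_loc gi) df dg).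
rewrite /N1 => ->; have := N1_weak_derivative df; have := N1_weak_derivative dg.
by rewrite /N1 => -> ->; exact: N1D.
Qed.

Lemma le_sobolev1_norm f : sobolev k 1 f -> N1 f <= sobolev1_norm k f.
Proof.
move=> [/Lfun1P fi _]; rewrite /sobolev1_norm big_ord_recl /=.
have := N1_weak_derivative (wd0 (intg_loc fi)); rewrite /N1 => ->.
by rewrite lerDl; apply: sumr_ge0 => j _; exact: N1_ge0.
Qed.

Lemma sobolev1_open_ball (v : W) (r : R) : 0 < r ->
  open [set g : W | sobolev1_norm k (fun x => g x - v x) < r].
Proof.
move=> r0; exists [set [set g : W | sobolev1_norm k (fun x => g x - v x) < r]]; last first.
  by rewrite bigcup_set1.
move=> _ ->; exists [fset ((v : R -> R), r)]%fset.
  by move=> i; rewrite in_fsetE => /eqP ->; apply: mem_set; split => //; exact: sobolev1P.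
by rewrite set_fset1 bigcap_set1.
Qed.

Local Opaque sobolev1_norm.

(** Balls with arbitrary centres generate the topology, so a neighbourhood contains
    a finite intersection of balls containing v. *)
Lemma sobolev1_cvg_filter (F : set_system W) (v : W) : Filter F ->
  (forall (f : R -> R) (r : R), sobolev k 1 f -> sobolev1_norm k (fun x => v x - f x) < r ->
     F [set g : W | sobolev1_norm k (fun x => g x - f x) < r]) -> F --> v.
Proof.
move=> FF H A; rewrite /= nbhsE => -[B [oB Bv] BA]; apply: filterS BA _.
case: oB => D hD eB; move: Bv; rewrite -eB => -[E DE Ev].
apply: (@filterS _ _ _ E); first by move=> g Cg; exists E.
have [D' hD' eE] := hD _ DE; rewrite -eE; apply: filter_bigI => -[f r] iD.
have iD' : [set` D'] (f, r) by [].
apply: H; first by have [] := set_mem (hD' _ iD).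
by move: Ev; rewrite -eE => /(_ _ iD').
Qed.

Lemma sobolev1_normB_lt f g h (r : R) : sobolev k 1 f -> sobolev k 1 g -> sobolev k 1 h ->
  sobolev1_norm k (fun x => f x - g x) < r - sobolev1_norm k (fun x => g x - h x) ->
  sobolev1_norm k (fun x => f x - h x) < r.
Proof.
have aux (a b c d : R) : d <= a + b -> a < c - b -> d < c.
  by move=> h1 h2; apply: (le_lt_trans h1); rewrite -ltrBrDr.
move=> sf sg sh h0; apply: (aux _ _ _ _ _ h0).
have -> : (fun x => f x - h x) = (fun x => (f x - g x) + (g x - h x)).
  by apply/funext => x; rewrite addrA subrK.
exact: (sobolev1_normD (sobolevB sf sg) (sobolevB sg sh)).
Qed.

Lemma sobolev1_cvg (w : nat -> W) (v : W) :
  sobolev1_norm k (fun x => w n x - v x) @[n --> \oo] --> (0 : R) -> w n @[n --> \oo] --> v.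
Proof.
move=> H; apply: sobolev1_cvg_filter => f r sf vf.
have d0 : 0 < r - sobolev1_norm k (fun x => v x - f x) by rewrite subr_gt0.
have /cvgrPdist_lt/(_ _ d0) := H; apply: filterS => n.
rewrite sub0r normrN => hn.
apply: (sobolev1_normB_lt (sobolev1P (w n)) (sobolev1P v) sf).
exact: le_lt_trans (ler_norm _) hn.
Qed.

End topology.
End weak_classes.

(** * Cutoffs and stretched bumps *)

Section cutoffs.
Variable R : realType.
Local Notation mu := (@lebesgue_measure R).
Local Notation wd := (@is_weak_derivative R).
Local Notation seqf := (nat -> R -> R).
Implicit Types (f g B T : R -> R) (F a : seqf).

(** The substitution rule, from the limits at both ends of a primitive. *)
Lemma integral_affine B (s c : R) : continuous B -> cpt B -> s != 0 ->
  intg (fun x => B (s * x + c)) /\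
  \int[mu]_x B (s * x + c) = `|s|^-1 * \int[mu]_x B x.
Proof.
move=> cB pB s0; have dB := rd_dom cB (cpt_rd (continuous_cpt_bnd cB pB) pB).
have aff : Der (fun x => s * x + c) (fun=> s) by der; ring.
have cBs : continuous (fun x => B (s * x + c)).
  move=> x; apply: (@continuous_comp _ _ _ (fun x => s * x + c) B x); last exact: cB.
  exact: (Der_continuous aff).
have pBs : cpt (fun x => B (s * x + c)).
  have [M hM] := pB; exists ((`|M| + `|c|) / `|s|) => x; rewrite ltr_pdivrMr ?normr_gt0// => h.
  apply: hM; apply: (le_lt_trans (ler_norm M)).
  have := ler_normB (s * x + c) c; rewrite addrK normrM mulrC => h1; lra.
have dBs := rd_dom cBs (cpt_rd (continuous_cpt_bnd cBs pBs) pBs).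
split; first exact: dom_intg.
have [G [GB G0 G1]] := dom_primitive dB; set I := \int[mu]_x B x in G1 *.
have [K [KB K0 K1]] := dom_primitive dBs; set J := \int[mu]_x _ in K1 *.
have GD : Der (fun x => s^-1 * G (s * x + c)) (fun x => B (s * x + c)).
  by apply: Der_eq (DerM (Der_cst s^-1) (Der_comp GB aff)) _ => x; field.
have [d hd] := Der_diff GD KB.
have affy : 0 < s -> s * x + c @[x --> +oo] --> +oo.
  move=> sp; apply/cvgryPge => A; near=> x.
  have : (A - c) / s <= x by near: x; apply: nbhs_pinfty_ge; exact: num_real.
  by rewrite ler_pdivrMr// mulrC; lra.
have affNy : 0 < s -> s * x + c @[x --> -oo] --> -oo.
  move=> sp; apply/cvgrNyPle => A; near=> x.
  have : x <= (A - c) / s by near: x; apply: nbhs_ninfty_le; exact: num_real.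
  by rewrite ler_pdivlMr// mulrC; lra.
have affyN : s < 0 -> s * x + c @[x --> +oo] --> -oo.
  move=> sn; apply/cvgrNyPle => A; near=> x.
  have : (A - c) / s <= x by near: x; apply: nbhs_pinfty_ge; exact: num_real.
  by rewrite ler_ndivrMr// mulrC; lra.
have affNyN : s < 0 -> s * x + c @[x --> -oo] --> +oo.
  move=> sn; apply/cvgryPge => A; near=> x.
  have : x <= (A - c) / s by near: x; apply: nbhs_ninfty_le; exact: num_real.
  by rewrite ler_ndivlMr// mulrC; lra.
have lim (H : set_system R) (l k : R) : ProperFilter H ->
    G (s * x + c) @[x --> H] --> l -> K x @[x --> H] --> k -> s^-1 * l = k + d.
  move=> PH Gl Kk; have h1 : s^-1 * G (s * x + c) @[x --> H] --> s^-1 * l by exact: cvgMr.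
  have h2 : K x + d @[x --> H] --> k + d by apply: cvgD => //; exact: cvg_cst.
  have h3 : s^-1 * G (s * x + c) @[x --> H] --> k + d.
    by apply: (cvg_eqfun _ h2) => x; rewrite hd.
  exact: (cvg_unique _ h1 h3).
have [sn|sp|s00] := ltgtP s 0; last by move: s0; rewrite s00 eqxx.
- have e1 : s^-1 * I = 0 + d by apply: lim K0; exact: cvg_comp (affNyN sn) G1.
  have e2 : s^-1 * 0 = J + d by apply: lim K1; exact: cvg_comp (affyN sn) G0.
  by rewrite ltr0_norm// invrN mulNr e1; move: e2; rewrite mulr0; lra.
- have e1 : s^-1 * 0 = 0 + d by apply: lim K0; exact: cvg_comp (affNy sp) G0.
  have e2 : s^-1 * I = J + d by apply: lim K1; exact: cvg_comp (affy sp) G1.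
  by rewrite gtr0_norm// e2; move: e1; rewrite mulr0; lra.
Unshelve. all: by end_near. Qed.

Lemma N1_le f g : intg f -> intg g -> (forall x, `|f x| <= g x) ->
  N1 f <= \int[mu]_x g x.
Proof.
move=> fi gi h; apply: (@le_Rintegral _ _ _ mu setT) => //; exact: intg_norm.
Qed.

Variable s : R.
Hypothesis s1 : `|s| = 1.

Let s0 : s != 0. Proof. by rewrite -normr_eq0 s1 oner_eq0. Qed.

Definition Atail a := exists T, [/\ continuous T, bnd T, (forall x, x < 0 -> T x = 0) &
  a = tail T s].

Definition Aunit a := exists T, [/\ continuous T, cpt T, (forall x, x < 0 -> T x = 0) &
  a = tail T s].

Lemma tail_derive1 T : cls (@anyf R) T ->
  (fun n => (tail T s n)^`()) = tail (fun x => s * T^`() x) s.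
Proof.
by move=> cT; apply/funext => n; exact: Der_derive1 (Der_tail s n (cls_derive1 cT)).
Qed.

Lemma tail_scls k T : cls (@bnd R) T -> (forall x, x < 0 -> T x = 0) ->
  scls k Atail (tail T s).
Proof.
elim: k T => [|k IH] T cT T0.
  split=> // [|n]; first by exists T; split => //; [exact: cls_continuous cT|exact: cls_in cT].
  by apply: tail_smooth; exact: cls_any cT.
split=> [|n|]; first by exists T; split => //; [exact: cls_continuous cT|exact: cls_in cT].
  by apply: tail_smooth; exact: cls_any cT.
rewrite (tail_derive1 (cls_any cT)); apply: IH.
  by apply: cls_bndM; [exact: cls_bnd_cst|exact: cls_derivative].
by move=> x x0; rewrite (@Der_locally0 R T _ [set x | x < 0] 0 (cls_derive1 cT)) ?mulr0.
Qed.

Lemma unit_scls k T : cls (@cpt R) T -> (forall x, x < 0 -> T x = 0) ->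
  scls k Aunit (tail T s).
Proof.
elim: k T => [|k IH] T cT T0.
  split=> // [|n]; first by exists T; split => //; [exact: cls_continuous cT|exact: cls_in cT].
  by apply: tail_smooth; exact: cls_any cT.
split=> [|n|]; first by exists T; split => //; [exact: cls_continuous cT|exact: cls_in cT].
  by apply: tail_smooth; exact: cls_any cT.
rewrite (tail_derive1 (cls_any cT)); apply: IH.
  by apply: cls_cptM; [exact: (cls_cst (P := @anyf R))|exact: cls_derivative].
by move=> x x0; rewrite (@Der_locally0 R T _ [set x | x < 0] 0 (cls_derive1 cT)) ?mulr0.
Qed.

Lemma continuous_tail T n : continuous T -> continuous (tail T s n).
Proof.
move=> cT x; have aff : Der (fun x => s * x + - n%:R) (fun=> s) by der; ring.
apply: (@continuous_comp _ _ _ (fun x => s * x + - n%:R) T x); last exact: cT.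
exact: (Der_continuous aff).
Qed.

(** The tails are bounded and live where an integrable function has small integral. *)
Lemma tail_null a F : Atail a -> L1cst F -> nullseq (fun n x => a n x * F n x).
Proof.
move=> [T [cT [C hC] T0 ->]] [f fi ->].
have i n : intg (fun x => tail T s n x * f x).
  by apply: intgM => //; [apply: measurable_cont; exact: continuous_tail|exists C => x; exact: hC].
split=> [n|]; first exact: i.
have lim x : `|tail T s n x * f x| @[n --> \oo] --> (0 : R).
  apply: cvg_near_cst; near=> n; rewrite (tail_lt s1 T0) ?mul0r ?normr0//.
  have : `|x| + 1 <= n%:R by near: n; exact: nbhs_infty_ger.
  lra.
have bb n x : `| `|tail T s n x * f x| | <= C * `|f x|.
  by rewrite normr_id normrM ler_wpM2r// hC.
have [_] := @dominated_cvgR R (fun n x => `|tail T s n x * f x|) (fun=> 0)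
  (fun x => C * `|f x|) (fun n => intg_meas (intg_norm (i n))) lim
  (intgZ C (intg_norm fi)) bb.
by rewrite Rintegral_cst// mul0r.
Unshelve. all: by end_near. Qed.

Definition C0cst F := exists f, [/\ continuous f, f x @[x --> -oo] --> (0 : R),
  f x @[x --> +oo] --> (0 : R) & F = cseq f].

Lemma C0_small f (e : R) : f x @[x --> -oo] --> (0 : R) -> f x @[x --> +oo] --> (0 : R) ->
  0 < e -> \forall n \near \oo, forall x, n%:R <= `|x| -> `|f x| <= e.
Proof.
move=> h1 h2 e0; move/cvgr0Pnorm_le: h1 => /(_ _ e0)[M1 [_ H1]].
move/cvgr0Pnorm_le: h2 => /(_ _ e0)[M2 [_ H2]].
near=> n => x; have : `|M1| + `|M2| + 1 <= n%:R by near: n; exact: nbhs_infty_ger.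
have := ler_norm (- M1); rewrite normrN; have := ler_norm M2.
have := normr_ge0 M1; have := normr_ge0 M2 => a b c d nn.
rewrite ler_normr => /orP[h|h]; first by apply: H2; lra.
by apply: H1; lra.
Unshelve. all: by end_near. Qed.

(** If F merely tends to 0 at infinity, it is the fixed mass of the escaping bump that
    makes the integral small. *)
Lemma unit_null a F : Aunit a -> L1cst F \/ C0cst F -> nullseq (fun n x => a n x * F n x).
Proof.
move=> [T [cT pT T0 aE]] [FL|[f [cf fNy fy ->]]].
  by apply: tail_null => //; exists T; split => //; exact: continuous_cpt_bnd.
rewrite aE; pose B x := `|T x|.
have cB : continuous B by move=> x; apply: cvg_norm; exact: cT.
have pB : cpt B by have [M hM] := pT; exists M => x /hM; rewrite /B => ->; rewrite normr0.
have hB n := integral_affine (- n%:R) cB pB s0.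
have i n : intg (fun x => tail T s n x * f x).
  rewrite (_ : (fun x => _) = (fun x => f x * tail T s n x)); last first.
    by apply/funext => x; rewrite mulrC.
  apply: loc_cpt; [exact: loc_cont|exact: continuous_tail|].
  have [M hM] := pT; exists (`|M| + n%:R) => x h; apply: hM.
  apply: le_lt_trans (ler_norm M) _.
  have := ler_normB (s * x + - n%:R) (- n%:R).
  by rewrite addrK normrM s1 mul1r normrN (ger0_norm (ler0n R n)); lra.
split=> [n|]; first exact: i.
set I := \int[mu]_x B x in hB; have I0 : 0 <= I by apply: Rintegral_ge0 => x _; exact: normr_ge0.
apply/cvgrPdist_le => e e0; have eI : 0 < e / (I + 1) by rewrite divr_gt0// ltr_wpDl.
have := C0_small fNy fy eI; apply: filterS => n small.
rewrite sub0r normrN ger0_norm ?N1_ge0//.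
have [Bi BE] := hB n; rewrite s1 invr1 mul1r in BE.
apply: (@le_trans _ _ (\int[mu]_x (e / (I + 1) * B (s * x + - n%:R)))).
  apply: N1_le => [||x]; [exact: i|exact: intgZ|].
  rewrite normrM mulrC; have [xn|nx] := ltP `|x| n%:R.
    by rewrite (tail_lt s1 T0 xn) normr0 mulr0 mulr_ge0 ?(ltW eI)//; exact: normr_ge0.
  by rewrite ler_wpM2r// small.
by rewrite RintZ// BE mulrAC ler_pdivrMr ?ltr_wpDl// ler_pM2l// lerDl.
Qed.

End cutoffs.

Section scaled_bumps.
Variable R : realType.
Local Notation mu := (@lebesgue_measure R).
Local Notation wd := (@is_weak_derivative R).
Local Notation seqf := (nat -> R -> R).
Implicit Types (f g B : R -> R) (F a : seqf).

Lemma nullseq_integral F : nullseq F -> \int[mu]_x F n x @[n --> \oo] --> (0 : R).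
Proof.
move=> [iF cF]; apply: (cvg_squeeze0 (h := fun n => N1 (F n))) => //; near=> n.
by rewrite subr0; apply: (@le_normr_Rintegral _ _ _ mu setT _ measurableT (iF n)).
Unshelve. all: by end_near. Qed.

Lemma cpt_intg f : continuous f -> cpt f -> intg f.
Proof.
move=> cf pf; apply: dom_intg; apply: rd_dom => //.
by apply: cpt_rd => //; exact: continuous_cpt_bnd.
Qed.

Definition cptseq a := forall n, cls (@cpt R) (a n).

Lemma cpt_scls k a : cptseq a -> scls k cptseq a.
Proof.
elim: k a => [|k IH] a ca; split => //; try by move=> n; exact: cls_any (ca n).
by apply: IH => n; exact: cls_derivative.
Qed.

Lemma cptseq_L1 a : cptseq a -> L1seq a.
Proof. by move=> ca n; apply: cpt_intg; [exact: cls_continuous (ca n)|exact: cls_in (ca n)]. Qed.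

Lemma cptseqM a F : cptseq a -> L1cst F \/ C0cst F -> L1seq (fun n x => a n x * F n x).
Proof.
move=> ca hF n; have lF : loc (F n).
  by case: hF => [[f fi ->]|[f [cf _ _ ->]]]; [exact: intg_loc|exact: loc_cont].
have := loc_test lF (ca n); congr intg; apply/funext => x; exact: mulrC.
Qed.

Lemma C0_bnd f : continuous f -> f x @[x --> -oo] --> (0 : R) -> f x @[x --> +oo] --> (0 : R) ->
  bnd f.
Proof.
move=> cf fNy fy; have [n _ hn] := C0_small fNy fy ltr01.
have [C hC] := continuous_itv_bnd n%:R cf; exists (`|C| + 1) => x.
have [nx|xn] := leP n%:R `|x|.
  by rewrite (le_trans (hn n (leqnn n) x nx))// lerDr.
by rewrite (le_trans (hC x (ltW xn)))// (le_trans (ler_norm C))// lerDl.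
Qed.

Definition rdcst a := exists2 p, cls (@rd R) p & a = (fun=> p).

Lemma rdcstM a F : rdcst a -> L1cst F \/ C0cst F -> L1cst (fun n x => a n x * F n x).
Proof.
move=> [p cp ->] [[f fi ->]|[f [cf fNy fy ->]]]; exists (fun x => p x * f x) => //.
  have [C hC] := cls_in (cls_rd_bnd cp).
  by apply: intgM => //; [apply: measurable_cont; exact: cls_continuous cp|exists C].
have := dom_intg (domM cf (C0_bnd cf fNy fy) (cls_rd_dom cp)); congr intg.
by apply/funext => x; rewrite mulrC.
Qed.

Lemma rdcst_scls k a : rdcst a -> scls k rdcst a.
Proof.
elim: k a => [|k IH] a ha; have [p cp aE] := ha.
  by split => // n; rewrite aE; exact: cls_any cp.
split => // [n|]; first by rewrite aE; exact: cls_any cp.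
by apply: IH; exists p^`(); [exact: cls_derivative|rewrite aE].
Qed.

Lemma rdcst_L1 a : rdcst a -> L1cst a.
Proof. by move=> [p cp ->]; exists p => //; exact: dom_intg (cls_rd_dom cp). Qed.

Section family.
Variables c m : nat -> R.
Hypothesis m1 : forall n, 1 <= m n.
Hypothesis cm : forall n, `|c n| * n.+1%:R <= m n.

Let m0 n : 0 < m n. Proof. exact: lt_le_trans ltr01 (m1 n). Qed.

(** The bump B stretched to width m n, normalized so that the first one has
    integral c n times that of B; each derivative gains a factor 1 / m n. *)
Definition stretch (j : nat) B : seqf :=
  fun n x => c n * m n ^- j.+1 * B ((m n)^-1 * x + 0).

Lemma Der_stretch j B dB n : Der B dB -> Der (stretch j B n) (stretch j.+1 dB n).
Proof.
move=> BD; have aff : Der (fun x => (m n)^-1 * x + 0) (fun=> (m n)^-1) by der; ring.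
apply: Der_eq (DerM (Der_cst (c n * m n ^- j.+1)) (Der_comp BD aff)) _ => x.
by rewrite /stretch mul0r add0r (exprSr _ j.+1) invfM; ring.
Qed.

Lemma stretch_derive1 j B : cls (@anyf R) B ->
  (fun n => (stretch j B n)^`()) = stretch j.+1 B^`().
Proof.
by move=> cB; apply/funext => n; exact: Der_derive1 (Der_stretch j n (cls_derive1 cB)).
Qed.

Lemma cm_le n j : `|c n| * m n ^- j.+1 <= n.+1%:R^-1.
Proof.
have n0 : 0 < n.+1%:R :> R by rewrite ltr0n.
have mj : m n ^- j.+1 <= (m n)^-1.
  by rewrite lef_pV2 ?posrE ?exprn_gt0// -[leLHS]expr1; apply: ler_weXn2l.
apply: (@le_trans _ _ (`|c n| / m n)); first by rewrite ler_wpM2l.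
by rewrite ler_pdivrMr// -[leRHS]mulrC ler_pdivlMr.
Qed.

Lemma cls_stretch j B n : cls (@cpt R) B -> cls (@cpt R) (stretch j B n).
Proof.
move=> cB; have [M hM] := cls_in cB.
apply: (@cls_affine R (@cpt R) (m n)^-1 0 B _ (c n * m n ^- j.+1) cB) => d f [N hN].
exists (`|N| * m n) => x; rewrite -ltr_pdivlMr// => h; rewrite hN ?mulr0//.
apply: (le_lt_trans (ler_norm N)); apply: (lt_le_trans h).
by rewrite addr0 normrM mulrC gtr0_norm// invr_gt0.
Qed.

Lemma stretch_N1 j B n : continuous B -> cpt B ->
  N1 (stretch j.+1 B n) <= (\int[mu]_x `|B x|) / n.+1%:R.
Proof.
move=> cB pB; pose D x := `|B x|.
have cD : continuous D by move=> x; apply: cvg_norm; exact: cB.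
have pD : cpt D by have [M hM] := pB; exists M => x /hM; rewrite /D => ->; rewrite normr0.
have mV : (m n)^-1 != 0 by rewrite invr_eq0 gt_eqF.
have [Di DE] := integral_affine 0 cD pD mV.
have -> : N1 (stretch j.+1 B n) = `|c n| * m n ^- j.+2 * \int[mu]_x D ((m n)^-1 * x + 0).
  rewrite -RintZ//; congr Rintegral; apply/funext => x.
  by rewrite /stretch !normrM (gtr0_norm (x := m n ^- j.+2)) ?invr_gt0 ?exprn_gt0.
rewrite DE normfV invrK (gtr0_norm (m0 n)) mulrA.
have -> : `|c n| * m n ^- j.+2 * m n = `|c n| * m n ^- j.+1.
  by rewrite (exprSr _ j.+1) invfM mulrA divfK ?gt_eqF.
rewrite mulrC ler_wpM2l ?cm_le//.
by apply: Rintegral_ge0 => x _; exact: normr_ge0.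
Qed.

Lemma stretch_nullseq j B : cls (@cpt R) B -> nullseq (stretch j.+1 B).
Proof.
move=> cB; split=> [n|].
  have cS : cls (@cpt R) (stretch j.+1 B n) by exact: cls_stretch.
  by apply: cpt_intg; [exact: cls_continuous cS|exact: cls_in cS].
have h : (\int[mu]_x `|B x|) * harmonic n @[n --> \oo] --> (0 : R).
  by rewrite -[X in _ --> X](mulr0 (\int[mu]_x `|B x|)); apply: cvgMr; exact: cvg_harmonic.
apply: (cvg_squeeze0 (h := fun n => (\int[mu]_x `|B x|) * harmonic n)) => //; near=> n.
rewrite subr0 ger0_norm ?N1_ge0//.
by apply: stretch_N1; [exact: cls_continuous cB|exact: cls_in cB].
Unshelve. all: by end_near. Qed.

(** The L^1 norm of the i-th derivative of the stretched bump is a multiple of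
    |c n| / m n ^ i, small as soon as i > 0. *)
Lemma stretch_null k j B : cls (@cpt R) B -> wcls k (@nullseq R) (stretch j.+1 B).
Proof.
elim: k j B => [|k IH] j B cB.
  split=> // [|n]; first exact: stretch_nullseq.
  by apply: loc_cont; exact: cls_continuous (cls_stretch j.+1 n cB).
split=> // [|n|]; first exact: stretch_nullseq.
  by apply: loc_cont; exact: cls_continuous (cls_stretch j.+1 n cB).
exists (stretch j.+2 B^`()); last by apply: IH; exact: cls_derivative.
move=> n; rewrite -stretch_derive1; last exact: cls_any cB.
have cS := cls_stretch j.+1 n cB.
apply: wd_Der; first exact: cls_derive1 cS.
exact: cls_continuous (cls_derivative cS).
Qed.

Definition smallseq a := (forall n, continuous (a n)) /\
  exists C, forall n x, `|a n x| <= C / n.+1%:R.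

Lemma small_null a F : smallseq a -> L1cst F -> nullseq (fun n x => a n x * F n x).
Proof.
move=> [ca [C hC]] [f fi ->].
have i n : intg (fun x => a n x * f x).
  by apply: intgM => //; [exact: measurable_cont|exists (C / n.+1%:R) => x; exact: hC].
split=> // ; have h : C * N1 f * harmonic n @[n --> \oo] --> (0 : R).
  by rewrite -[X in _ --> X](mulr0 (C * N1 f)); apply: cvgMr; exact: cvg_harmonic.
apply: (cvg_squeeze0 (h := fun n => C * N1 f * harmonic n)) => //; near=> n.
rewrite subr0 ger0_norm ?N1_ge0//.
have -> : C * N1 f * harmonic n = \int[mu]_x (C / n.+1%:R * `|f x|).
  by rewrite RintZ; [rewrite [LHS]mulrAC|exact: intg_norm].
apply: N1_le => // [|x]; first by apply: intgZ; exact: intg_norm.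
by rewrite normrM ler_wpM2r// hC.
Unshelve. all: by end_near. Qed.

Lemma stretch_smallseq j B : cls (@cpt R) B -> smallseq (stretch j B).
Proof.
move=> cB; split=> [n|]; first exact: cls_continuous (cls_stretch j n cB).
have [C hC] := continuous_cpt_bnd (cls_continuous cB) (cls_in cB).
exists C => n x; rewrite /stretch normrM normrM.
rewrite (gtr0_norm (x := m n ^- j.+1)) ?invr_gt0 ?exprn_gt0// mulrC.
by apply: ler_pM => //; [rewrite mulr_ge0// invr_ge0 exprn_ge0// ltW|exact: cm_le].
Qed.

(** The stretched bump itself has a possibly large integral, but it is uniformly
    small, which suffices against a fixed integrable factor. *)
Lemma stretch_small k j B : cls (@cpt R) B -> scls k smallseq (stretch j B).
Proof.
elim: k j B => [|k IH] j B cB.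
  split=> // [|n]; first exact: stretch_smallseq.
  exact: cls_any (cls_stretch j n cB).
split=> [|n|]; [exact: stretch_smallseq|exact: cls_any (cls_stretch j n cB)|].
by rewrite stretch_derive1; [apply: IH; exact: cls_derivative|exact: cls_any cB].
Qed.

Lemma integral_stretch B n : continuous B -> cpt B ->
  \int[mu]_x stretch 0 B n x = c n * \int[mu]_x B x.
Proof.
move=> cB pB; have mV : (m n)^-1 != 0 by rewrite invr_eq0 gt_eqF.
have [Bi BE] := integral_affine 0 cB pB mV.
rewrite /stretch RintZ// BE normfV invrK (gtr0_norm (m0 n)) expr1.
by rewrite mulrA divfK// gt_eqF.
Qed.

End family.
End scaled_bumps.

(** * The range on Sobolev spaces *)

Section density.
Variable R : realType.
Local Notation mu := (@lebesgue_measure R).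
Local Notation wd := (@is_weak_derivative R).
Local Notation seqf := (nat -> R -> R).
Implicit Types (f g v : R -> R) (F a : seqf).

Lemma lint_norm_le f x : intg f -> `|lint f x| <= lint (fun t => `|f t|) x.
Proof.
by move=> fi; apply: (@le_normr_Rintegral _ _ _ mu `]-oo, x] f (measurable_itv _) (intg_itv `]-oo, x] fi)).
Qed.

(** Dominated convergence along the integers for |f|, whose primitive is monotone,
    controls the primitive of f. *)
Lemma lint_limits f : intg f ->
  lint f x @[x --> -oo] --> (0 : R) /\ lint f x @[x --> +oo] --> \int[mu]_x f x.
Proof.
move=> fi; pose h x := `|f x|; have hi : intg h by exact: intg_norm.
have lh x y : x <= y -> lint h x <= lint h y.
  move=> xy; rewrite -subr_ge0 (lint_itv hi xy).
  by apply: Rintegral_ge0 => t _; exact: normr_ge0.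
have cut_lim (D : nat -> set R) (l : R -> R) : (forall n, measurable (D n)) ->
    (forall x, (h \_ (D n)) x @[n --> \oo] --> l x) ->
    \int[mu]_(x in D n) h x @[n --> \oo] --> \int[mu]_x l x.
  move=> mD hl.
  have mn n : measurable_fun setT (h \_ (D n)).
    by apply/(measurable_restrictT _ _).1 => //; exact: measurable_funS (intg_meas hi).
  have bb n x : `|(h \_ (D n)) x| <= h x.
    by rewrite patchE; case: ifP => _; rewrite /h ?normr_id ?normr0.
  have [_ c] := dominated_cvgR mn hl hi bb.
  by apply: (cvg_eqfun _ c) => n; rewrite [RHS]Rintegral_mkcond.
have l0 : lint h (- n%:R) @[n --> \oo] --> (0 : R).
  have := @cut_lim (fun n => [set` `]-oo, - n%:R]]) (fun=> 0).
  rewrite Rintegral_cst// mul0r; apply => [n|x]; first exact: measurable_itv.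
  apply: cvg_near_cst; near=> n; rewrite patchE ifF//; apply/negbTE; rewrite notin_setE /= in_itv/=.
  apply/negP; rewrite -ltNge; have : `|x| + 1 <= n%:R by near: n; exact: nbhs_infty_ger.
  by have := ler_norm (- x); rewrite normrN; lra.
have l1 : lint h n%:R @[n --> \oo] --> \int[mu]_x h x.
  apply: (@cut_lim (fun n => [set` `]-oo, n%:R]]) h) => [n|x]; first exact: measurable_itv.
  apply: cvg_near_cst; near=> n; rewrite patchE ifT// inE /= in_itv/=.
  by apply: le_trans (ler_norm x) _; near: n; exact: nbhs_infty_ger.
split; apply/cvgrPdist_le => e e0.
  have /cvgr0Pnorm_le/(_ _ e0)[n _ /(_ n (leqnn n))] := l0.
  move=> hn; near=> x; rewrite sub0r normrN; apply: le_trans (lint_norm_le x fi) _.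
  apply: le_trans hn; apply: le_trans (ler_norm _); apply: lh.
  by near: x; apply: nbhs_ninfty_le; exact: num_real.
have /cvgrPdist_le/(_ _ e0)[n _ /(_ n (leqnn n))] := l1 => hn.
have splitT k x : intg k -> \int[mu]_t k t - lint k x = \int[mu]_(t in `]x, +oo[) k t.
  move=> ki; have := @Rintegral_itvB _ k -oo%O +oo%O x; rewrite set_itvE.
  by move=> /(_ ki isT isT).
near=> x; rewrite splitT//.
apply: (@le_trans _ _ (\int[mu]_(t in `]x, +oo[) h t)).
  exact: (@le_normr_Rintegral _ _ _ mu `]x, +oo[ f (measurable_itv _) (intg_itv `]x, +oo[ fi)).
rewrite -splitT//; apply: le_trans hn; apply: le_trans (ler_norm _); rewrite lerD2l lerN2.
by apply: lh; near: x; apply: nbhs_pinfty_ge; exact: num_real.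
Unshelve. all: by end_near. Qed.

(** Test with the cutoffs: their derivatives are bounded and escape to infinity. *)
Lemma integral_wd (F f : R -> R) : intg F -> intg f -> wd 1 F f -> \int[mu]_x f x = 0.
Proof.
move=> Fi fi d; have [S stepS] := exists_step R; pose X := cutoff S.
have cX n : cls (@cpt R) (X n) by exact: cutoff_cpt.
have lim : \int[mu]_x (f x * X n x) @[n --> \oo] --> \int[mu]_x f x.
  have mX n : measurable_fun setT (fun x => f x * X n x).
    apply: measurable_funM; first exact: intg_meas.
    by apply: measurable_cont; exact: cls_continuous (cX n).
  have bb n x : `|f x * X n x| <= 3 * `|f x|.
    by rewrite normrM mulrC ler_wpM2r//; exact: cutoff_bnd.
  apply: (proj2 (dominated_cvgR mX _ (intgZ 3 (intg_norm fi)) bb)) => x.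
  apply: cvg_near_cst; near=> n; rewrite /X cutoff_lt ?mulr1//.
  by have : `|x| + 1 <= n%:R by [near: n; exact: nbhs_infty_ger]; lra.
have cb : cls (@bnd R) S^`() by case: stepS => cS _ _ _; exact: cls_derivative cS.
have tn (s : R) : `|s| = 1 -> nullseq (fun n x => tail S^`() s n x * cseq F n x).
  move=> ss; apply: (tail_null ss); last by exists F.
  exact: scls_in (@tail_scls R s 0 _ cb (step_derive0 stepS)).
have t1 := tn 1 (normr1 R).
have t2 : nullseq (fun n x => tail S^`() (-1) n x * cseq F n x).
  by apply: tn; rewrite normrN normr1.
have lim0 : \int[mu]_x (f x * X n x) @[n --> \oo] --> (0 : R).
  have h : \int[mu]_x (tail S^`() 1 n x * F x) +
      -1 * \int[mu]_x (tail S^`() (-1) n x * F x) @[n --> \oo] --> (0 + -1 * 0 : R).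
    by apply: cvgD; [exact: nullseq_integral t1|apply: cvgMr; exact: nullseq_integral t2].
  rewrite mulr0 addr0 in h; apply: (cvg_eqfun _ h) => n.
  have i1 : intg (fun x => tail S^`() 1 n x * F x) by exact: (proj1 t1 n).
  have i2 : intg (fun x => tail S^`() (-1) n x * F x) by exact: (proj1 t2 n).
  rewrite -RintZ// -RintD//; last exact: intgZ.
  have D := Der_derive1 (Der_cutoff stepS n).
  have := wd_test d (cX n); rewrite derive1n1 D expr1 mulN1r.
  move=> /(congr1 -%R); rewrite opprK => <-; rewrite -RintN; last first.
    by have := cls_derivative (cX n); rewrite D; apply: loc_test; exact: intg_loc.
  by congr Rintegral; apply/funext => x; ring.
exact: (cvg_unique _ lim lim0).
Unshelve. all: by end_near. Qed.

End density.

Section approximation.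
Variable R : realType.
Local Notation mu := (@lebesgue_measure R).
Local Notation wd := (@is_weak_derivative R).
Implicit Types (f g v h : R -> R).

Lemma sobolev_le (j k : nat) f : (j <= k)%N -> sobolev k 1 f -> sobolev j 1 f.
Proof. by move=> jk [fi h]; split => // i ij; apply: h; exact: leq_trans jk. Qed.

Lemma sobolev_rd k f : cls (@rd R) f -> sobolev k 1 f.
Proof.
move=> cf; apply: (@wcls_sobolev R k (cseq f) 0); apply: (@wcls_sub _ _ (@L1cst R)).
  exact: L1cst_seq.
by apply: (scls_wcls (@rdcst_L1 R)); apply: rdcst_scls; exists f.
Qed.

Section with_u.
Variable u : R -> R.
Hypothesis cu : cls (@rd R) u.
Let cdu : cls (@rd R) u^`(). Proof. exact: cls_derivative. Qed.
Let du : Der u u^`(). Proof. exact: cls_derive1. Qed.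

(** The linearized equation is solved by the same formula as for Schwartz data, but
    for v merely in W^{k,1} the solution tends to 0 without being integrable. *)
Lemma lin_weak_solution v : intg v -> Lambda1 u v = 0 ->
  exists g, [/\ continuous g, g x @[x --> -oo] --> (0 : R), g x @[x --> +oo] --> (0 : R) &
    wd 1 g (fun x => u^`() x * g x + 2 * v x)].
Proof.
move=> vi L1v; pose p x := expR (- u x) * v x.
have pi : intg p.
  have [C hC] := cls_in (cls_expNu cu).
  apply: intgM => //; last by exists C.
  by apply: measurable_cont; exact: cls_continuous (cls_expNu cu).
have [VNy Vy] := lint_limits pi; rewrite -[X in _ --> X](Lambda1E u v) L1v in Vy.
pose a x := 2 * expR (u x).
have ca : cls (@bnd R) a by apply: cls_bndM; [exact: cls_bnd_cst|exact: cls_expu].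
have [C hC] := cls_in ca.
have cV := continuous_lint pi.
have lim (H : set_system R) : Filter H -> lint p x @[x --> H] --> (0 : R) ->
    a x * lint p x @[x --> H] --> (0 : R).
  move=> FH h; apply: (cvg_squeeze0 (h := fun x => C * `|lint p x|)).
    by near=> x; rewrite subr0 normrM ler_wpM2r.
  by rewrite -[X in _ --> X](mulr0 C) -(normr0 R); apply: cvgMr; exact: cvg_norm.
exists (fun x => a x * lint p x); split; [|exact: lim|exact: lim|].
  by move=> x; apply: cvgM; [exact: (cls_continuous ca)|exact: cV].
have := wdM (cls_any ca) (loc_cont cV) (wd_lint pi); congr is_weak_derivative.
have aD : Der a (fun x => 2 * (expR (u x) * u^`() x)).
  by apply: Der_eq (DerM (Der_cst 2) (Der_expR du)) _ => x; ring.
apply/funext => x; rewrite (Der_derive1 aD) /p /a.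
have E : expR (u x) * expR (- u x) = 1 by rewrite -expRD subrr expR0.
have -> : 2 * expR (u x) * (expR (- u x) * v x) = 2 * (expR (u x) * expR (- u x)) * v x by ring.
by rewrite E; ring.
Unshelve. all: by end_near. Qed.

Local Notation P0 := (fun F => L1cst F \/ C0cst F).

(** Bootstrap: in the equation g' = u' g + 2 v the factor u' turns g, which merely
    tends to 0, into an integrable function, and each further derivative of g
    inherits the regularity of the previous one. *)
Lemma wcls_solution k v g : sobolev k 1 v -> C0cst (cseq g) ->
  wd 1 g (fun x => u^`() x * g x + 2 * v x) ->
  wcls k.+1 P0 (cseq g) /\ wcls k (@L1cst R) (cseq (fun x => u^`() x * g x + 2 * v x)).
Proof.
move=> sv cg dg; have lg n : loc (cseq g n).
  by have [g' [cg' _ _ e]] := cg; rewrite e; exact: loc_cont.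
have pg : P0 (cseq g) by right.
have step j : (j <= k)%N -> wcls j P0 (cseq g) ->
    wcls j (@L1cst R) (cseq (fun x => u^`() x * g x + 2 * v x)).
  move=> jk wg; have sv2 := sobolev_wcls (sobolevZ 2 (sobolev_le jk sv)).
  have su : scls j (@rdcst R) (fun=> u^`()) by apply: rdcst_scls; exists u^`().
  exact: (wclsD (@L1cstD R) (wclsM (@rdcstM R) (@L1cstD R) su wg) sv2).
have main j : (j <= k.+1)%N -> wcls j P0 (cseq g).
  elim: j => [_|j IH jk]; first by split.
  split=> //; exists (cseq (fun x => u^`() x * g x + 2 * v x)) => //.
  by apply: (wcls_sub (P := @L1cst R)) (step j jk (IH (ltnW jk))) => F; left.
by split; [exact: main|apply: step => //; exact: main].
Qed.

(** Cut the solution g off at distance n and remove its remaining integral by a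
    bump of large width; the result is the derivative of a compactly supported
    function, and its image under the linearization is close to v. *)
Lemma range_dense k v : sobolev k 1 v -> Lambda1 u v = 0 ->
  exists2 F : nat -> R -> R, wcls k (@nullseq R) F &
    forall n, exists2 h, sobolev k.+2 1 h & (fun x => v x + F n x) = Dbers_weak u h %[ae mu].
Proof.
move=> sv L1v; have vi := sobolev_intg sv.
have [g [cg gNy gy dg]] := lin_weak_solution vi L1v.
have Cg : C0cst (cseq g) by exists g.
have [wg wg'] := wcls_solution sv Cg dg.
set g' := fun x => u^`() x * g x + 2 * v x in dg wg'.
have [S stepS] := exists_step R; have [cS _ S0 _] := stepS.
have S0' x : x < 0 -> S x = 0 by move=> /ltW; exact: S0.
pose b := S^`(); have b0 : forall x, x < 0 -> b x = 0 := step_derive0 stepS.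
have cb : cls (@cpt R) b := step_derive_cpt stepS.
have ib : \int[mu]_x b x = 1 := integral_step_derive stepS.
have cbZ (c : R) : cls (@cpt R) (fun x => c * b x).
  by apply: cls_cptM => //; exact: (cls_cst (P := @anyf R)).
have bZ0 (c : R) x : x < 0 -> c * b x = 0 by move=> /b0 ->; rewrite mulr0.
pose X := cutoff S; pose dX n x : R := -1 * tail b 1 n x + tail b (-1) n x.
have XD n : Der (X n) (dX n) by exact: Der_cutoff.
have cX n : cls (@cpt R) (X n) by exact: cutoff_cpt.
pose c n := \int[mu]_x (X n x * g x); pose m n := 1 + `|c n| * n.+1%:R.
have m1 n : 1 <= m n by rewrite lerDl mulr_ge0.
have cm n : `|c n| * n.+1%:R <= m n by rewrite lerDr.
pose t := stretch c m 0; pose t1 := stretch c m 1.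
pose gn n x := X n x * g x + t (fun x => -1 * b x) n x.
pose Gn n x := dX n x * g x + X n x * g' x + t1 (fun x => -1 * b^`() x) n x.
have ct (a : R) n : cls (@cpt R) (t (fun x => a * b x) n) by exact: cls_stretch.
have tD n : Der (t (fun x => -1 * b x) n) (t1 (fun x => -1 * b^`() x) n).
  apply: (@Der_stretch R c m 0 (fun x => -1 * b x) (fun x => -1 * b^`() x) n).
  by apply: Der_eq (DerM (Der_cst (-1)) (cls_derive1 cb)) _ => x; ring.
have ctD n : continuous (t1 (fun x => -1 * b^`() x) n).
  have := cls_derivative (ct (-1) n); rewrite (Der_derive1 (tD n)); exact: cls_continuous.
have lg : loc g by exact: loc_cont.
have wgn n : wd 1 (gn n) (Gn n).
  have h1 := wdM (cls_any (cX n)) lg dg; rewrite (Der_derive1 (XD n)) in h1.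
  have h2 := wd_Der (tD n) (ctD n).
  apply: wdD h1 h2; first by apply: loc_contM => //; exact: cls_continuous (cX n).
  by apply: loc_cont; exact: cls_continuous (ct (-1) n).
have cgn n : continuous (gn n).
  move=> x; apply: cvgD; last exact: (cls_continuous (ct (-1) n)).
  by apply: cvgM; [exact: (cls_continuous (cX n))|exact: cg].
have pgn n : cpt (gn n).
  have [M hM] := cls_in (cX n); have [N hN] := cls_in (ct (-1) n).
  exists (Num.max M N) => x; rewrite gt_max => /andP[/hM e1 /hN e2].
  by rewrite /gn e1 e2 mul0r addr0.
have wcX : scls k.+1 (@cptseq R) X by exact: cpt_scls.
have wct : wcls k.+1 (@L1seq R) (t (fun x => -1 * b x)).
  by apply: (scls_wcls (@cptseq_L1 R)); apply: cpt_scls => n; exact: ct.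
have wX : wcls k.+1 (@L1seq R) (fun n x => X n x * cseq g n x).
  exact: (wclsM (@cptseqM R) (@L1seqD R) wcX wg).
have wgn1 : wcls k.+1 (@L1seq R) gn by exact: (wclsD (@L1seqD R) wX wct).
have ign n : \int[mu]_x gn n x = 0.
  rewrite RintD; [|exact: (wcls_in wX)|exact: (wcls_in wct)].
  have e := @integral_stretch R c m m1 (fun x => -1 * b x) n (cls_continuous (cbZ (-1))) (cls_in (cbZ (-1))).
  rewrite /t e RintZ ?ib; first by rewrite -/(c n); ring.
  exact: cpt_intg (cls_continuous cb) (cls_in cb).
have main n : exists H, Der H (gn n) /\ cpt H.
  by have [H H1 H2] := cpt_primitive_continuous (cgn n) (pgn n) (ign n); exists H.
have /choice[H hH] := main.
have wH : wcls k.+2 (@L1seq R) H.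
  have cH n : continuous (H n) by exact: Der_continuous (proj1 (hH n)).
  split=> [n|n|]; first exact: cpt_intg (cH n) (proj2 (hH n)).
    exact: loc_cont.
  exists gn => [n|]; last exact: wgn1.
  exact: (wd_Der (proj1 (hH n)) (cgn n)).
(* F1 is the error made by the cutoffs, F2 the one made by the stretched bump; the
   halves come from the factor 1/2 of the linearized map *)
pose F1 n x := tail (fun x => -1 * S x) 1 n x * v x + tail (fun x => -1 * S x) (-1) n x * v x +
  (tail (fun x => - 2^-1 * b x) 1 n x * g x + tail (fun x => 2^-1 * b x) (-1) n x * g x).
pose F2 n x := t1 (fun x => - 2^-1 * b^`() x) n x + t (fun x => 2^-1 * b x) n x * u^`() x.
have cSN : cls (@bnd R) (fun x => -1 * S x) by apply: cls_bndM => //; exact: cls_bnd_cst.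
have SN0 x : x < 0 -> -1 * S x = 0 by move=> /S0' ->; rewrite mulr0.
have wv := sobolev_wcls sv.
have wgk : wcls k P0 (cseq g) by exact: wclsS.
have wt1 (s : R) : `|s| = 1 ->
    wcls k (@nullseq R) (fun n x => tail (fun x => -1 * S x) s n x * cseq v n x).
  move=> ss; exact: (wclsM (tail_null ss) (@nullseqD R) (@tail_scls R s k _ cSN SN0) wv).
have wt2 (s a : R) : `|s| = 1 ->
    wcls k (@nullseq R) (fun n x => tail (fun x => a * b x) s n x * cseq g n x).
  move=> ss; exact: (wclsM (unit_null ss) (@nullseqD R) (@unit_scls R s k _ (cbZ a) (bZ0 a)) wgk).
have sN1 : `|-1 : R| = 1 by rewrite normrN normr1.
have wF1 : wcls k (@nullseq R) F1.
  apply: (wclsD (@nullseqD R)); apply: (wclsD (@nullseqD R)).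
  - exact: wt1 (normr1 R).
  - exact: wt1 sN1.
  - exact: wt2 (normr1 R).
  - exact: wt2 sN1.
have wF2 : wcls k (@nullseq R) F2.
  have cdb : cls (@cpt R) (fun x => - 2^-1 * b^`() x).
    by apply: cls_cptM; [exact: (cls_cst (P := @anyf R))|exact: cls_derivative].
  have wu : wcls k (@L1cst R) (fun=> u^`()).
    by apply: (scls_wcls (@rdcst_L1 R)); apply: rdcst_scls; exists u^`().
  apply: (wclsD (@nullseqD R)); first exact: (stretch_null m1 cm k 0 cdb).
  exact: (wclsM (@small_null R) (@nullseqD R) (stretch_small m1 cm k 0 (cbZ 2^-1)) wu).
exists (fun n x => F1 n x + F2 n x); first exact: (wclsD (@nullseqD R) wF1 wF2).
move=> n; exists (H n); first exact: wcls_sobolev wH.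
have w1 : wd 1 (H n) (gn n) by exact: (wd_Der (proj1 (hH n)) (cgn n)).
have w2 : wd 2 (H n) (Gn n) by exact: (wd_add w1 (wgn n)).
apply: aeS (aeI (proj2 (weak_derivativeP w1)) (proj2 (weak_derivativeP w2))) => x [e1 e2] xT.
rewrite /Dbers_weak e1// e2// /Gn /gn /F1 /F2 /g' /dX /X /cutoff /tail /t /t1 /stretch.
by move: (c n / m n ^+ 2) (c n / m n ^+ 1) => A B; field.
Unshelve. all: by end_near. Qed.

End with_u.
End approximation.

Section sobolev_range.
Variable R : realType.
Local Notation mu := (@lebesgue_measure R).
Local Notation wd := (@is_weak_derivative R).
Implicit Types (f g h : R -> R).

Lemma ae_cst0_intg h (c : R) : intg h -> (forall n : nat, exists a : R,
  {ae mu, forall x, a <= x <= a + n%:R -> h x = c}) -> c = 0.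
Proof.
move=> hi H; apply/eqP; rewrite -normr_le0; apply: (intg_lower_bound hi) => n.
by have [a ha] := H n; exists a; apply: aeS ha => x e /e ->.
Qed.

Section with_u.
Variable u : R -> R.
Hypothesis cu : cls (@rd R) u.
Let cdu : cls (@rd R) u^`(). Proof. exact: cls_derivative. Qed.
Let du : Der u u^`(). Proof. exact: cls_derive1. Qed.

Lemma Dbers_weak_sobolev k h : sobolev k.+2 1 h -> sobolev k 1 (Dbers_weak u h).
Proof.
move=> sh; have s2 : sobolev k 1 (weak_derivative 2 h).
  exact: (@sobolev_weak_derivative R 2 k h sh).
have s1 : sobolev k 1 (weak_derivative 1 h).
  exact: (sobolev_le (leqnSn k) (@sobolev_weak_derivative R 1 k.+1 h sh)).
exact: (sobolevZ 2^-1 (sobolevB s2 (sobolevM (cls_rd_bnd cdu) s1))).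
Qed.

Lemma sobolev_weak_derivatives k h : sobolev k.+2 1 h ->
  let h1 := weak_derivative 1 h in let h2 := weak_derivative 2 h in
  [/\ intg h1, intg h2, wd 1 h h1 & wd 1 h1 h2].
Proof.
move=> sh h1 h2; have [_ H] := sh; have [f1 _ d1] := H 1%N isT; have [f2 _ d2] := H 2%N isT.
have [w1 _] := weak_derivativeP d1; have [w2 _] := weak_derivativeP d2.
split => //.
- exact: (sobolev_intg (@sobolev_weak_derivative R 1 k.+1 h sh)).
- exact: (sobolev_intg (@sobolev_weak_derivative R 2 k h sh)).
- exact: (wd_sub (j := 1) w1 w2).
Qed.

Let e x := expR (- u x).
Let ce : cls (@bnd R) e. Proof. exact: cls_expNu. Qed.
Let eD : Der e (fun x => - u^`() x * e x).
Proof. by apply: Der_eq (Der_expR (DerN du)) _ => x; rewrite mulrC. Qed.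

Let intg_e f : intg f -> intg (fun x => e x * f x).
Proof.
move=> fi; apply: intgM => //; last exact: cls_in ce.
by apply: measurable_cont; exact: cls_continuous ce.
Qed.

Let wd_e f g : loc f -> wd 1 f g -> wd 1 (fun x => e x * f x) (fun x => e x * (g x - u^`() x * f x)).
Proof.
move=> lf d; have := wdM (cls_any ce) lf d; congr is_weak_derivative.
by apply/funext => x; rewrite (Der_derive1 eD); ring.
Qed.

(** The integrand is half the weak derivative of the integrable function
    exp(-u) h', whose integral vanishes. *)
Lemma Lambda1_Dbers_weak k h : sobolev k.+2 1 h -> Lambda1 u (Dbers_weak u h) = 0.
Proof.
move=> sh; have [i1 i2 w1 w2] := sobolev_weak_derivatives sh.
have w := wd_e (intg_loc i1) w2.
set p := (fun x => e x * (_ - _)) in w.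
have ip : intg p.
  apply: intg_e; apply: intgB => //.
  exact: (sobolev_intg (sobolevM (cls_rd_bnd cdu) (sobolev_le (leq0n _) (@sobolev_weak_derivative R 1 k.+1 h sh)))).
rewrite Lambda1E; have -> : (fun x => expR (- u x) * Dbers_weak u h x) = (fun x => 2^-1 * p x).
  by apply/funext => x; rewrite /p /Dbers_weak mulrCA.
by rewrite RintZ// (integral_wd (intg_e i1) ip w) mulr0.
Qed.

Lemma Lambda1_ae f g : intg f -> intg g -> f = g %[ae mu] -> Lambda1 u f = Lambda1 u g.
Proof.
move=> fi gi fg; rewrite !Lambda1E; apply: eq_Rintegral_ae.
- exact: intg_meas (intg_e fi).
- exact: intg_meas (intg_e gi).
- by apply: aeS fg => x E xT; rewrite E.
Qed.

Section fixed_k.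
Variable k : nat.
Local Notation W := (sobolev1Type R k).
Implicit Types v w : W.

Lemma range_kernel v : range_Dbers_sobolev u v -> Lambda1 u v = 0.
Proof.
move=> [h sh vE]; rewrite (Lambda1_ae _ _ vE) ?(Lambda1_Dbers_weak sh)//.
  exact: (sobolev_intg (sobolev1P v)).
exact: (sobolev_intg (Dbers_weak_sobolev sh)).
Qed.

Lemma Lambda1_continuous : exists2 C : R, 0 < C &
  forall v w, `|Lambda1 u w - Lambda1 u v| <= C * sobolev1_norm k (fun x => w x - v x).
Proof.
have [C hC] := cls_in ce; exists (`|C| + 1); first by rewrite ltr_wpDl.
move=> v w; have vi := sobolev_intg (sobolev1P v); have wi := sobolev_intg (sobolev1P w).
have wv := sobolevB (sobolev1P w) (sobolev1P v); have di := sobolev_intg wv.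
rewrite !Lambda1E -RintB; [|exact: intg_e|exact: intg_e].
have -> : (fun x => expR (- u x) * w x - expR (- u x) * v x) = (fun x => e x * (w x - v x)).
  by apply/funext => x; rewrite mulrBr.
apply: (@le_trans _ _ (N1 (fun x => e x * (w x - v x)))).
  exact: (@le_normr_Rintegral _ _ _ mu setT _ measurableT (intg_e di)).
apply: (@le_trans _ _ ((`|C| + 1) * N1 (fun x => w x - v x))); last first.
  by rewrite ler_wpM2l ?addr_ge0//; exact: le_sobolev1_norm.
rewrite -RintZ; last exact: intg_norm.
apply: N1_le; [exact: intg_e|by apply: intgZ; exact: intg_norm|] => x.
rewrite normrM ler_wpM2r//; apply: (le_trans (hC x)); apply: (le_trans (ler_norm C)).
by rewrite lerDl.
Qed.

Lemma sobolev1_norm0 v : sobolev1_norm k (fun x => v x - v x) = 0.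
Proof.
have -> : (fun x => v x - v x) = (fun=> 0 : R) by apply/funext => x; rewrite subrr.
rewrite /sobolev1_norm big1// => j _.
have wd00 : wd j (fun=> 0 : R) (fun=> 0 : R).
  apply: wdI => [|phi cp]; first exact: loc_cst.
  have z (p : R -> R) : \int[mu]_x (0 * p x) = 0.
    have -> : (fun x => 0 * p x) = (fun=> 0 : R) by apply/funext => x; rewrite mul0r.
    by rewrite Rintegral_cst// mul0r.
  by rewrite !z mulr0.
have := N1_weak_derivative wd00; rewrite /N1 => ->.
by under eq_Rintegral do rewrite normr0; rewrite Rintegral_cst// mul0r.
Qed.

Lemma kernel_closed : closed [set v : W | Lambda1 u v = 0].
Proof.
have [C C0 hC] := Lambda1_continuous.
rewrite -openC openE => v /= Lv; rewrite /interior.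
have r0 : 0 < `|Lambda1 u v| / C by rewrite divr_gt0// normr_gt0; exact/eqP.
apply: (filterS (P := [set w : W | sobolev1_norm k (fun x => w x - v x) < `|Lambda1 u v| / C])).
  move=> w wv Lw; have := hC v w; rewrite Lw sub0r normrN leNgt.
  by rewrite mulrC -ltr_pdivlMr// => /negP; apply; exact: wv.
apply: open_nbhs_nbhs; split; first exact: sobolev1_open_ball.
by rewrite /= sobolev1_norm0.
Qed.

(** The kernel is closed and contains the range, and the range is dense in it. *)
Lemma closure_range :
  closure (range_Dbers_sobolev u (k := k)) = [set v : W | Lambda1 u v = 0].
Proof.
apply/seteqP; split => v.
  move=> cv; rewrite ((closure_id _).1 kernel_closed); move: v cv.
  by apply: closure_subset => v; exact: range_kernel.
move=> /= Lv B Bv; have [F wF hF] := range_dense cu (sobolev1P v) Lv.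
have sF n : sobolev k 1 (F n).
  by apply: wcls_sobolev; apply: wcls_sub wF => G [].
pose w n : W := sval (sobolev1K (sobolevD (sobolev1P v) (sF n))).
have wE n : w n = (fun x => v x + F n x) :> (R -> R) by rewrite /w; case: sobolev1K.
have wv : w n @[n --> \oo] --> v.
  apply: sobolev1_cvg; apply: (cvg_eqfun _ (wcls_null_norm wF)) => n.
  by congr sobolev1_norm; apply/funext => x; rewrite wE addrC addKr.
have [n _ /(_ n (leqnn n)) Bn] := wv B Bv.
exists (w n); split => //; have [h sh e0] := hF n; exists h => //.
by rewrite wE.
Qed.

(** The image lin u S' of a smooth step S lies in the kernel of Lambda1, hence in the
    closure of the range. A preimage h would satisfy exp(-u) (h' - S') = const;
    integrability makes this constant 0, so that h = S + const, which is integrable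
    at no more than one of the two ends. *)
Lemma range_not_closed : ~ closed (range_Dbers_sobolev u (k := k)).
Proof.
move=> cl; have [S stepS] := exists_step R; have [_ _ S0 S1] := stepS.
pose b := S^`(); have Sb : Der S b := step_der stepS.
have cb : cls (@cpt R) b := step_derive_cpt stepS.
have rb : cls (@rd R) b := cls_cpt_rd cb.
have bi : intg b by exact: dom_intg (cls_rd_dom rb).
have [v vE] := sobolev1K (sobolev_rd k (lin_rd cu rb)).
have : closure (range_Dbers_sobolev u (k := k)) v by rewrite closure_range /= vE (Lambda1_lin cu rb).
rewrite -((closure_id _).1 cl) => -[h sh]; rewrite vE => hE.
have [i1 i2 w1 w2] := sobolev_weak_derivatives sh.
set h1 := weak_derivative 1 h in i1 w1 w2; set h2 := weak_derivative 2 h in i2 w2.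
pose d x := h1 x + -1 * b x.
have di : intg d by apply: intgD => //; exact: intgZ.
have wb : wd 1 b b^`() by apply: wd_Der; [exact: cls_derive1 cb|exact: cls_continuous (cls_derivative cb)].
have wdd : wd 1 d (fun x => h2 x + -1 * b^`() x).
  by apply: (wdD (intg_loc i1) _ w2 (wdZ (-1) (intg_loc bi) wb)); apply: locZ; exact: intg_loc.
have [c hc] : exists c : R, (fun x => e x * d x) = cst c %[ae mu].
  apply: wd_zero; first exact: intg_loc (intg_e di).
  apply: (wd_aer _ _ (wd_e (intg_loc di) wdd)); first exact: loc_cst.
  apply: aeS hE => x E xT; have := E xT; rewrite /lin /Dbers_weak -/h1 -/h2 /d /= => E'.
  have -> : h2 x + -1 * b^`() x - u^`() x * (h1 x + -1 * b x) =
    2 * (2^-1 * (h2 x - u^`() x * h1 x) - 2^-1 * (b^`() x - u^`() x * b x)) by field.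
  by rewrite -E' subrr !mulr0.
have c0 : c = 0.
  apply: (ae_cst0_intg (intg_e di)) => n; exists 0.
  by apply: aeS hc => x E _; exact: E.
have hb : h1 = b %[ae mu].
  apply: aeS hc => x E xT; have := E xT; rewrite c0 /= => /eqP.
  by rewrite mulf_eq0 gt_eqF ?expR_gt0//= /d => /eqP; lra.
have hi := sobolev_intg sh; have lh := intg_loc hi.
have lS : loc S by exact: loc_cont (Der_continuous Sb).
have wS : wd 1 S b by exact: wd_Der Sb (cls_continuous cb).
have [a ha] : exists a : R, (fun x => h x + -1 * S x) = cst a %[ae mu].
  apply: wd_zero; first by apply: locD => //; exact: locZ.
  apply: (wd_aer _ _ (wdD lh (locZ (-1) lS) w1 (wdZ (-1) lS wS))); first exact: loc_cst.
  by apply: aeS hb => x E xT; rewrite /= E//; lra.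
have a0 : a = 0.
  apply: (ae_cst0_intg hi) => n; exists (- n%:R); apply: aeS ha => x E /andP[_ x0].
  by have := E I; rewrite S0 /=; [lra|move: x0; lra].
have a1 : 1 + a = 0.
  apply: (ae_cst0_intg hi) => n; exists 1; apply: aeS ha => x E /andP[x1 _].
  by have := E I; rewrite S1 //=; lra.
by move: a1; rewrite a0 addr0 => /eqP; rewrite oner_eq0.
Qed.

End fixed_k.
End with_u.
End sobolev_range.

(** * The differential of the Bers map and zero-energy scattering *)

Theorem theorem4 (R : realType) (phi : R -> R) (hphi : diffeo_schwartz phi)
    (x0 : R) :
  let q := bers phi in
  let u := log_derivative phi in
  let L1 := Lambda1 u in
  let L2 := Lambda2 u x0 in
  let range_S := [set v : schwartzType R |
    exists h : schwartzType R, Dbers u h = v :> (R -> R)] in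
  [/\
    (* (a) *)
    [/\ forall h : schwartzType R, Dbers u h \in @schwartz R,
        range_S = [set v : schwartzType R | L1 v = 0 /\ L2 v = 0],
        closed range_S,
        split_subspace range_S &
        codimension 2 range_S],
    (* (b) *)
    forall (v : schwartzType R) (x : R),
      is_derive (0 : R) (1 : R)
        (fun eps : R => jost_wronskian0 (fun y => q y + eps * v y) x)
        (real_complex R (L1 v)),
    (* (c) *)
    forall v : schwartzType R, L1 v = 0 ->
      exists (d : R) (Q : R -> schwartzType R),
        [/\ 0 < d,
            smooth_curve_on `]- d, d[ Q,
            Q 0 = q :> (R -> R),
            curve_derivative Q 0 v &
            (forall eps, eps \in `]- d, d[ ->
              [/\ exceptional (Q eps),
                  forall lam, lam < 0 -> ~ is_eigenvalue (Q eps) lam &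
                  cvg (reflection (Q eps) k @[k --> (0 : R)^'])]) /\
            (fun eps : R => reflection0 (Q eps) - real_complex R (eps * L2 v))
              =O_ (0 : R) (fun eps : R => eps ^+ 2)] &
    (* (d) *)
    forall k : nat,
      [/\ forall h, sobolev k.+2 1 h -> sobolev k 1 (Dbers_weak u h),
          ~ closed (range_Dbers_sobolev u (k := k)) &
          closure (range_Dbers_sobolev u (k := k))
            = [set v : sobolev1Type R k | L1 v = 0]]
  ].

Proof.
move=> q u L1 L2 range_S.
have [cu qE] := log_derivative_rd hphi.
have {}qE : q = pot u^`() by [].
split.
- have [h1 h2 h3] := schwartz_range x0 cu.
  by split => //; [exact: Dbers_schwartz|exact: range_DbersE].
- by move=> v x; rewrite qE; exact: (wronskian_variation cu (schwartz_cls v) x).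
- move=> v Lv; have [Q [Q1 Q2 Q3 Q4 Q5]] := exceptional_curve x0 cu Lv.
  exists 1, Q; split => //; first by rewrite qE.
  split=> // eps _; have [w [g [wg cg QE h1 h2]]] := Q4 eps.
  split=> // lam lam0; rewrite QE; exact: (no_negative_eigenvalue wg cg lam0).
- move=> k; split; [exact: Dbers_weak_sobolev|exact: range_not_closed|exact: closure_range].
Qed.
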